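(* Let $q\ge1$. (1) If $q=o(d/\log d)$ and $dq=\tilde\omega(n^3)$, then $\mathsf{TV}\big(\mathsf{RGG}(n,\mathbb{T}^d,\mathsf{Unif},\sigma^q_{1/2},1/2),\ \mathsf{G}(n,1/2)\big)=o(1)$. (2) If $q=\Omega(d/\log d)$ and $d^2=\tilde\omega(n^3)$, then $\mathsf{TV}\big(\mathsf{RGG}(n,\mathbb{T}^d,\mathsf{Unif},\sigma^q_{1/2},1/2),\ \mathsf{G}(n,1/2)\big)=o(1)$.
   Context: Torus $\mathbb{T}^d=\mathbb{R}^d/2\mathbb{Z}^d$ (product of $d$ circles of circumference 2) with uniform measure; $|x-y|_C\in[0,1]$ is circular distance; $\|\mathbf{x}-\mathbf{y}\|_q=(\sum_{i=1}^d|x_i-y_i|_C^q)^{1/q}$. $\tau^q_{1/2}$ satisfies $\mathbf{P}[\|\mathbf{x}-\mathbf{y}\|_q\le\tau^q_{1/2}]=1/2$ for iid uniform $\mathbf{x},\mathbf{y}$. $\mathsf{RGG}(n,\mathbb{T}^d,\mathsf{Unif},\sigma^q_{1/2},1/2)$: iid uniform latent points $\mathbf{x}^1,\dots,\mathbf{x}^n$ on $\mathbb{T}^d$; edge $ij$ iff $\|\mathbf{x}^i-\mathbf{x}^j\|_q\le\tau^q_{1/2}$. $\mathsf{G}(n,1/2)$ is Erdős–Rényi. Asymptotics are as $n\to\infty$; $\tilde\omega$ hides polylogarithmic factors. *)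

(* Defs.v *)
From HB Require Import structures.
From mathcomp Require Import all_boot all_order all_algebra.
From mathcomp Require Import all_classical all_reals all_analysis.
Set Implicit Arguments. Unset Strict Implicit. Unset Printing Implicit Defensive.
Import Order.TTheory GRing.Theory Num.Theory.
Local Open Scope ring_scope.
Local Open Scope classical_set_scope.

(* Expectation of f(x_1,...,x_k) for x_1,...,x_k iid uniform on [0,2]
   (the fundamental domain of the circle R/2Z), as an iterated Lebesgue
   integral (= integral against the normalized product measure, by Tonelli,
   for the nonnegative measurable indicators used below). *)
Fixpoint unif_iint (R : realType) (k : nat) (f : seq R -> \bar R) : \bar R :=
  match k with
  | 0 => f [::]
  | k'.+1 => ((2:R)^-1)%:E *
       \int[lebesgue_measure]_(x in `[(0%R : R), (2%R : R)]) unif_iint k' (fun s => f (x :: s))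
  end.

Definition ind (R : realType) (b : bool) : \bar R := if b then 1%E else 0%E.

(* circular distance on R/2Z for representatives in [0,2] *)
Definition circ (R : realType) (x y : R) : R := Num.min `|x - y| (2 - `|x - y|).

Definition qdist (R : realType) (d : nat) (q : R) (x y : nat -> R) : R :=
  (\sum_(j < d) (circ (x j) (y j)) `^ q) `^ (q^-1).

Definition is_median_thr (R : realType) (d : nat) (q tau : R) : Prop :=
  unif_iint (d + d) (fun s => ind R (qdist d q (fun j => nth 0 s j)
                                            (fun j => nth 0 s (d + j)) <= tau))
  = ((2:R)^-1)%:E.

Definition simple_graphs (n : nat) : {set {set 'I_n * 'I_n}} :=
  [set E : {set 'I_n * 'I_n} | E \subset [set p : 'I_n * 'I_n | (p.1 < p.2)%N]].

(* latent points x^i in [0,2]^d read off a flat coordinate list s of length n*d *)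
Definition config (R : realType) (n d : nat) (s : seq R) : 'I_n -> nat -> R :=
  fun i j => nth 0 s (i * d + j).

Definition rgg_edges (R : realType) (n d : nat) (q tau : R) (x : 'I_n -> nat -> R)
  : {set 'I_n * 'I_n} :=
  [set p : 'I_n * 'I_n | (p.1 < p.2)%N && (qdist d q (x p.1) (x p.2) <= tau)].

Definition rgg_prob (R : realType) (n d : nat) (q tau : R) (E : {set 'I_n * 'I_n}) : R :=
  fine (unif_iint (n * d) (fun s => ind R (@rgg_edges R n d q tau (@config R n d s) == E))).

Definition er_prob (R : realType) (n : nat) : R := ((2:R)^-1) ^+ 'C(n, 2).

Definition tv_rgg_er (R : realType) (n d : nat) (q tau : R) : R :=
  (2:R)^-1 * \sum_(E in simple_graphs n) `|@rgg_prob R n d q tau E - er_prob R n|.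

(* Main.v *)
(** Reveal the vertices one at a time. By Pinsker's inequality and the chain rule for relative
    entropy, the squared total variation distance is at most the sum over [k < n] of
    [E (prod_(i < k) (1 + c_i)) - 1], where [c_i] is the conditional covariance, given two
    independent latent points [x] and [y], of the edge signs joining them to the point [z] of
    vertex [i]. The mean of [c_i] over [y] vanishes: every [z] is adjacent to a random point with
    probability exactly 1/2.

    Bound the product by [exp (sum_i c_i)] and integrate the coordinates of [y] one at a time.
    A coordinate of [z] can change an edge only if it lies within [Dl ~ ln d / q] of the antipode
    of the corresponding coordinate (elsewhere its [q]-th power is negligible), and only if the
    remaining coordinates leave the [q]-th power distance within [1] of the threshold. For [x] and
    [y] together the former forces their coordinates to be within [2 Dl], and the latter has
    probability [O(min(1, q / d))] by a two-dimensional local limit bound, proved with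
    characteristic functions and valid unless the two families of summands are nearly collinear.
    To ensure the latter, the coordinates of [y] are integrated in two halves, each half being
    generic with high probability while the other one is integrated. So the exponential
    martingale bound gives a total variance of order [n^2 d Dl^3 min(1, q / d)^2], whose product with
    [n] is [n^3 / (d q)] in the first regime and [n^3 / d^2] in the second, up to logarithms. *)
From HB Require Import structures.
From mathcomp Require Import all_boot all_order all_algebra.
From mathcomp Require Import all_classical all_reals all_analysis.
From mathcomp Require Import measurable_realfun.
From mathcomp Require Import ring lra zify.
Require Import Defs.
Set Implicit Arguments. Unset Strict Implicit. Unset Printing Implicit Defensive.
Import Order.TTheory GRing.Theory Num.Theory.
Import numFieldNormedType.Exports.
Local Open Scope ring_scope.
Local Open Scope classical_set_scope.

(** * Functions of an environment of named coordinates, and integration of one coordinate *)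

Section Environment.
Context {R : realType} {disp : measure_display} {T : measurableType disp}.
Context {I : eqType}.

(** On a circle the law of the distance is the same whichever end point is resampled, so the
    increment of [c_i] when [y_j] is integrated out is a covariance of two edge signs in the single
    variable [z_j]. It vanishes unless both edges are still undecided when coordinate [j] is left
    out; this is where the local limit bound enters.

    That bound asks that the covariances of the two families add up to at most half of the total
    variance, an event about the very coordinates of [y] that are being integrated. For the half not
    being integrated the event is either frozen or averaged: in the first case it is constant, in
    the second its failure, of probability exponentially small in [d], is added to the bound on the
    increments.

    When the threshold left for coordinate [j] is almost zero, its [q]-th root need not be close to
    1 and nothing confines [z_j] to the antipode; such thresholds are charged to a separate error,
    made negligible by a cutoff polynomially small in [d].

    Expectations are iterated integrals over named coordinates. Independence is then absence of a
    name, and no product measure is formed. *)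

Definition upd (e : I -> T) (i : I) (x : T) : I -> T :=
  fun j => if j == i then x else e j.

Definition measenv d (X : measurableType d) (g : X -> I -> T) : Prop :=
  forall i, measurable_fun setT (fun x => g x i).

(* Measurability of a function of the environment is tested on measurable
   families of environments: no sigma-algebra on [I -> T] is needed. *)
Definition mbool (b : (I -> T) -> bool) : Prop :=
  forall d (X : measurableType d) (g : X -> I -> T), measenv g ->
    measurable_fun setT (fun x => b (g x)).

(** Boundedness keeps every integral finite, so that linearity and Fubini need no further side
    condition. *)
Definition bm (F : (I -> T) -> R) : Prop :=
  (forall d (X : measurableType d) (g : X -> I -> T), measenv g ->
    measurable_fun setT (fun x => F (g x)))
  /\ exists M, forall e, `|F e| <= M.

Definition indep (i : I) (U : Type) (F : (I -> T) -> U) : Prop :=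
  forall e x, F (upd e i x) = F e.

Lemma upd_id e i x y : upd (upd e i x) i y = upd e i y.
Proof. by apply/funext => j; rewrite /upd; case: eqP. Qed.

Lemma updC e i j x y : i != j -> upd (upd e i x) j y = upd (upd e j y) i x.
Proof.
move=> ij; apply/funext => k; rewrite /upd.
by case: (eqVneq k j) => // ->; rewrite eq_sym (negbTE ij).
Qed.

Lemma upd_same e i x : upd e i x i = x.
Proof. by rewrite /upd eqxx. Qed.

Lemma upd_diff e i j x : j != i -> upd e i x j = e j.
Proof. by rewrite /upd => /negbTE ->. Qed.

Lemma measenv_upd d (X : measurableType d) (g : X -> I -> T) (f : X -> T) i :
  measenv g -> measurable_fun setT f -> measenv (fun x => upd (g x) i (f x)).
Proof. by move=> mg mf j; rewrite /upd; case: eqP => // _; exact: mg. Qed.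

Lemma measenv_cst d (X : measurableType d) e : measenv (fun _ : X => e).
Proof. by move=> j; exact: measurable_cst. Qed.

Lemma measenv_comp d (X : measurableType d) d' (Y : measurableType d')
  (g : X -> I -> T) (f : Y -> X) :
  measenv g -> measurable_fun setT f -> measenv (fun x => g (f x)).
Proof. by move=> mg mf j; apply: (measurableT_comp (mg j)). Qed.

Lemma bm_cst (c : R) : bm (fun _ => c).
Proof. by split; [move=> *; exact: measurable_cst | exists `|c|]. Qed.

Lemma bmD F G : bm F -> bm G -> bm (fun e => F e + G e).
Proof.
move=> [mF [M FM]] [mG [N GN]]; split.
  by move=> d X g mg; apply: measurable_funD; [exact: mF | exact: mG].
exists (M + N) => e; apply: (le_trans (ler_normD _ _)); exact: lerD.
Qed.

Lemma bmN F : bm F -> bm (fun e => - F e).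
Proof.
move=> [mF [M FM]]; split.
  by move=> d X g mg; apply: measurableT_comp => //; exact: mF.
by exists M => e; rewrite normrN.
Qed.

Lemma bmB F G : bm F -> bm G -> bm (fun e => F e - G e).
Proof. by move=> bF bG; apply: bmD => //; exact: bmN. Qed.

Lemma bmM F G : bm F -> bm G -> bm (fun e => F e * G e).
Proof.
move=> [mF [M FM]] [mG [N GN]]; split.
  by move=> d X g mg; apply: measurable_funM; [exact: mF | exact: mG].
exists (M * N) => e; rewrite normrM; exact: ler_pM.
Qed.

Lemma bmX F n : bm F -> bm (fun e => F e ^+ n).
Proof.
move=> bF; elim: n => [|n IH].
  by rewrite (_ : (fun _ => _) = fun=> 1); [exact: bm_cst|].
rewrite (_ : (fun _ => _) = (fun e => F e * F e ^+ n)); first exact: bmM.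
by apply/funext => e; rewrite exprS.
Qed.

Lemma bm_norm F : bm F -> bm (fun e => `|F e|).
Proof.
move=> [mF [M FM]]; split.
  by move=> d X g mg; apply: measurableT_comp => //; exact: mF.
by exists M => e; rewrite normr_id.
Qed.

Lemma bm_expR F : bm F -> bm (fun e => expR (F e)).
Proof.
move=> [mF [M FM]]; split.
  by move=> d X g mg; apply: measurableT_comp => //; exact: mF.
exists (expR M) => e; rewrite gtr0_norm ?expR_gt0// ler_expR.
exact: le_trans (ler_norm _) (FM e).
Qed.

Lemma bm_cos F : bm F -> bm (fun e => cos (F e)).
Proof.
move=> [mF _]; split; last by exists 1 => e; exact: cos_max.
move=> d X g mg; apply: (measurableT_comp (f := @cos R)); last exact: mF.
by apply: continuous_measurable_fun; exact: continuous_cos.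
Qed.

Lemma bm_sin F : bm F -> bm (fun e => sin (F e)).
Proof.
move=> [mF _]; split; last by exists 1 => e; exact: sin_max.
move=> d X g mg; apply: (measurableT_comp (f := @sin R)); last exact: mF.
by apply: continuous_measurable_fun; exact: continuous_sin.
Qed.

Lemma bm_sum (J : Type) (r : seq J) (P : pred J) (F : J -> (I -> T) -> R) :
  (forall j, bm (F j)) -> bm (fun e => \sum_(j <- r | P j) F j e).
Proof.
move=> bF; elim: r => [|j r IH].
  under eq_fun do rewrite big_nil; exact: bm_cst.
under eq_fun do rewrite big_cons.
by case: (P j); [exact: bmD|].
Qed.

Lemma bm_prod (J : Type) (r : seq J) (P : pred J) (F : J -> (I -> T) -> R) :
  (forall j, bm (F j)) -> bm (fun e => \prod_(j <- r | P j) F j e).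
Proof.
move=> bF; elim: r => [|j r IH].
  under eq_fun do rewrite big_nil; exact: bm_cst.
under eq_fun do rewrite big_cons.
by case: (P j); [exact: bmM|].
Qed.

Lemma bm_bool b : mbool b -> bm (fun e => (b e)%:R).
Proof.
move=> mb; split; last by exists 1 => e; case: (b e); rewrite ?normr1 ?normr0.
move=> d X g mg; rewrite (_ : (fun _ => _) = fun x => if b (g x) then 1 else 0).
  by apply: measurable_fun_ifT => //; exact: mb.
by apply/funext => x; case: (b (g x)).
Qed.

Lemma mbool_le F G : bm F -> bm G -> mbool (fun e => F e <= G e).
Proof.
by move=> [mF _] [mG _] d X g mg; apply: measurable_fun_ler; [exact: mF|exact: mG].
Qed.

Lemma mbool_lt F G : bm F -> bm G -> mbool (fun e => F e < G e).
Proof.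
by move=> [mF _] [mG _] d X g mg; apply: measurable_fun_ltr; [exact: mF|exact: mG].
Qed.

Lemma mbool_and b c : mbool b -> mbool c -> mbool (fun e => b e && c e).
Proof. by move=> mb mc d X g mg; apply: measurable_and; [exact: mb|exact: mc]. Qed.

Lemma mbool_neg b : mbool b -> mbool (fun e => ~~ b e).
Proof. by move=> mb d X g mg; apply: measurable_neg; exact: mb. Qed.

Variable mu : probability T R.

Definition E1 (i : I) (F : (I -> T) -> R) (e : I -> T) : R :=
  \int[mu]_x F (upd e i x).

Definition Es (s : seq I) (F : (I -> T) -> R) : (I -> T) -> R := foldr E1 F s.

Lemma bounded_integrable d (X : measurableType d) (P : probability X R) (f : X -> R) :
  measurable_fun setT f -> (exists M, forall x, `|f x| <= M) ->
  P.-integrable setT (EFin \o f).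
Proof.
move=> mf [M fM]; apply: measurable_bounded_integrable => //=.
  by rewrite probability_setT ltry.
exists `|M|; split; first by rewrite num_real.
move=> x Mx y _ /=; apply: (le_trans (fM y)).
by apply: (le_trans (ler_norm _)); exact: ltW.
Qed.

Lemma bm_slice F i e : bm F ->
  measurable_fun setT (fun x => F (upd e i x)).
Proof.
move=> [mF _]; apply: mF; apply: measenv_upd; first exact: measenv_cst.
exact: measurable_id.
Qed.

Lemma slice_integrable F i e : bm F ->
  mu.-integrable setT (EFin \o (fun x => F (upd e i x))).
Proof.
move=> bF; apply: bounded_integrable; first exact: bm_slice.
by case: bF => _ [M FM]; exists M.
Qed.
Local Hint Resolve slice_integrable : core.

Lemma E1_EFin F i e : bm F ->
  (E1 i F e)%:E = (\int[mu]_x (F (upd e i x))%:E)%E.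
Proof.
move=> bF; rewrite /E1 /Rintegral fineK//.
exact: (integrable_fin_num measurableT (slice_integrable i e bF)).
Qed.

Lemma E1_cst c i e : E1 i (fun _ => c) e = c.
Proof.
rewrite /E1 Rintegral_cst//.
have -> : fine (mu setT) = 1 by rewrite (@probability_setT _ _ _ mu).
by rewrite mulr1.
Qed.

Lemma E1D F G i e : bm F -> bm G ->
  E1 i (fun e => F e + G e) e = E1 i F e + E1 i G e.
Proof. by move=> bF bG; rewrite /E1 RintegralD//; exact: slice_integrable. Qed.

Lemma E1Z c F i e : bm F -> E1 i (fun e => c * F e) e = c * E1 i F e.
Proof. by move=> bF; rewrite /E1 RintegralZl//; exact: slice_integrable. Qed.

Lemma E1_le F G i e : bm F -> bm G ->
  (forall x, F (upd e i x) <= G (upd e i x)) -> E1 i F e <= E1 i G e.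
Proof. by move=> bF bG FG; apply: le_Rintegral => //; exact: slice_integrable. Qed.

Lemma E1_eq F G i e :
  (forall x, F (upd e i x) = G (upd e i x)) -> E1 i F e = E1 i G e.
Proof. by move=> FG; apply: eq_Rintegral => x _; exact: FG. Qed.

Lemma E1_indepM F G i e : bm G -> indep i F ->
  E1 i (fun e => F e * G e) e = F e * E1 i G e.
Proof.
move=> bG iF; rewrite -E1Z//; apply: E1_eq => x.
by rewrite iF.
Qed.

Lemma E1_indep F i : indep i F -> E1 i F = F.
Proof.
move=> iF; apply/funext => e; rewrite -[RHS](E1_cst _ i e).
by apply: E1_eq => x; rewrite iF.
Qed.

Lemma indep_E1 F i : indep i (E1 i F).
Proof. by move=> e x; apply: eq_Rintegral => y _; rewrite upd_id. Qed.

Lemma indep_E1_neq F i j : indep i F -> indep i (E1 j F).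
Proof.
move=> iF; have [->|ij] := eqVneq i j; first exact: indep_E1.
by move=> e x; apply: eq_Rintegral => y _; rewrite updC// iF.
Qed.

(** Tonelli gives measurability of a parametrized integral once the integrand has been made
    nonnegative by adding its bound [M]. The same shift serves in [E1C]. *)
Lemma bmE1 F i : bm F -> bm (E1 i F).
Proof.
move=> bF; have [mF [M FM]] := bF; split; last first.
  exists M => e; apply: le_trans (le_normr_Rintegral _ _) _ => //.
    exact: slice_integrable.
  have : E1 i (fun e => `|F e|) e <= E1 i (fun _ => M) e.
    by apply: E1_le; [exact: bm_norm|exact: bm_cst|move=> x; exact: FM].
  by rewrite E1_cst.
move=> d X g mg.
pose f (z : X * T) := (F (upd (g z.1) i z.2) + M)%:E.
have mf : measurable_fun setT f.
  apply/measurable_EFinP; apply: measurable_funD; last exact: measurable_cst.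
  apply: mF; apply: measenv_upd => //; apply: (measenv_comp mg) => //.
have f0 z : (0 <= f z)%E.
  rewrite lee_fin; have := FM (upd (g z.1) i z.2).
  by rewrite ler_norml => /andP[h _]; lra.
have := measurable_fun_fubini_tonelli_F (m2 := mu) f mf f0.
move=> mff.
rewrite (_ : (fun _ => _) = fun x => fine (fubini_F mu f x) - M).
  apply: measurable_funB => //.
  by apply: measurableT_comp => //; exact: fine_measurable.
apply/funext => x; rewrite /fubini_F /f /=.
have := @E1D F (fun=> M) i (g x) bF (bm_cst M).
rewrite E1_cst => h; rewrite -[LHS](addrK M) -h.
by [].
Qed.

Lemma bmEs F s : bm F -> bm (Es s F).
Proof. by move=> bF; elim: s => //= i s IH; exact: bmE1. Qed.

Lemma E1C F i j : bm F -> E1 i (E1 j F) = E1 j (E1 i F).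
Proof.
move=> bF; have [->//|ij] := eqVneq i j; apply/funext => e.
have [mF [M FM]] := bF.
pose G e := F e + M.
have bG : bm G by apply: bmD => //; exact: bm_cst.
have EG k : E1 k G = fun e => E1 k F e + M.
  by apply/funext => e'; rewrite E1D ?E1_cst//; exact: bm_cst.
have G0 e' : 0 <= G e'.
  by rewrite /G; have := FM e'; rewrite ler_norml => /andP[h _]; lra.
suff : E1 i (E1 j G) e = E1 j (E1 i G) e.
  rewrite !EG !E1D ?E1_cst; last first.
  all: try by [exact: bmE1 | exact: bm_cst].
  exact: addIr.
apply: EFin_inj; rewrite !E1_EFin; try exact: bmE1.
under eq_integral do rewrite E1_EFin//.
under [RHS]eq_integral do rewrite E1_EFin//.
pose f (z : T * T) := (G (upd (upd e i z.1) j z.2))%:E.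
have mf : measurable_fun setT f.
  apply/measurable_EFinP; apply bG; apply: measenv_upd => //.
  by apply: measenv_upd => //; exact: measenv_cst.
have f0 z : (0 <= f z)%E by rewrite lee_fin G0.
rewrite (fubini_tonelli (m1 := mu) (m2 := mu) f mf f0).
apply: eq_integral => y _; apply: eq_integral => x _.
by rewrite /f /= updC.
Qed.

End Environment.

(** * Iterated expectations, Cauchy-Schwarz and the exponential martingale bound *)

Section IteratedExpectation.
Context {R : realType} {disp : measure_display} {T : measurableType disp}.
Context {I : eqType} (mu : probability T R).
Implicit Types (F G : (I -> T) -> R) (s t : seq I).
Local Notation E1 := (@E1 R disp T I mu).
Local Notation Es := (@Es R disp T I mu).

Lemma Es_cat s t F : Es (s ++ t) F = Es s (Es t F).
Proof. exact: foldr_cat. Qed.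

Lemma Es_cst s c e : Es s (fun _ => c) e = c.
Proof.
elim: s e => //= i s IH e; rewrite (_ : Es s _ = fun=> c) ?E1_cst//.
by apply/funext.
Qed.

Lemma EsD s F G e : bm F -> bm G ->
  Es s (fun e => F e + G e) e = Es s F e + Es s G e.
Proof.
move=> bF bG; elim: s e => //= i s IH e; rewrite -E1D; try exact: bmEs.
by apply: E1_eq => x; exact: IH.
Qed.

Lemma EsZ s c F e : bm F -> Es s (fun e => c * F e) e = c * Es s F e.
Proof.
move=> bF; elim: s e => //= i s IH e; rewrite -E1Z; try exact: bmEs.
by apply: E1_eq => x; exact: IH.
Qed.

Lemma EsB s F G e : bm F -> bm G ->
  Es s (fun e => F e - G e) e = Es s F e - Es s G e.
Proof.
move=> bF bG; rewrite EsD//; last exact: bmN.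
congr (_ + _); rewrite -mulN1r -EsZ//; congr (Es s _ e).
by apply/funext => e'; rewrite mulN1r.
Qed.

Lemma Es_sum (J : Type) (r : seq J) (P : pred J) (F : J -> (I -> T) -> R) s e :
  (forall j, bm (F j)) ->
  Es s (fun e => \sum_(j <- r | P j) F j e) e = \sum_(j <- r | P j) Es s (F j) e.
Proof.
move=> bF; elim: r => [|j r IH].
  by rewrite big_nil; under eq_fun do rewrite big_nil; rewrite Es_cst.
rewrite big_cons; under eq_fun do rewrite big_cons.
case: (P j) => //; rewrite EsD ?IH//; exact: bm_sum.
Qed.

Lemma Es_le s F G e : bm F -> bm G -> (forall e, F e <= G e) -> Es s F e <= Es s G e.
Proof.
move=> bF bG FG; elim: s e => //= i s IH e.
by apply: E1_le => //; exact: bmEs.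
Qed.

Lemma Es_ge0 s F e : bm F -> (forall e, 0 <= F e) -> 0 <= Es s F e.
Proof.
move=> bF F0; rewrite -[leLHS](Es_cst s 0 e).
by apply: Es_le => //; exact: bm_cst.
Qed.

Lemma Es_le_cst s F c e : bm F -> (forall e, F e <= c) -> Es s F e <= c.
Proof.
move=> bF Fc; rewrite -[leRHS](Es_cst s c e).
by apply: Es_le => //; exact: bm_cst.
Qed.

Lemma Es_norm s F e : bm F -> `|Es s F e| <= Es s (fun e => `|F e|) e.
Proof.
move=> bF; have bn := bm_norm bF; rewrite ler_norml; apply/andP; split.
  rewrite lerNl -mulN1r -EsZ//; apply: Es_le => //.
    by apply: bmM => //; exact: bm_cst.
  by move=> e'; rewrite mulN1r -normrN ler_norm.
by apply: Es_le => // e'; exact: ler_norm.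
Qed.

Lemma indep_Es s F i : indep i F -> indep i (Es s F).
Proof. by move=> iF; elim: s => //= j s IH; exact: indep_E1_neq. Qed.

Lemma indep_Es_in s F i : i \in s -> indep i (Es s F).
Proof.
elim: s => //= j s IH; rewrite inE => /orP[/eqP <-|/IH].
  exact: indep_E1.
exact: indep_E1_neq.
Qed.

Lemma Es_indepM s F G e : bm G -> {in s, forall i, indep i F} ->
  Es s (fun e => F e * G e) e = F e * Es s G e.
Proof.
move=> bG; elim: s e => //= i s IH e iF.
rewrite -E1_indepM; last exact: (iF i (mem_head _ _)); last exact: bmEs.
apply: E1_eq => x; apply: IH => j js; apply: iF.
by rewrite inE js orbT.
Qed.

Lemma Es_indep s F : {in s, forall i, indep i F} -> Es s F = F.
Proof.
elim: s => //= i s IH iF; rewrite IH; last first.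
  by move=> j js; apply: iF; rewrite inE js orbT.
exact/E1_indep/iF/mem_head.
Qed.

Lemma E1_Es i s F : bm F -> E1 i (Es s F) = Es s (E1 i F).
Proof.
by move=> bF; elim: s => //= j s IH; rewrite E1C ?IH//; exact: bmEs.
Qed.

Lemma EsC s t F : bm F -> Es s (Es t F) = Es t (Es s F).
Proof.
move=> bF; elim: s => //= i s ->; rewrite E1_Es//; exact: bmEs.
Qed.

Lemma Es_perm s t F : perm_eq s t -> bm F -> Es s F = Es t F.
Proof.
move=> + bF; elim: s t => [|i s IH] t st /=.
  by have := perm_size st; case: t {st}.
have : i \in t by rewrite -(perm_mem st) mem_head.
move=> it; case/splitPr: it st => t1 t2 st.
rewrite (IH (t1 ++ t2)); last first.
  by rewrite -(perm_cons i) (perm_trans st)// perm_sym -cat1s perm_catCA.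
rewrite !Es_cat /= E1_Es//; exact: bmEs.
Qed.

Lemma Es_E1_in i s F : i \in s -> bm F -> Es s (E1 i F) = Es s F.
Proof.
by move=> is_ bF; rewrite -E1_Es// E1_indep//; exact: indep_Es_in.
Qed.

Lemma Es_Es_sub s t F : {subset t <= s} -> bm F -> Es s (Es t F) = Es s F.
Proof.
move=> ts bF; rewrite EsC//; apply: Es_indep => i /ts; exact: indep_Es_in.
Qed.

Lemma EsM2 s t F G e : bm F -> bm G ->
  {in t, forall i, indep i F} -> {in s, forall i, indep i G} ->
  Es s (Es t (fun e => F e * G e)) e = Es s F e * Es t G e.
Proof.
move=> bF bG iF iG.
rewrite (_ : Es t _ = fun e => Es t G e * F e); last first.
  by apply/funext => e'; rewrite Es_indepM// mulrC.
rewrite Es_indepM 1?mulrC// => i /iG; exact: indep_Es.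
Qed.

Lemma Es_prod s (A : I -> (I -> T) -> R) e : uniq s -> (forall i, bm (A i)) ->
  (forall i j, i \in s -> j \in s -> i != j -> indep j (A i)) ->
  Es s (fun e => \prod_(i <- s) A i e) e = \prod_(i <- s) E1 i (A i) e.
Proof.
move=> + bA; elim: s e => [|i s IH] e /=.
  by rewrite !big_nil.
case/andP=> is_ us iA; rewrite big_cons.
rewrite (_ : Es s _ = fun e => A i e * Es s (fun e => \prod_(j <- s) A j e) e);
  last first.
  apply/funext => e'; rewrite -Es_indepM; first last.
  - move=> j js; apply: iA; rewrite ?inE ?eqxx ?js ?orbT//.
    by apply: contraNneq is_ => ->.
  - exact: bm_prod.
  by congr (Es s _ e'); apply/funext => e''; rewrite big_cons.
rewrite (_ : (fun e => _) = fun e => (\prod_(j <- s) E1 j (A j) e) * A i e);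
  last first.
  apply/funext => e'; rewrite mulrC IH//.
  by move=> j k js ks; apply: iA; rewrite inE ?js ?ks orbT.
rewrite E1_indepM//; first by rewrite mulrC.
move=> e' x; rewrite [RHS]big_seq [LHS]big_seq; apply: eq_bigr => j js.
apply: indep_E1_neq; apply: iA; rewrite ?inE ?eqxx ?js ?orbT//.
by apply: contraNneq is_ => <-.
Qed.

(** Integrated coordinates are bound variables, so a renaming can be moved to the integrand and the
    outer environment. Only exchanges of two vertices are needed, and an involution is its own
    inverse. *)
Lemma Es_rename (sg : I -> I) s F e : involutive sg ->
  Es (map sg s) F e = Es s (fun e => F (fun i => e (sg i))) (fun i => e (sg i)).
Proof.
move=> sgK; elim: s e => [|i s IH] e /=.
  by congr F; apply/funext => i; rewrite sgK.
apply: eq_Rintegral => x _; rewrite IH; congr (Es s _ _).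
apply/funext => j; rewrite /upd.
by rewrite (inj_eq (inv_inj sgK)).
Qed.

(** The discriminant criterion. In the degenerate case [c = 0] with [b != 0], the value
    [t = - (a + 1) / (2 * b)] would make the form equal to -1. *)
Lemma quadratic_ge0 (a b c : R) : 0 <= a -> 0 <= c ->
  (forall t : R, 0 <= a + 2 * t * b + t ^+ 2 * c) -> b ^+ 2 <= a * c.
Proof.
move=> a0 c0 H; have [c00|c00] := eqVneq c 0.
  have [->|b0] := eqVneq b 0; first by rewrite expr0n mulr_ge0.
  have := H (- (a + 1) / (2 * b)); rewrite c00 mulr0 addr0.
  have -> : a + 2 * (- (a + 1) / (2 * b)) * b = -1 by field.
  by rewrite lerNr oppr0 ler10.
have cp : 0 < c by rewrite lt_neqAle eq_sym c00.
have := H (- b / c).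
have -> : a + 2 * (- b / c) * b + (- b / c) ^+ 2 * c = (a * c - b ^+ 2) / c.
  by field.
by rewrite pmulr_lge0 ?invr_gt0// subr_ge0.
Qed.

Lemma Es_CauchySchwarz s (W F G : (I -> T) -> R) e : bm W -> bm F -> bm G ->
  (forall e, 0 <= W e) ->
  Es s (fun e => W e * (F e * G e)) e ^+ 2 <=
  Es s (fun e => W e * F e ^+ 2) e * Es s (fun e => W e * G e ^+ 2) e.
Proof.
move=> bW bF bG W0.
have bFF : bm (fun e => W e * F e ^+ 2) by apply: bmM => //; exact: bmX.
have bGG : bm (fun e => W e * G e ^+ 2) by apply: bmM => //; exact: bmX.
have bFG : bm (fun e => W e * (F e * G e)) by do 2 apply: bmM => //.
apply: quadratic_ge0; try by apply: Es_ge0 => // e'; rewrite mulr_ge0// sqr_ge0.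
move=> u; rewrite -!EsZ// -!EsD//; last first.
- by apply: bmM => //; exact: bm_cst.
- by apply: bmM => //; exact: bm_cst.
- by apply: bmD => //; apply: bmM => //; exact: bm_cst.
apply: Es_ge0 => [|e'].
  by repeat first [exact: bFF | exact: bGG | exact: bFG | exact: bm_cst
                  | apply: bmD | apply: bmM].
rewrite (_ : _ + _ = W e' * (F e' + u * G e') ^+ 2); last by ring.
by rewrite mulr_ge0// sqr_ge0.
Qed.

(** From [expR x * (1 - x) <= 1] and [(1 + x + 2 x^2) (1 - x) = 1 + x^2 (1 - 2 x) >= 1]. *)
Lemma expR_le_quadratic (x : R) : `|x| <= 1 / 2 -> expR x <= 1 + x + 2 * x ^+ 2.
Proof.
rewrite ler_norml => /andP[x1 x2].
have h : 1 - x <= expR (- x) by have := expR_ge1Dx (- x).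
have h0 : 0 < 1 - x by lra.
have : expR x * (1 - x) <= 1.
  by rewrite -[leRHS](expRxMexpNx_1 x) ler_wpM2l ?expR_ge0.
have h2 : 0 <= 1 + x + 2 * x ^+ 2 by nra.
have h3 : 1 <= (1 + x + 2 * x ^+ 2) * (1 - x).
  have : 0 <= x ^+ 2 * (1 - 2 * x) by apply: mulr_ge0; [exact: sqr_ge0|lra].
  by nra.
move=> h4; rewrite -(ler_pM2r h0); exact: le_trans h4 h3.
Qed.

(* Exponential martingale bound: integrating out the coordinates one at a time,
   each costs a factor [1 + 2 V i]. *)
Lemma Es_expR_le s F (b : I -> (I -> T) -> R) (V : I -> R) e : uniq s -> bm F ->
  (forall i, bm (b i)) ->
  (forall i j, i \in s -> j \in s -> i != j -> indep j (b i)) ->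
  (forall i e, i \in s -> `|F e - E1 i F e| <= b i e) ->
  (forall i e, i \in s -> b i e <= 1 / 2) ->
  (forall i e, i \in s -> E1 i (fun e => b i e ^+ 2) e <= V i) ->
  Es s (fun e => expR (F e)) e <= expR (Es s F e + 2 * \sum_(i <- s) V i).
Proof.
move=> + bF bb; elim: s e => [|i s IH] e /=.
  by rewrite big_nil mulr0 addr0.
case/andP=> is_ us ib Fb b1 bV.
have si j : j \in s -> j \in i :: s by rewrite inE => ->; rewrite orbT.
have {}IH e' : Es s (fun e => expR (F e)) e' <=
    expR (Es s F e' + 2 * \sum_(i <- s) V i).
  apply: IH => // [j k /si ? /si ?|j e'' /si|j e'' /si|j e'' /si].
  - exact: ib.
  - exact: Fb.
  - exact: b1.
  - exact: bV.
set c := 2 * \sum_(j <- s) V j in IH.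
pose G := Es s F.
have bG : bm G by exact: bmEs.
have bm_ : bm (E1 i G) by exact: bmE1.
(* Averaging over the remaining coordinates preserves the increment bound, because [b i] does not
   depend on them. *)
have Gb e' : `|G e' - E1 i G e'| <= b i e'.
  rewrite /G E1_Es// -EsB//; last exact: bmE1.
  have bi : Es s (b i) = b i.
    apply: Es_indep => j js; apply: ib; rewrite ?inE ?eqxx ?js ?orbT//.
    by apply: contraNneq is_ => ->.
  have bD : bm (fun e => F e - E1 i F e) by apply: bmB => //; exact: bmE1.
  rewrite -bi; apply: (le_trans (Es_norm _ _ bD)); apply: Es_le => //.
    exact: bm_norm.
  by move=> e''; apply: Fb; rewrite mem_head.
(* The linear term [G e - E1 i G e] integrates to zero over coordinate [i], so only the quadratic
   term survives. *)
apply: (@le_trans _ _ (E1 i (fun e => expR (E1 i G e + c) *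
    (1 + ((G e - E1 i G e) + 2 * (b i e) ^+ 2))) e)).
  apply: E1_le.
  - by apply: bmEs; exact: bm_expR.
  - apply: bmM; first by apply/bm_expR/bmD => //; exact: bm_cst.
    apply: bmD; first exact: bm_cst.
    apply: bmD; first exact: bmB.
    by apply: bmM; [exact: bm_cst|exact: bmX].
  - move=> x; set e' := upd e i x; apply: (le_trans (IH e')).
    rewrite -/(G e') (_ : G e' + c = (E1 i G e' + c) + (G e' - E1 i G e')); last by ring.
    rewrite expRD ler_wpM2l ?expR_ge0//.
    apply: le_trans (expR_le_quadratic _) _.
      exact: le_trans (Gb e') (b1 _ _ (mem_head _ _)).
    rewrite [leRHS]addrA lerD2l ler_wpM2l// -(real_normK (num_real _)).
    have b0 : 0 <= b i e' by exact: le_trans (Gb e').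
    by rewrite ler_sqr ?nnegrE.
rewrite E1_indepM; first last.
- by move=> e' x; rewrite (indep_E1 mu G).
- apply: bmD; first exact: bm_cst.
  apply: bmD; first exact: bmB.
  by apply: bmM; [exact: bm_cst|exact: bmX].
have bX : bm (fun e => b i e ^+ 2) by exact: bmX.
have bcX : bm (fun e => 2 * b i e ^+ 2) by apply: bmM => //; exact: bm_cst.
have bBG : bm (fun e => G e - E1 i G e) by exact: bmB.
rewrite E1D; [|exact: bm_cst|exact: bmD].
rewrite E1D// E1_cst E1Z// -[E1 i (fun e => G e - _) e]/(Es [:: i] _ e) EsB//=.
rewrite [E1 i (E1 i G)]E1_indep; last exact: indep_E1.
rewrite subrr add0r big_cons.
have -> : E1 i (Es s F) e + 2 * (V i + \sum_(j <- s) V j) =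
    (E1 i G e + c) + 2 * V i by rewrite /c /G; ring.
rewrite [leRHS]expRD ler_wpM2l ?expR_ge0//.
apply: le_trans (expR_ge1Dx _).
by rewrite lerD2l ler_wpM2l// bV// mem_head.
Qed.

End IteratedExpectation.

(** * Functions determined by a set of coordinates *)

Section Dependence.
Context {R : realType} {disp : measure_display} {T : measurableType disp}.
Context {I : eqType} (mu : probability T R).

(** Stronger than [indep] at every coordinate outside [S]: the two environments may differ at
    infinitely many places. *)
Definition depends (S : pred I) (U : Type) (F : (I -> T) -> U) : Prop :=
  forall e e', (forall i, S i -> e i = e' i) -> F e = F e'.

Lemma dependsW (S S' : pred I) (U : Type) (F : (I -> T) -> U) :
  (forall i, S i -> S' i) -> depends S F -> depends S' F.
Proof. by move=> SS' dF e e' ee'; apply: dF => i /SS'; exact: ee'. Qed.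

Lemma depends_indep (S : pred I) (U : Type) (F : (I -> T) -> U) i :
  ~~ S i -> depends S F -> indep i F.
Proof.
move=> Si dF e x; apply: dF => j Sj; rewrite upd_diff//.
by apply: contraNneq Si => <-.
Qed.

Lemma depends_Es (S : pred I) s (F : (I -> T) -> R) :
  depends S F -> depends (fun i => S i && (i \notin s)) (Es mu s F).
Proof.
move=> dF; elim: s => [|i s IH] /=.
  by apply: dependsW dF => i ->.
move=> e e' ee'; apply: eq_Rintegral => x _; apply: IH => j /andP[Sj js].
rewrite /upd; case: eqVneq => // ji; apply: ee'.
by rewrite Sj inE negb_or ji.
Qed.

Lemma depends_prod (S : pred I) (J : Type) (r : seq J) (P : pred J)
    (F : J -> (I -> T) -> R) :
  (forall j, P j -> depends S (F j)) ->
  depends S (fun e => \prod_(j <- r | P j) F j e).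
Proof. by move=> dF e e' ee'; apply: eq_bigr => j Pj; exact: dF. Qed.

End Dependence.

(** * Averages over all subsets, with membership read as a random sign *)

Section SubsetAverages.
Context {R : realType} {P : finType} (K : {set P}).
Implicit Types (G : {set P}) (p : P).

Definition esign G p : R := if p \in G then 1 else -1.
Definition toggle p G : {set P} := if p \in G then G :\ p else p |: G.

Lemma toggleK p : involutive (toggle p).
Proof.
move=> G; rewrite /toggle; case: (boolP (p \in G)) => pG.
  by rewrite finset.setD11 finset.setD1K.
by rewrite finset.setU11 finset.setU1K.
Qed.

Lemma esign_toggle p G : esign (toggle p G) p = - esign G p.
Proof.
rewrite /esign /toggle; case: (boolP (p \in G)) => pG.
  by rewrite finset.setD11.
by rewrite finset.setU11 opprK.
Qed.

Lemma esign_toggle_neq p p' G : p' != p -> esign (toggle p G) p' = esign G p'.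
Proof.
move=> pp'; rewrite /esign /toggle; case: (boolP (p \in G)) => pG.
  by rewrite finset.in_setD1 pp'.
by rewrite finset.in_setU1 (negbTE pp').
Qed.

Lemma toggle_sub p G : p \in K -> (toggle p G \subset K) = (G \subset K).
Proof.
move=> pK; rewrite /toggle; case: (boolP (p \in G)) => pG.
  by rewrite -[in RHS](finset.setD1K pG) finset.subUset finset.sub1set pK.
by rewrite finset.subUset finset.sub1set pK.
Qed.

(** [toggle p] permutes the subsets of [K], flips the sign of [p] and leaves [A] unchanged, so the
    sum equals its opposite. *)
Lemma sum_esign (A : {set P} -> R) p : p \in K -> (forall G, A (toggle p G) = A G) ->
  \sum_(G : {set P} | G \subset K) A G * esign G p = 0.
Proof.
move=> pK iA; set S := \sum_(_ | _) _; suff : S = - S by lra.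
rewrite {1}/S (reindex_inj (inv_inj (@toggleK p))) -sumrN /=.
by apply: eq_big => [G|G _]; rewrite ?toggle_sub// iA esign_toggle mulrN.
Qed.

(** Under a uniform random subset the signs of distinct elements are independent and centered, hence
    each factor contributes its constant term only. *)
Lemma sum_prod_esign (A : {set P} -> R) (r : seq P) (al be : P -> R) :
  uniq r -> {subset r <= K} ->
  (forall p G, p \in r -> A (toggle p G) = A G) ->
  \sum_(G : {set P} | G \subset K) A G * \prod_(p <- r) (al p + esign G p * be p) =
  (\prod_(p <- r) al p) * \sum_(G : {set P} | G \subset K) A G.
Proof.
elim: r A => [|p r IH] A /=.
  by move=> _ _ _; rewrite big_nil mul1r; apply: eq_bigr => G _; rewrite big_nil mulr1.
case/andP=> pr ur rK iA.
have pK : p \in K by apply: rK; rewrite mem_head.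
under eq_bigr do rewrite big_cons mulrA.
rewrite (IH (fun G => A G * (al p + esign G p * be p)))//; last 2 first.
- by move=> x xr; apply: rK; rewrite inE xr orbT.
- move=> x G xr; rewrite iA ?inE ?xr ?orbT// esign_toggle_neq//.
  by apply: contraNneq pr => ->.
rewrite big_cons [al p * _]mulrC -mulrA; congr (_ * _).
rewrite (eq_bigr (fun G => al p * A G + be p * (A G * esign G p))); last first.
  by move=> G _; ring.
rewrite big_split /= -!mulr_sumr sum_esign ?mulr0 ?addr0// => G.
by rewrite iA// mem_head.
Qed.

End SubsetAverages.

(** * Total variation against relative entropy *)

Section Hellinger.
Context {R : realType} {J : finType} (P : pred J) (f : J -> R) (c : R).
Hypothesis c0 : 0 <= c.
Local Notation avg F := (c * \sum_(j | P j) F j).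

Lemma avg_CauchySchwarz (a b : J -> R) :
  avg (fun j => a j * b j) ^+ 2 <= avg (fun j => a j ^+ 2) * avg (fun j => b j ^+ 2).
Proof.
apply: quadratic_ge0; try by rewrite mulr_ge0// sumr_ge0// => j _; rewrite sqr_ge0.
move=> t.
have -> : avg (fun j => a j ^+ 2) + 2 * t * avg (fun j => a j * b j) +
    t ^+ 2 * avg (fun j => b j ^+ 2) = avg (fun j => (a j + t * b j) ^+ 2).
  rewrite !(mulrCA _ c) -!mulrDr; congr (_ * _).
  rewrite !mulr_sumr -!big_split /=; apply: eq_bigr => j _; ring.
by rewrite mulr_ge0// sumr_ge0// => j _; rewrite sqr_ge0.
Qed.

(** This is [ln u <= u - 1] at [u = 1 / sqrt x], multiplied by [- 2 x]. *)
Lemma hellinger_le_entropy (x : R) : 0 <= x -> 2 * x - 2 * Num.sqrt x <= x * ln x.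
Proof.
rewrite le_eqVlt => /predU1P[<-|x0]; first by rewrite sqrtr0 !mulr0 subr0 mul0r.
have s0 : 0 < Num.sqrt x by rewrite sqrtr_gt0.
have sx : Num.sqrt x ^+ 2 = x by rewrite sqr_sqrtr// ltW.
have -> : ln x = - (2 * ln ((Num.sqrt x)^-1)).
  by rewrite lnV ?posrE// -{1}sx lnXn// mulrN opprK mulr_natl.
have : ln ((Num.sqrt x)^-1) <= (Num.sqrt x)^-1 - 1.
  rewrite lerBrDl -[leRHS]lnK ?posrE ?invr_gt0//; exact: expR_ge1Dx.
move=> /(ler_wpM2l (ltW x0)).
have -> : x * ((Num.sqrt x)^-1 - 1) = Num.sqrt x - x.
  by rewrite mulrBr mulr1 -{1}sx; field; exact: lt0r_neq0.
by move=> h; rewrite mulrN mulrCA; lra.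
Qed.

(* Pinsker's inequality up to a constant, through the Hellinger distance. *)
Lemma avg_dist1_entropy : (forall j, P j -> 0 <= f j) ->
  c * \sum_(j | P j) 1 = 1 -> avg f = 1 ->
  avg (fun j => `|f j - 1|) ^+ 2 <= 4 * avg (fun j => f j * ln (f j)).
Proof.
move=> f0 c1 f1; pose s j := Num.sqrt (f j).
have sf j : P j -> s j ^+ 2 = f j by move=> Pj; rewrite sqr_sqrtr// f0.
(* With [s = sqrt f], Cauchy-Schwarz splits the distance into the mean of [(s - 1)^2], which the
   entropy dominates, and the mean of [(s + 1)^2], which is at most 4. *)
have -> : avg (fun j => `|f j - 1|) = avg (fun j => `|s j - 1| * (s j + 1)).
  congr (_ * _); apply: eq_bigr => j Pj.
  rewrite -[s j + 1]ger0_norm ?addr_ge0 ?sqrtr_ge0// -normrM; congr `|_|.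
  by rewrite -(sf _ Pj); ring.
apply: le_trans (avg_CauchySchwarz _ _) _.
have E1 : avg (fun j => `|s j - 1| ^+ 2) = 2 - 2 * avg s.
  transitivity (avg f + c * (\sum_(j | P j) 1) - 2 * avg s); last by rewrite f1 c1.
  rewrite mulrCA -mulrDr -mulrBr; congr (_ * _).
  rewrite mulr_sumr -big_split -sumrB /=; apply: eq_bigr => j Pj.
  by rewrite real_normK ?num_real// -(sf _ Pj); ring.
have E2 : avg (fun j => (s j + 1) ^+ 2) = 2 + 2 * avg s.
  transitivity (avg f + c * (\sum_(j | P j) 1) + 2 * avg s); last by rewrite f1 c1.
  rewrite mulrCA -!mulrDr; congr (_ * _).
  rewrite mulr_sumr -!big_split /=; apply: eq_bigr => j Pj.
  by rewrite -(sf _ Pj); ring.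
have A0 : 0 <= 2 - 2 * avg s.
  by rewrite -E1 mulr_ge0// sumr_ge0// => j _; rewrite sqr_ge0.
have H : 2 - 2 * avg s <= avg (fun j => f j * ln (f j)).
  have -> : 2 - 2 * avg s = avg (fun j => 2 * f j - 2 * s j).
    rewrite sumrB -!mulr_sumr mulrBr ![c * (2 * _)]mulrCA f1 mulr1//.
  rewrite ler_wpM2l// ler_sum// => j Pj; exact/hellinger_le_entropy/f0.
rewrite E1 E2 mulrC; apply: ler_pM => //; last lra.
rewrite addr_ge0// mulr_ge0// mulr_ge0// sumr_ge0// => j _; exact: sqrtr_ge0.
Qed.

End Hellinger.

(* [simple_graphs] uses the classical set of increasing pairs. *)
Definition upper_pairs (n : nat) : {set 'I_n * 'I_n} :=
  finset (fun p : 'I_n * 'I_n => (p.1 < p.2)%N).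

Lemma in_upper_pairs n (p : 'I_n * 'I_n) : (p \in upper_pairs n) = (p.1 < p.2)%N.
Proof. by rewrite finset.in_set. Qed.

Lemma simple_graphsE n (G : {set 'I_n * 'I_n}) :
  (G \in simple_graphs n) = (G \subset upper_pairs n).
Proof.
rewrite finset.in_set; apply/fintype.subsetP/fintype.subsetP => GK p /GK.
  by rewrite inE /= in_upper_pairs.
by rewrite in_upper_pairs inE.
Qed.

(** * Relative entropy to the uniform graph, vertex by vertex *)

Section EntropyChain.
Context {R : realType} {disp : measure_display} {T : measurableType disp}.
Context (mu : probability T R) (d n : nat).
Local Notation env := ((nat * nat)%type -> T).
Local Notation Es := (@Es R disp T (nat * nat)%type mu).
Local Notation pair_t := ('I_n * 'I_n)%type.

Definition pt (i : nat) : seq (nat * nat) := [seq (i, j) | j <- iota 0 d].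
Definition pts (k : nat) : seq (nat * nat) := flatten [seq pt i | i <- iota 0 k].

Lemma mem_pt i p : (p \in pt i) = (p.1 == i) && (p.2 < d)%N.
Proof.
case: p => a j /=; apply/mapP/andP => [[k kd [-> ->]]|[/eqP -> jd]].
  by move: kd; rewrite mem_iota add0n eqxx.
by exists j; rewrite // mem_iota.
Qed.

Lemma uniq_pt i : uniq (pt i).
Proof. by rewrite map_inj_uniq ?iota_uniq// => a b []. Qed.

Lemma mem_pts k p : (p \in pts k) = (p.1 < k)%N && (p.2 < d)%N.
Proof.
apply/flatten_mapP/andP => [[i]|[pk pd]].
  by rewrite mem_iota /= => ik; rewrite mem_pt => /andP[/eqP -> ->].
by exists p.1; rewrite ?mem_iota// mem_pt eqxx.
Qed.

Lemma ptsS k : pts k.+1 = pts k ++ pt k.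
Proof. by rewrite /pts -addn1 iotaD map_cat flatten_cat /= cats0. Qed.

Variable h : nat -> nat -> env -> R.
Hypothesis bmh : forall i j, bm (h i j).
Hypothesis h1 : forall i j e, `|h i j e| <= 1.
Hypothesis dep_h : forall i j,
  depends [pred p : nat * nat | ((p.1 == i) || (p.1 == j)) && (p.2 < d)%N] (h i j).
Hypothesis ren_h : forall (sg : nat -> nat) i j e,
  h i j (fun p => e (sg p.1, p.2)) = h (sg i) (sg j) e.
Variable e0 : env.

Local Notation K := (upper_pairs n).
Local Notation N := (#|simple_graphs n|%:R : R).
Local Notation avg F := (N^-1 * \sum_(G in simple_graphs n) F G).
Local Notation sgn := (@esign R _).

(** For signs [h] this is the likelihood ratio, given the latent points, of the graph on the first
    [k] vertices against the uniform one: a power of 2 if [G] agrees with the signs on all pairs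
    below [k], and 0 otherwise. *)
Definition wgt (k : nat) (G : {set pair_t}) (e : env) : R :=
  \prod_(p : pair_t | (p.1 < p.2)%N && (p.2 < k)%N) (1 + sgn G p * h p.1 p.2 e).
(** The edges are those of vertex [k], but the latent point is that of [l]: taking [l = k] and
    [l = k.+1] gives two independent copies of the same row. *)
Definition row_wgt (k l : nat) (G : {set pair_t}) (e : env) : R :=
  \prod_(p : pair_t | (p.1 < p.2)%N && (p.2 == k :> nat)) (1 + sgn G p * h p.1 l e).
Definition dens (k : nat) (G : {set pair_t}) : R := Es (pts k) (wgt k G) e0.
Definition codeg (k i : nat) : env -> R :=
  Es (pt i) (fun e => h i k e * h i k.+1 e).
(** Second moment of the likelihood ratio of the row of vertex [k]; [k.+1] carries the second copy
    of its latent point. *)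
Definition overlap (k : nat) : R :=
  Es (pt k) (Es (pt k.+1) (fun e => \prod_(i < k) (1 + codeg k i e))) e0.

Lemma sg_norm G (p : pair_t) : `|sgn G p| = 1 :> R.
Proof. by rewrite /esign; case: ifP; rewrite ?normrN normr1. Qed.

Lemma factor_ge0 G (p : pair_t) i j e : 0 <= 1 + sgn G p * h i j e.
Proof.
have : `|sgn G p * h i j e| <= 1 by rewrite normrM sg_norm mul1r.
by rewrite ler_norml => /andP[]; lra.
Qed.

Lemma bm_factor G (p : pair_t) i j : bm (fun e => 1 + sgn G p * h i j e).
Proof. by apply: bmD; [exact: bm_cst|apply: bmM => //; exact: bm_cst]. Qed.

Lemma bm_wgt k G : bm (wgt k G).
Proof. by apply: bm_prod => p; exact: bm_factor. Qed.

Lemma bm_row_wgt k l G : bm (row_wgt k l G).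
Proof. by apply: bm_prod => p; exact: bm_factor. Qed.

Lemma wgt_ge0 k G e : 0 <= wgt k G e.
Proof. by apply: prodr_ge0 => p _; exact: factor_ge0. Qed.

Lemma wgtS k G e : wgt k.+1 G e = wgt k G e * row_wgt k k G e.
Proof.
rewrite /wgt (bigID (fun p : pair_t => (p.2 < k)%N)) /=; congr (_ * _).
  apply: eq_bigl => p; rewrite -andbA; congr (_ && _).
  by rewrite ltnS; case: ltnP; rewrite ?andbT ?andbF// => /ltnW ->.
rewrite /row_wgt; apply: eq_big => [p|p /andP[/andP[_ pk] /negP kp]].
  by rewrite -andbA; congr (_ && _); rewrite -leqNgt ltnS eqn_leq.
by have -> : p.2 = k :> nat by lia.
Qed.

Lemma dep_factor G (p : pair_t) i j :
  depends [pred p : nat * nat | ((p.1 == i) || (p.1 == j)) && (p.2 < d)%N]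
    (fun e => 1 + sgn G p * h i j e).
Proof. by move=> e e' ee'; rewrite (dep_h ee'). Qed.

Lemma dep_wgt k G :
  depends [pred p : nat * nat | (p.1 < k)%N && (p.2 < d)%N] (wgt k G).
Proof.
apply: depends_prod => p /andP[p12 pk]; apply: dependsW (@dep_factor G p _ _).
by move=> q /= /andP[/orP[] /eqP ->]; rewrite ?pk// (ltn_trans p12 pk).
Qed.

Lemma dep_row_wgt k l G : depends
  [pred p : nat * nat | ((p.1 < k)%N || (p.1 == l)) && (p.2 < d)%N] (row_wgt k l G).
Proof.
apply: depends_prod => p /andP[p12 /eqP pk]; apply: dependsW (@dep_factor G p _ _).
by move=> q /= /andP[/orP[] /eqP ->]; rewrite ?eqxx ?orbT// -pk p12.
Qed.

Definition exch (k : nat) (i : nat) : nat :=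
  if i == k then k.+1 else if i == k.+1 then k else i.

Lemma exchK k : involutive (exch k).
Proof.
move=> i; rewrite /exch; case: (eqVneq i k) => [->|ik].
  by rewrite eqxx; case: eqP => //; lia.
case: (eqVneq i k.+1) => [->|ik1]; first by rewrite eqxx.
by rewrite (negbTE ik) (negbTE ik1).
Qed.

Lemma exch_lt k i : (i < k)%N -> exch k i = i.
Proof.
by move=> ik; rewrite /exch; case: eqP => [?|_]; [lia|case: eqP => // ?; lia].
Qed.

Lemma exchS k : exch k k.+1 = k.
Proof. by rewrite /exch eqxx; case: eqP => // ?; lia. Qed.

Lemma row_expectation_rename k G e :
  Es (pt k.+1) (row_wgt k k.+1 G) e = Es (pt k) (row_wgt k k G) e.
Proof.
pose sg (p : nat * nat) := (exch k p.1, p.2).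
have sgK : involutive sg by move=> [i j]; rewrite /sg /= exchK.
have -> : pt k.+1 = map sg (pt k).
  by rewrite /pt -map_comp; apply: eq_map => j; rewrite /sg /exch /= eqxx.
rewrite Es_rename//.
rewrite (_ : (fun e => row_wgt k k.+1 G _) = row_wgt k k G); last first.
  apply/funext => e'; apply: eq_bigr => p /andP[p12 /eqP pk].
  by rewrite (ren_h (exch k)) exchS exch_lt// -pk.
have dd := @depends_Es _ _ _ _ mu _ (pt k) _ (@dep_row_wgt k k G).
apply: dd => -[a j].
rewrite mem_pt /= => /andP[/andP[ak jd]]; rewrite jd andbT => ak'.
by rewrite /sg /= exch_lt//; lia.
Qed.

Lemma densS k G : dens k.+1 G =
  Es (pts k) (fun e => wgt k G e * Es (pt k) (row_wgt k k G) e) e0.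
Proof.
rewrite /dens ptsS Es_cat; congr (Es _ _ e0); apply/funext => e.
rewrite -Es_indepM; last first.
- move=> [a j]; rewrite mem_pt /= => /andP[/eqP ik _]; apply: depends_indep (@dep_wgt k G).
  by rewrite /=; lia.
- exact: bm_row_wgt.
by congr (Es _ _ e); apply/funext => e'; rewrite wgtS.
Qed.

Lemma dens_ge0 k G : 0 <= dens k G.
Proof. by apply: Es_ge0; [exact: bm_wgt|exact: wgt_ge0]. Qed.

(** The square of an expectation is an expectation over two independent copies, the second of which
    is read at vertex [k.+1]. *)
Lemma Es_wgt_row_sqr k G :
  Es (pts k) (fun e => wgt k G e * Es (pt k) (row_wgt k k G) e ^+ 2) e0 =
  Es (pts k) (Es (pt k) (Es (pt k.+1)
    (fun e => wgt k G e * (row_wgt k k G e * row_wgt k k.+1 G e)))) e0.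
Proof.
congr (Es _ _ e0); apply/funext => e.
rewrite -Es_cat Es_indepM; last first.
- move=> [a j]; rewrite mem_cat !mem_pt /= => ik; apply: depends_indep (@dep_wgt k G).
  by rewrite /=; lia.
- by apply: bmM; exact: bm_row_wgt.
rewrite Es_cat EsM2; try exact: bm_row_wgt.
- by rewrite row_expectation_rename expr2.
- move=> [a j]; rewrite mem_pt /= => ik; apply: depends_indep (@dep_row_wgt k k G).
  by rewrite /=; lia.
- move=> [a j]; rewrite mem_pt /= => ik; apply: depends_indep (@dep_row_wgt k k.+1 G).
  by rewrite /=; lia.
Qed.

(** Cauchy-Schwarz with weight [wgt k G]. Written without dividing by [dens k G], it covers graphs
    of density zero. *)
Lemma dens_sqr_le k G : dens k.+1 G ^+ 2 <= dens k G *
  Es (pts k) (fun e => wgt k G e * Es (pt k) (row_wgt k k G) e ^+ 2) e0.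
Proof.
have := @Es_CauchySchwarz _ _ _ _ mu (pts k) (wgt k G) (fun=> 1)
  (Es (pt k) (row_wgt k k G)) e0 (bm_wgt k G) (bm_cst 1)
  (bmEs _ _ (bm_row_wgt k k G)) (wgt_ge0 k G).
rewrite densS; under eq_fun do rewrite mul1r.
by under [X in _ <= Es _ X _ * _ -> _]eq_fun do rewrite expr1n mulr1.
Qed.

Lemma N_neq0 : N != 0.
Proof.
rewrite pnatr_eq0 -lt0n; apply/card_gt0P; exists finset.set0.
by rewrite simple_graphsE finset.sub0set.
Qed.

Lemma avg1 : N^-1 * \sum_(G in simple_graphs n) 1 = 1 :> R.
Proof. by rewrite sumr_const mulVf// N_neq0. Qed.

Lemma avg_prod (A : {set pair_t} -> R) (Q : pred pair_t) (al be : pair_t -> R) :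
  (forall p, Q p -> p \in K) ->
  (forall p G, Q p -> A (toggle p G) = A G) ->
  avg (fun G => A G * \prod_(p | Q p) (al p + sgn G p * be p)) =
  (\prod_(p | Q p) al p) * avg A.
Proof.
move=> QK iA; rewrite mulrCA; congr (_ * _).
have E (F : {set pair_t} -> R) : \sum_(G in simple_graphs n) F G =
    \sum_(G : {set pair_t} | G \subset K) F G.
  by apply: eq_bigl => G; rewrite simple_graphsE.
rewrite !E -[\prod_(p | Q p) al p]big_filter.
rewrite [LHS](eq_bigr (fun G => A G *
    \prod_(p <- seq.filter Q (index_enum _)) (al p + sgn G p * be p))); last first.
  by move=> G _; rewrite big_filter.
rewrite sum_prod_esign ?filter_uniq ?index_enum_uniq//.
- by move=> p; rewrite mem_filter => /andP[/QK].
- by move=> p G; rewrite mem_filter => /andP[+ _]; exact: iA.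
Qed.

Lemma wgt_toggle k G (p : pair_t) e : (k <= p.2)%N -> wgt k (toggle p G) e = wgt k G e.
Proof.
move=> kp; apply: eq_bigr => p' /andP[_ p'k]; rewrite esign_toggle_neq//.
by apply: contraTneq p'k => ->; rewrite -leqNgt.
Qed.

Lemma dens_toggle k G (p : pair_t) : (k <= p.2)%N -> dens k (toggle p G) = dens k G.
Proof.
by move=> kp; congr (Es _ _ e0); apply/funext => e; exact: wgt_toggle.
Qed.

Lemma avg_Es s (A : {set pair_t} -> R) (F : {set pair_t} -> env -> R) :
  (forall G, bm (F G)) ->
  avg (fun G => A G * Es s (F G) e0) =
  Es s (fun e => avg (fun G => A G * F G e)) e0.
Proof.
move=> bF; rewrite EsZ; last by apply: bm_sum => G; apply: bmM => //; exact: bm_cst.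
rewrite Es_sum; last by move=> G; apply: bmM => //; exact: bm_cst.
by congr (_ * _); apply: eq_bigr => G _; rewrite EsZ.
Qed.

Lemma avg_wgt k e : avg (fun G => wgt k G e) = 1.
Proof.
transitivity (avg (fun G => 1 * wgt k G e)).
  by congr (_ * _); apply: eq_bigr => G _; rewrite mul1r.
rewrite (@avg_prod (fun=> 1)) => [|p /andP[p12 _]|//]; last by rewrite in_upper_pairs.
by rewrite avg1 mulr1 big1.
Qed.

Lemma avg_dens k : avg (dens k) = 1.
Proof.
transitivity (avg (fun G => 1 * dens k G)).
  by congr (_ * _); apply: eq_bigr => G _; rewrite mul1r.
rewrite (@avg_Es (pts k) (fun=> 1)); last exact: bm_wgt.
rewrite -[RHS](Es_cst mu (pts k) 1 e0).
congr (Es _ _ e0); apply/funext => e; rewrite -[RHS](avg_wgt k e).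
by congr (_ * _); apply: eq_bigr => G _; rewrite mul1r.
Qed.

(** The row factors of vertex [k] average to 1 over its edges, so [dens k] is the marginal of
    [dens k.+1]. *)
Lemma avg_dens_marginal k (A : {set pair_t} -> R) :
  (forall (p : pair_t) G, (p.2 == k :> nat) -> A (toggle p G) = A G) ->
  avg (fun G => A G * dens k.+1 G) = avg (fun G => A G * dens k G).
Proof.
move=> iA.
have dE G : dens k G = Es (pts k.+1) (wgt k G) e0.
  rewrite ptsS Es_cat (@Es_indep _ _ _ _ _ (pt k))// => -[a j].
  rewrite mem_pt /= => ik; apply: depends_indep (@dep_wgt k G).
  by rewrite /=; lia.
under [in RHS]eq_bigr do rewrite dE.
rewrite !avg_Es; try exact: bm_wgt.
congr (Es _ _ e0); apply/funext => e.
under eq_bigr do rewrite wgtS mulrA.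
rewrite (@avg_prod (fun G => A G * wgt k G e)); first by rewrite big1 ?mul1r.
  by move=> p /andP[p12 _]; rewrite in_upper_pairs.
by move=> p G /andP[_ pk]; rewrite iA// wgt_toggle// (eqP pk).
Qed.

(** Once the points of index at least [k] are fixed, the factors involve disjoint sets of
    coordinates. *)
Lemma Es_prod_pts k m (B : nat -> env -> R) e : (m <= k)%N -> (forall i, bm (B i)) ->
  (forall i, depends [pred p : nat * nat | (p.1 == i) || (k <= p.1)%N] (B i)) ->
  Es (pts m) (fun e => \prod_(i < m) B i e) e = \prod_(i < m) Es (pt i) (B i) e.
Proof.
move=> + bB dB; elim: m e => [|m IH] e mk.
  by rewrite /= !big_ord0.
rewrite big_ord_recr /= -IH 1?ltnW// ptsS Es_cat -EsM2.
- congr (Es _ _ e); congr (Es _ _); apply/funext => e'.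
  by rewrite big_ord_recr.
- exact: bm_prod.
- exact: bB.
- move=> [a j]; rewrite mem_pt /= => /andP[/eqP im _].
  apply: (@depends_indep _ _ _ [pred p : nat * nat | (p.1 < m)%N || (k <= p.1)%N]).
    by rewrite /=; lia.
  apply: depends_prod => i _; apply: dependsW (@dB i) => p /=.
  by case/orP=> [/eqP ->|->]; rewrite ?ltn_ord// orbT.
- move=> [a j]; rewrite mem_pts /= => /andP[im _]; apply: depends_indep (@dB m).
  by rewrite /=; lia.
Qed.

Lemma prod_row (B : nat -> R) k : (k < n)%N ->
  \prod_(p : pair_t | (p.1 < p.2)%N && (p.2 == k :> nat)) B p.1 = \prod_(i < k) B i.
Proof.
move=> kn; pose k' := Ordinal kn.
rewrite (reindex_onto (fun i : 'I_n => (i, k')) fst) /=; last first.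
  by case=> i j /= /andP[_ /eqP jk]; congr pair; exact: val_inj.
rewrite (big_ord_widen_cond _ predT _ (ltnW kn)) /=.
by apply: eq_bigl => i; rewrite !eqxx !andbT.
Qed.

(** For a sign [s], the mean of [(1 + s a) (1 + s b)] is [1 + a b]: averaging over the edges of
    vertex [k] leaves one such factor for each earlier vertex, and averaging over the other edges
    removes [wgt k G]. The earlier latent points are then integrated independently. *)
Lemma avg_row_sqr k : (k < n)%N ->
  avg (fun G => Es (pts k) (fun e => wgt k G e * Es (pt k) (row_wgt k k G) e ^+ 2) e0)
  = overlap k.
Proof.
move=> kn.
pose F G e := wgt k G e * (row_wgt k k G e * row_wgt k k.+1 G e).
have bF G : bm (F G) by do 2 (apply: bmM; first by [exact: bm_wgt|exact: bm_row_wgt]); exact: bm_row_wgt.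
transitivity (avg (fun G => 1 * Es (pts k ++ pt k ++ pt k.+1) (F G) e0)).
  by congr (_ * _); apply: eq_bigr => G _; rewrite mul1r Es_wgt_row_sqr !Es_cat.
rewrite (@avg_Es _ (fun=> 1) F bF).
pose B i e := 1 + h i k e * h i k.+1 e.
have bB i : bm (B i) by apply: bmD; [exact: bm_cst|exact: bmM].
rewrite (_ : (fun e => _) = (fun e => \prod_(i < k) B i e)); last first.
  apply/funext => e.
  pose al (p : pair_t) := 1 + h p.1 k e * h p.1 k.+1 e.
  pose be (p : pair_t) := h p.1 k e + h p.1 k.+1 e.
  have := @avg_prod (fun G => wgt k G e)
    (fun p => (p.1 < p.2)%N && (p.2 == k :> nat)) al be.
  rewrite avg_wgt mulr1 (prod_row (fun i => B i e))// => <-.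
  - congr (_ * _); apply: eq_bigr => G _; rewrite mul1r /F; congr (_ * _).
    rewrite /row_wgt -big_split /=; apply: eq_bigr => p _.
    have ss : sgn G p * sgn G p = 1 :> R.
      by rewrite /esign; case: ifP => _; rewrite ?mulr1// mulrNN mulr1.
    transitivity (1 + sgn G p * sgn G p * (h p.1 k e * h p.1 k.+1 e) + sgn G p * be p).
      by rewrite /be; ring.
    by rewrite ss mul1r.
  - by move=> p /andP[p12 _]; rewrite in_upper_pairs.
  - by move=> p G /andP[_ /eqP pk]; rewrite wgt_toggle// pk.
rewrite Es_cat EsC; last exact: bm_prod.
rewrite Es_cat /overlap; congr (Es _ (Es _ _) e0); apply/funext => e.
rewrite (@Es_prod_pts k k B)//; last first.
  move=> i e1 e2 ee; rewrite /B.
  by congr (1 + _ * _); apply: dep_h => p /= /andP[/orP[] /eqP pi _]; apply: ee;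
    rewrite inE pi ?eqxx ?leqnn ?leqnSn ?orbT.
by apply: eq_bigr => i _; rewrite EsD ?Es_cst//; [exact: bm_cst|exact: bmM].
Qed.

(** With [a = dens k G] and [b = dens k.+1 G], [ln u <= u - 1] gives
    [b (ln b - ln a) <= b^2 / a - b], and [b^2 / a] is bounded by a quantity of average
    [overlap k]. *)
Lemma entropy_step k : (k < n)%N ->
  avg (fun G => dens k.+1 G * ln (dens k.+1 G)) <=
  avg (fun G => dens k G * ln (dens k G)) + (overlap k - 1).
Proof.
move=> kn.
(* [ln (dens k G)] does not see the edges of vertex [k], so it may be averaged under either
   density. *)
have -> : avg (fun G => dens k G * ln (dens k G)) =
    avg (fun G => dens k.+1 G * ln (dens k G)).
  under eq_bigr do rewrite mulrC.
  under [in RHS]eq_bigr do rewrite mulrC.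
  by rewrite avg_dens_marginal// => p G /eqP pk; rewrite dens_toggle// pk.
pose Q G := Es (pts k) (fun e => wgt k G e * Es (pt k) (row_wgt k k G) e ^+ 2) e0.
have -> : overlap k - 1 = avg (fun G => Q G - dens k.+1 G).
  by rewrite sumrB mulrBr avg_dens -(avg_row_sqr kn).
rewrite -mulrDr ler_wpM2l ?invr_ge0 ?ler0n// -big_split /= ler_sum// /Q => G _ {Q}.
set Q := Es _ _ _.
have := dens_sqr_le k G; rewrite -/Q.
have := dens_ge0 k.+1 G; have := dens_ge0 k G.
set a := dens k G; set b := dens k.+1 G; move=> a0 b0 abQ.
have Q0 : 0 <= Q.
  apply: Es_ge0 => [|e]; last by rewrite mulr_ge0 ?wgt_ge0 ?sqr_ge0.
  by apply: bmM; [exact: bm_wgt|apply/bmX/bmEs/bm_row_wgt].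
have [b00|b00] := eqVneq b 0; first by rewrite b00 !mul0r add0r subr0.
have bp : 0 < b by rewrite lt_neqAle eq_sym b00.
have ap : 0 < a.
  rewrite lt_neqAle a0 andbT; apply: contraTneq abQ => <-.
  by rewrite mul0r -ltNge exprn_gt0.
have hl : ln b - ln a <= b / a - 1.
  rewrite -ln_div ?posrE// lerBrDl -[leRHS]lnK ?posrE ?divr_gt0//.
  exact: expR_ge1Dx.
have hq : b * (b / a) <= Q.
  by rewrite mulrA ler_pdivrMr// -expr2 mulrC.
have := ler_wpM2l b0 hl; rewrite !mulrBr mulr1; lra.
Qed.

(* Chain rule for the relative entropy, vertex by vertex. *)
Lemma avg_dens_dist1 :
  avg (fun G => `|dens n G - 1|) ^+ 2 <= 4 * \sum_(k < n) (overlap k - 1).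
Proof.
apply: le_trans (avg_dist1_entropy _ _ _ _) _.
- by rewrite invr_ge0 ler0n.
- by move=> G _; exact: dens_ge0.
- exact: avg1.
- exact: avg_dens.
rewrite ler_wpM2l//.
suff H k : (k <= n)%N -> avg (fun G => dens k G * ln (dens k G)) <=
    \sum_(i < k) (overlap i - 1) by exact: H.
elim: k => [_|k IH kn].
  rewrite big_ord0 big1 ?mulr0// => G _.
  suff -> : dens 0 G = 1 by rewrite ln1 mulr0.
  by rewrite /dens /= /wgt big_pred0// => p; rewrite andbF.
rewrite big_ord_recr /=; apply: le_trans (entropy_step kn) _.
by rewrite lerD2r IH// ltnW.
Qed.

End EntropyChain.

(** * Distance on the circle of circumference 2 *)

Section CircularDistance.
Context {R : realType}.
Implicit Types (a b s t x y th : R).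

Local Notation TR := (measurableTypeR R).
Definition unif02 : probability TR R := @uniform_prob R 0 2 (ltr0n R 2).
Local Notation U := unif02.

Definition clip x : R := Num.max 0 (Num.min 2 x).
(* Clamping makes every statement about the circle valid for all real
   coordinates; it is the identity on [0, 2]. *)
Definition kap x y : R := circ (clip x) (clip y).

Lemma clip_itv x : 0 <= clip x <= 2.
Proof. by rewrite le_max ge_max lexx ler0n ge_min lexx. Qed.

Lemma clip_id x : 0 <= x <= 2 -> clip x = x.
Proof. by case/andP => x0 x2; rewrite /clip min_r// max_r. Qed.

Lemma kap_id x y : 0 <= x <= 2 -> 0 <= y <= 2 -> kap x y = circ x y.
Proof. by move=> x2 y2; rewrite /kap !clip_id. Qed.

Lemma kap_itv x y : 0 <= kap x y <= 1.
Proof.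
rewrite /kap /circ; have := clip_itv x; have := clip_itv y.
set u := clip x; set v := clip y => /andP[? ?] /andP[? ?].
rewrite le_min ge_min; case: (lerP u v) => ?; apply/andP; split; try (apply/andP; split); lra.
Qed.

Lemma kap_ge0 x y : 0 <= kap x y. Proof. by have /andP[] := kap_itv x y. Qed.
Lemma kap_le1 x y : kap x y <= 1. Proof. by have /andP[] := kap_itv x y. Qed.

Lemma kapC x y : kap x y = kap y x.
Proof. by rewrite /kap /circ distrC. Qed.

(** A triangle on the circle has perimeter at most the circumference. Two points close to the
    antipode of a third one are thus close to each other. *)
Lemma kap_perimeter x y z : kap x y + kap x z + kap y z <= 2.
Proof.
have m a b : circ a b <= `|a - b| /\ circ a b <= 2 - `|a - b|.
  by rewrite /circ !ge_min !lexx orbT.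
rewrite /kap; have := clip_itv x; have := clip_itv y; have := clip_itv z.
set u := clip x; set v := clip y; set w := clip z => /andP[? ?] /andP[? ?] /andP[? ?].
move: (m u v) (m u w) (m v w).
by case: (lerP u v) => ?; case: (lerP u w) => ?; case: (lerP v w) => ? [? ?] [? ?] [? ?]; lra.
Qed.

Lemma measurable_clip d (X : measurableType d) (f : X -> R) :
  measurable_fun setT f -> measurable_fun setT (fun x : X => clip (f x)).
Proof.
by move=> mf; apply: measurable_maxr => //; apply: measurable_minr.
Qed.

Lemma measurable_kap d (X : measurableType d) (f g : X -> R) :
  measurable_fun setT f -> measurable_fun setT g ->
  measurable_fun setT (fun x : X => kap (f x) (g x)).
Proof.
move=> mf mg.
have mn : measurable_fun setT (fun x : X => `|clip (f x) - clip (g x)|).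
  apply: measurableT_comp => //; apply: measurable_funB; exact: measurable_clip.
by apply: measurable_minr => //; apply: measurable_funB.
Qed.

Lemma unif02E (A : set TR) : measurable A ->
  (U A = (2^-1)%:E * lebesgue_measure (A `&` `[0%R, 2%R]))%E.
Proof.
move=> mA; rewrite -[LHS]/(uniform_prob (ltr0n R 2) A) /uniform_prob integral_uniform_pdf.
rewrite (eq_integral (cst (2^-1)%:E)); last first.
  move=> x; rewrite inE /= => -[_]; rewrite in_itv/= /uniform_pdf => ->.
  by rewrite subr0.
by rewrite integral_cst//; exact: measurableI.
Qed.

(** The set is the open arc of length [2 - 2 th] centered at the antipode of [a]; the three cases
    tell whether and where the cut of the circle at [0 = 2] meets it. *)
Lemma kap_gt_measure a th : 0 <= th <= 1 -> (U [set t : TR | (th < kap a t)%R] = (1 - th)%:E)%E.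
Proof.
move=> /andP[? ?]; rewrite unif02E; last first.
  rewrite -[X in measurable X]setTI.
  have := measurable_fun_ltr (@measurable_cst _ _ TR R setT th)
    (measurable_kap (@measurable_cst _ _ TR R setT a) (@measurable_id _ _ setT)).
  by move=> /(_ measurableT [set true]) /=; apply.
have := clip_itv a; set u := clip a => /andP[? ?].
set A := _ `&` _.
have inA t : A t <-> 0 <= t <= 2 /\ th < `|u - t| < 2 - th.
  rewrite /A /= in_itv /=; split=> [[+ t2]|[t2 /andP[h1 h2]]].
    rewrite /kap (clip_id t2) -/u /circ lt_min => /andP[h1 h2]; split=> //.
    by rewrite h1; lra.
  by split=> //; rewrite /kap (clip_id t2) -/u /circ lt_min h1; lra.
have [uth|uth] := leP u th.
  have -> : A = `]u + th, u + 2 - th[%classic.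
    apply/seteqP; split => t; rewrite /= in_itv /=.
      by move/inA=> [/andP[? ?] /andP[]]; case: (lerP u t) => ? ? ?; apply/andP; split; lra.
    move=> /andP[? ?]; apply/inA.
    by case: (lerP u t) => ?; (split; apply/andP; split); lra.
  rewrite lebesgue_measure_itv /= lte_fin; case: ltP => ?.
    by rewrite -EFinD -EFinM; congr EFin; lra.
  by rewrite mule0; congr EFin; lra.
have [uth2|uth2] := leP (2 - th) u.
  have -> : A = `]u - 2 + th, u - th[%classic.
    apply/seteqP; split => t; rewrite /= in_itv /=.
      by move/inA=> [/andP[? ?] /andP[]]; case: (lerP u t) => ? ? ?; apply/andP; split; lra.
    move=> /andP[? ?]; apply/inA.
    by case: (lerP u t) => ?; (split; apply/andP; split); lra.
  rewrite lebesgue_measure_itv /= lte_fin; case: ltP => ?.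
    by rewrite -EFinD -EFinM; congr EFin; lra.
  by rewrite mule0; congr EFin; lra.
have -> : A = `[0, u - th[%classic `|` `]u + th, 2]%classic.
  apply/seteqP; split => t; rewrite /= !in_itv /=.
    move/inA=> [/andP[? ?] /andP[]]; case: (lerP u t) => ? ? ?.
      by right; apply/andP; split; lra.
    by left; apply/andP; split; lra.
  move=> [] /andP[? ?]; apply/inA;
    by case: (lerP u t) => ?; (split; apply/andP; split); lra.
have mU : lebesgue_measure (`[0, u - th[%classic `|` `]u + th, 2]%classic : set TR) =
    (lebesgue_measure (`[0%R, (u - th)%R[%classic : set TR) +
     lebesgue_measure (`](u + th)%R, 2%R]%classic : set TR))%E.
  apply: measureU => //.
  by apply/seteqP; split => t //= []; rewrite !in_itv /= => /andP[? ?] /andP[? ?]; lra.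
rewrite mU !lebesgue_measure_itv /= !lte_fin.
case: ltP => ?; last by exfalso; lra.
case: ltP => ?; last by exfalso; lra.
by rewrite -!EFinD -EFinM; congr EFin; lra.
Qed.

End CircularDistance.

(** * Rotation invariance of the law of the distance *)

Section CircularLaw.
Context {R : realType}.
Implicit Types (a b th : R).
Local Notation TR := (measurableTypeR R).
Local Notation U := (@unif02 R).

(** A named function of the second argument, to which the structure of measurable function can be
    attached so that its law is a measure. *)
Definition kapT a : TR -> TR := kap a.

Lemma measurable_kapT a : measurable_fun setT (kapT a).
Proof. exact: measurable_kap. Qed.

HB.instance Definition _ a := @isMeasurableFun.Build _ _ TR TR (kapT a)
  (measurable_kapT a).

(** Both laws agree on half-lines, which are stable under intersection and generate the Borel
    sets. *)
Lemma kap_law_measure a b (A : set TR) : measurable A ->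
  pushforward U (kapT a) A = pushforward U (kapT b) A.
Proof.
move=> mA; pose P c : {measure set TR -> \bar R} := distribution U (kapT c).
rewrite -[LHS]/(P a A) -[RHS]/(P b A).
apply: (@measure_unique _ R TR (RGenOInfty.G (R:=R)) (fun n => `]- n%:R, +oo[%classic)).
- exact: RGenOInfty.measurableE.
- move=> _ _ [x ->] [y ->]; exists (Num.max x y).
  by apply/seteqP; split => t /=; rewrite !in_itv /= !andbT gt_max => /andP.
- by move=> i; exists (- i%:R).
- apply/seteqP; split => // t _; exists (Num.bound `|t|) => //=.
  rewrite in_itv /= andbT ltrNl; apply: le_lt_trans (archi_boundP (normr_ge0 t)).
  by rewrite -normrN ler_norm.
- move=> _ [x ->].
  have E c : P c `]x, +oo[%classic = U [set t : TR | (x < kap c t)%R].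
    rewrite /P /= /pushforward; congr (U _); apply/seteqP; split => t /=.
      by rewrite in_itv /= andbT.
    by rewrite in_itv /= andbT.
  rewrite !E; have [x0|x0] := ltP x 0.
    suff E0 c : [set t : TR | (x < kap c t)%R] = setT by rewrite !E0.
    by apply/seteqP; split => // t _ /=; exact: lt_le_trans (kap_ge0 _ _).
  have [x1|x1] := leP x 1; first by rewrite !kap_gt_measure ?x0.
  suff E0 c : [set t : TR | (x < kap c t)%R] = set0 by rewrite !E0.
  by apply/seteqP; split => // t /=; have := kap_le1 c t; lra.
- move=> k; apply: (@le_lt_trans _ _ 1%E); last exact: ltry.
  exact: probability_le1.
- exact: mA.
Qed.

Lemma kap_law (f : R -> R) a b :
  measurable_fun setT f -> (exists M, forall x, `|f x| <= M) ->
  \int[U]_t f (kap a t) = \int[U]_t f (kap b t).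
Proof.
move=> mf bf.
pose P c : {measure set TR -> \bar R} := distribution U (kapT c).
have E c : \int[U]_t f (kap c t) = \int[P c]_t f t.
  rewrite /Rintegral; congr fine; symmetry.
  apply: (integral_pushforward (measurable_kapT c)) => //.
  - by apply/measurable_EFinP.
  - rewrite preimage_setT; apply: bounded_integrable.
      by apply: (measurableT_comp mf); exact: measurable_kapT.
    by case: bf => M fM; exists M => x; exact: fM.
have EP : \int[P a]_t f t = \int[P b]_t f t.
  apply: (congr1 fine); apply: eq_measure_integral => A mA _.
  exact: kap_law_measure.
exact: etrans (E a) (etrans EP (esym (E b))).
Qed.

Lemma kap_bool_int (b : TR -> bool) : measurable_fun setT b ->
  \int[U]_t (b t)%:R = fine (U [set t | b t]).
Proof.
move=> mb; rewrite /Rintegral -[in RHS](setIT [set t | b t]) -integral_indic//=.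
  congr fine; apply: eq_integral => t _.
  rewrite indicE; case: (boolP (b t)) => bt; first by rewrite mem_set.
  by rewrite memNset//; exact/negP.
rewrite -[X in measurable X]setTI; exact: (mb measurableT [set true]).
Qed.

Lemma kap_gt_prob a th : 0 <= th <= 1 -> \int[U]_t ((th < kap a t)%R)%:R = 1 - th.
Proof.
move=> th01; rewrite kap_bool_int ?kap_gt_measure//.
by apply: measurable_fun_ltr => //; exact: measurable_kapT.
Qed.

End CircularLaw.

(** * The [q]-th power of the distance to a uniform point *)

Section PowerDistance.
Context {R : realType} (q : R).
Hypothesis q1 : 1 <= q.
Local Notation TR := (measurableTypeR R).
Local Notation U := (@unif02 R).
Context {I : eqType}.
Implicit Types (a b r th : R) (i : I).
Local Notation env := (I -> TR).
Local Notation E i F := (@E1 R _ TR I U i F).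

Definition wdist a b : R := kap a b `^ q.

Let q0 : 0 < q. Proof. by apply: lt_le_trans q1. Qed.
Let qn0 : q != 0. Proof. exact: lt0r_neq0. Qed.
Let qi0 : 0 <= q^-1. Proof. by rewrite invr_ge0 ltW. Qed.

Lemma powR_le1 (x p : R) : 0 <= p -> 0 <= x -> x <= 1 -> x `^ p <= 1.
Proof.
move=> p0 x0 x1; have := @ge0_ler_powR R p p0 x 1; rewrite powR1.
by apply; rewrite ?nnegrE.
Qed.

Lemma wdist_ge0 a b : 0 <= wdist a b. Proof. exact: powR_ge0. Qed.

Lemma wdist_le1 a b : wdist a b <= 1.
Proof. by rewrite powR_le1 ?kap_ge0 ?kap_le1// ltW. Qed.

Lemma wdistC a b : wdist a b = wdist b a.
Proof. by rewrite /wdist kapC. Qed.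

Lemma powR_invK r : 0 <= r -> (r `^ q^-1) `^ q = r.
Proof. by move=> r0; rewrite -powRrM mulVf// powRr1. Qed.

Lemma wdist_le a b r : 0 <= r -> (wdist a b <= r) = (kap a b <= r `^ q^-1).
Proof.
move=> r0; rewrite -{1}(powR_invK r0) /wdist; apply/idP/idP => h.
  have n1 x : x `^ q \is Num.nneg by rewrite nnegrE powR_ge0.
  have := @ge0_ler_powR R q^-1 qi0 _ _ (n1 _) (n1 _) h.
  by rewrite -!powRrM mulfV// !mulr1 ?powRr1 ?kap_ge0// mulrA mulVf// mul1r.
by rewrite ge0_ler_powR ?nnegrE ?kap_ge0 ?powR_ge0// ltW.
Qed.

Lemma bm_wdist (f g : env -> TR) : (forall d (X : measurableType d) (h : X -> env),
    measenv h -> measurable_fun setT (fun x => f (h x))) ->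
  (forall d (X : measurableType d) (h : X -> env),
    measenv h -> measurable_fun setT (fun x => g (h x))) ->
  bm (fun e => wdist (f e) (g e)).
Proof.
move=> mf mg; split; last first.
  by exists 1 => e; rewrite ger0_norm ?wdist_ge0// wdist_le1.
move=> d X h mh; apply: (measurableT_comp (@measurable_powR R q)).
by apply: measurable_kap; [exact: mf|exact: mg].
Qed.

Lemma bm_wdist_var i j : bm (fun e : env => wdist (e i) (e j)).
Proof. by apply: bm_wdist => d X h mh; exact: mh. Qed.

Lemma bm_wdist_cst a i : bm (fun e : env => wdist a (e i)).
Proof.
apply: bm_wdist => d X h mh; last exact: mh.
exact: (@measurable_cst _ _ X TR).
Qed.

Lemma bm_kap_cst a i : bm (fun e : env => kap a (e i)).
Proof.
split; last by exists 1 => e; rewrite ger0_norm ?kap_ge0// kap_le1.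
by move=> d X h mh; apply: measurable_kap; [exact: measurable_cst|exact: mh].
Qed.

Lemma bm_kap_var i j : bm (fun e : env => kap (e i) (e j)).
Proof.
split; last by exists 1 => e; rewrite ger0_norm ?kap_ge0// kap_le1.
by move=> d X h mh; apply: measurable_kap; exact: mh.
Qed.

Lemma E_wdist_law (f : R -> R) a b i e :
  measurable_fun setT f -> (exists M, forall x, `|f x| <= M) ->
  E i (fun e => f (wdist a (e i))) e = E i (fun e => f (wdist b (e i))) e.
Proof.
move=> mf bf; rewrite /E1.
under eq_Rintegral do rewrite upd_same.
under [RHS]eq_Rintegral do rewrite upd_same.
rewrite /wdist (kap_law (f := fun x => f (x `^ q)) a b)//.
  by apply: (measurableT_comp mf); exact: measurable_powR.
by case: bf => M fM; exists M.
Qed.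

Lemma E_kap_gt a th i e : 0 <= th <= 1 ->
  E i (fun e => ((th < kap a (e i))%R)%:R) e = 1 - th.
Proof.
move=> th01; rewrite /E1 -(kap_gt_prob a th01).
by under eq_Rintegral do rewrite upd_same.
Qed.

Lemma bm_kap_gt a th i : bm (fun e : env => ((th < kap a (e i))%R)%:R : R).
Proof. by apply/bm_bool/mbool_lt; [exact: bm_cst|exact: bm_kap_cst]. Qed.

Lemma bm_kap_le a th i : bm (fun e : env => ((kap a (e i) <= th)%R)%:R : R).
Proof. by apply/bm_bool/mbool_le; [exact: bm_kap_cst|exact: bm_cst]. Qed.

Lemma E_kap_le a th i e : 0 <= th <= 1 ->
  E i (fun e => ((kap a (e i) <= th)%R)%:R) e = th.
Proof.
move=> th01.
rewrite (_ : (fun e => _) = fun e => 1 + (-1) * ((th < kap a (e i))%R)%:R); last first.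
  by apply/funext => e'; rewrite leNgt; case: (_ < _) => /=; rewrite ?mulr1 ?mulr0 ?subrr ?addr0.
have bb := bm_kap_gt a th i.
rewrite E1D; [|exact: bm_cst|by apply: bmM => //; exact: bm_cst].
by rewrite E1_cst E1Z// E_kap_gt//; lra.
Qed.

Lemma E_kap_le_max a th i e : 0 <= th ->
  E i (fun e => ((kap a (e i) <= th)%R)%:R) e <= th.
Proof.
move=> th0; have [th1|th1] := leP th 1; first by rewrite E_kap_le// th0.
rewrite -[leRHS](E1_cst U th i e); apply: E1_le; [exact: bm_kap_le|exact: bm_cst|].
by move=> x; case: (kap _ _ <= th) => /=; lra.
Qed.

Lemma E_kap_itv a (lo hi : R) i e : 0 <= lo -> lo <= hi ->
  E i (fun e => ((lo <= kap a (e i) <= hi)%R)%:R) e <= hi - lo.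
Proof.
move=> lo0 lohi.
have blh : bm (fun e : env => ((lo <= kap a (e i) <= hi)%R)%:R : R).
  apply/bm_bool/mbool_and; apply: mbool_le; try exact: bm_cst; exact: bm_kap_cst.
have [lo1|lo1] := ltP 1 lo.
  rewrite [leLHS](_ : _ = 0) ?subr_ge0//.
  rewrite -[RHS](E1_cst U 0 i e); apply: E1_eq => x.
  by rewrite leNgt (le_lt_trans (kap_le1 _ _) lo1).
have [lo00|lo00] := eqVneq lo 0.
  move: blh; rewrite lo00 => blh; rewrite subr0; apply: le_trans (E_kap_le_max a i e (le_trans lo0 lohi)).
  apply: E1_le => //; first exact: bm_kap_le.
  by move=> x; rewrite kap_ge0.
have lop : 0 < lo by rewrite lt_neqAle eq_sym lo00.
(* [E_kap_le] only measures sets [kap <= th]. Since the lower end is included, the set removed is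
   [kap <= lo - eta'] with [eta'] as small as desired, and at most [lo / 2] so that [lo - eta']
   stays nonnegative. *)
apply/ler_addgt0Pr => eta eta0.
pose hi' := Num.min 1 hi; pose eta' := Num.min eta (lo / 2).
have e'0 : 0 < eta' by rewrite lt_min eta0 divr_gt0.
have e'1 : eta' <= eta by rewrite ge_min lexx.
have e'2 : eta' <= lo / 2 by rewrite ge_min lexx orbT.
have h1 : hi' <= 1 by rewrite ge_min lexx.
have h2 : hi' <= hi by rewrite ge_min lexx orbT.
have h3 : lo <= hi' by rewrite le_min lo1 lohi.
apply: (@le_trans _ _ (E i (fun e => ((kap a (e i) <= hi')%R)%:R +
    (-1) * ((kap a (e i) <= lo - eta')%R)%:R) e)).
  apply: E1_le => //.
    apply: bmD; first exact: bm_kap_le.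
    by apply: bmM; [exact: bm_cst|exact: bm_kap_le].
  move=> x; rewrite upd_same; set k := kap _ _.
  have k1 : k <= 1 := kap_le1 _ _.
  have -> : (k <= hi') = (k <= hi) by rewrite le_min k1.
  case: (lerP k hi) => ?; case: (lerP lo k) => ?; case: (lerP k (lo - eta')) => ? //=; lra.
rewrite E1D; [|exact: bm_kap_le|by apply: bmM; [exact: bm_cst|exact: bm_kap_le]].
rewrite E1Z; last exact: bm_kap_le.
rewrite !E_kap_le; first lra.
- by apply/andP; split; lra.
- by apply/andP; split; lra.
Qed.

(* An interval of length [ep] away from 0 has small probability, since
   the density of the power of a uniform variable blows up only at 0. *)
Lemma E_wdist_itv a (w0 ep r : R) i e : 0 < w0 -> 0 <= ep ->
  E i (fun e => ((w0 <= wdist a (e i))%R && (r - ep <= wdist a (e i) <= r)%R)%:R) e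
  <= ep / w0.
Proof.
move=> w00 ep0; pose lo := Num.max w0 (r - ep).
have rhs0 : 0 <= ep / w0 by rewrite divr_ge0// ltW.
have lo0 : 0 < lo by rewrite lt_max w00.
set F := fun e : env => _.
have [rlo|rlo] := ltP r lo.
  rewrite (_ : E i F e = 0)// -[RHS](E1_cst U 0 i e); apply: E1_eq => x.
  rewrite /F upd_same; set w := wdist _ _; case: andP => // -[? /andP[? ?]].
  by exfalso; move: rlo; rewrite lt_max; lra.
have [lo1|lo1] := ltP 1 lo.
  rewrite (_ : E i F e = 0)// -[RHS](E1_cst U 0 i e); apply: E1_eq => x.
  rewrite /F upd_same; have := wdist_le1 a x.
  set w := wdist _ _ => ?; case: andP => // -[? /andP[? ?]].
  by exfalso; move: lo1; rewrite lt_max; lra.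
have r0 : 0 <= r by apply: le_trans rlo; exact: ltW.
pose tl := lo `^ q^-1; pose tr := r `^ q^-1.
have tltr : tl <= tr by rewrite ge0_ler_powR ?nnegrE// ltW.
have tl0 : 0 <= tl by exact: powR_ge0.
apply: (@le_trans _ _ (tr - tl)).
  apply: le_trans (E_kap_itv a i e tl0 tltr); apply: E1_le.
  - rewrite /F; apply: bm_bool; apply: mbool_and.
      by apply: mbool_le; [exact: bm_cst|exact: bm_wdist_cst].
    apply: mbool_and; apply: mbool_le; by [exact: bm_cst|exact: bm_wdist_cst].
  - apply/bm_bool/mbool_and; apply: mbool_le; by [exact: bm_cst|exact: bm_kap_cst].
  move=> x; rewrite /F upd_same; case: andP => [[h1 /andP[h2 h3]]|_]; last by case: (_ && _).
  have -> : tl <= kap a x.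
    have : lo <= wdist a x by rewrite ge_max h1.
    apply: contraTT; rewrite -!ltNge => k.
    rewrite -(powR_invK (ltW lo0)) -/tl /wdist.
    by rewrite gt0_ltr_powR ?nnegrE ?kap_ge0.
  by rewrite -[_ <= tr]wdist_le// h3.
have lolo : tl <= 1.
  by rewrite powR_le1// ltW.
(* As [w0 <= lo], the ratio [r / lo] is at most [1 + ep / w0]; a root of order [q >= 1] only brings
   such a ratio closer to 1, which makes the bound uniform in [q]. *)
have rle : r <= lo * (1 + ep / w0).
  have h0 : r - ep <= lo by rewrite le_max lexx orbT.
  have h1 : r <= lo + ep by lra.
  apply: (le_trans h1); rewrite mulrDr mulr1 lerD2l mulrCA -{1}[ep]mulr1.
  by rewrite ler_wpM2l// ler_pdivlMr// mul1r le_max lexx.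
have : tr <= tl * (1 + ep / w0).
  apply: le_trans (_ : (lo * (1 + ep / w0)) `^ q^-1 <= _).
    by rewrite ge0_ler_powR ?nnegrE// mulr_ge0 ?addr_ge0// ltW.
  rewrite powRM ?addr_ge0 ?(ltW lo0)// ler_wpM2l//.
  rewrite -[leRHS]powRr1 ?addr_ge0// ler_powR ?lerDl//.
  by rewrite invf_le1.
by have := ler_wpM2r rhs0 lolo; rewrite mul1r; lra.
Qed.

End PowerDistance.

Ltac bmt := repeat
  match goal with
  | |- bm (fun _ => ?c) => exact (bm_cst c)
  | H : bm ?F |- bm ?G => constr_eq F G; exact H
  | H : bm ?F |- bm (fun e => ?G e) => constr_eq F G; exact H
  | |- bm (fun e => kap (e _) (e _)) => apply: bm_kap_var
  | |- bm (fun e => kap _ (e _)) => apply: bm_kap_cst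
  | |- bm (fun e => wdist _ (e _) (e _)) => apply: bm_wdist_var; assumption
  | |- bm (fun e => wdist _ _ (e _)) => apply: bm_wdist_cst; assumption
  | |- bm (fun e => @?F e + @?G e) => apply: (@bmD _ _ _ _ F G)
  | |- bm (fun e => - @?F e) => apply: (@bmN _ _ _ _ F)
  | |- bm (fun e => @?F e * @?G e) => apply: (@bmM _ _ _ _ F G)
  | |- bm (fun e => @?F e ^+ ?n) => apply: (@bmX _ _ _ _ F n)
  | |- bm (fun e => `|@?F e|) => apply: (@bm_norm _ _ _ _ F)
  | |- bm (fun e => expR (@?F e)) => apply: (@bm_expR _ _ _ _ F)
  | |- bm (fun e => cos (@?F e)) => apply: (@bm_cos _ _ _ _ F)
  | |- bm (fun e => sin (@?F e)) => apply: (@bm_sin _ _ _ _ F)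
  | |- bm (E1 _ _ _) => apply: bmE1
  | |- bm (Es _ _ _) => apply: bmEs
  | |- bm (fun e => E1 _ _ _ e) => apply: bmE1
  | |- bm (fun e => Es _ _ _ e) => apply: bmEs
  | |- bm (fun e => (nat_of_bool (@?b e))%:R) => apply: (@bm_bool _ _ _ _ b)
  | |- mbool (fun e => @?b e && @?c e) => apply: (@mbool_and _ _ _ b c)
  | |- mbool (fun e => ~~ @?b e) => apply: (@mbool_neg _ _ _ b)
  | |- mbool (fun e => (@?F e <= @?G e)%R) => apply: (@mbool_le _ _ _ _ F G)
  | |- mbool (fun e => (@?F e < @?G e)%R) => apply: (@mbool_lt _ _ _ _ F G)
  end.

(** * Covariance of two edge signs in one coordinate *)

Section SignCovariance.
Context {R : realType} (q : R).
Hypothesis q1 : 1 <= q.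
Local Notation TR := (measurableTypeR R).
Local Notation U := (@unif02 R).
Context {I : eqType}.
Local Notation env := (I -> TR).
Local Notation E i F := (@E1 R _ TR I U i F).
Local Notation W := (wdist q).

Definition sgl (w r : R) : R := 1 - 2 * ((r < w)%R)%:R.

Lemma sgl_norm w r : `|sgl w r| = 1.
Proof.
by rewrite /sgl; case: (r < w); rewrite ?mulr1 ?mulr0 ?subr0 ?normr1//
  -normrN opprB (_ : 2 - 1 = 1 :> R) ?normr1//; lra.
Qed.

Lemma bm_sgl (F G : env -> R) : bm F -> bm G -> bm (fun e => sgl (F e) (G e)).
Proof. by move=> bF bG; rewrite /sgl; bmt. Qed.

(** A threshold outside [[0, 1[] makes its sign constant, and the covariance is zero. If both
    thresholds exceed [ep], each sign is -1 only within [Dl] of an antipode; the covariance is four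
    times that of the two events, whose intersection is empty unless [a] and [b] are within [2 Dl].
    A threshold in [[0, ep]] is charged the trivial bound 2. *)
Lemma sign_cov_le (a b r r' Dl ep : R) (i : I) (e : env) :
  0 <= Dl -> 1 - Dl <= ep `^ q^-1 -> 0 <= ep ->
  `|E i (fun e => sgl (W a (e i)) r *
     (sgl (W b (e i)) r' - E i (fun e => sgl (W b (e i)) r') e)) e| <=
  4 * ((0 <= r < 1)%R%:R * (0 <= r' < 1)%R%:R *
    (Dl * ((kap a b <= 2 * Dl)%R)%:R + Dl ^+ 2)) +
  2 * (0 <= r <= ep)%R%:R + 2 * (0 <= r' <= ep)%R%:R.
Proof.
move=> Dl0 epDl ep0.
pose p e : R := sgl (W a (e i)) r; pose p' e : R := sgl (W b (e i)) r'.
have bp : bm p by apply: bm_sgl; bmt.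
have bp' : bm p' by apply: bm_sgl; bmt.
pose m : R := E i p' e.
have mE e' : E i p' e' = m.
  by rewrite /m; apply: eq_Rintegral => x _; rewrite /p' !upd_same.
rewrite (_ : (fun e => _) = fun e => p e * (p' e - m)); last first.
  by apply/funext => e'; rewrite -/(p' e') -(mE e').
have bF : bm (fun e => p e * (p' e - m)) by bmt.
set bd := (X in _ <= X).
have R0 : 0 <= bd.
  rewrite /bd; apply: addr_ge0; last by rewrite mulr_ge0.
  apply: addr_ge0; last by rewrite mulr_ge0.
  by rewrite mulr_ge0// mulr_ge0 ?mulr_ge0 ?addr_ge0 ?mulr_ge0 ?sqr_ge0.
have zero : (forall e, p' e = m) -> E i (fun e => p e * (p' e - m)) e = 0.
  move=> H; rewrite -[RHS](E1_cst U 0 i e); apply: E1_eq => x.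
  by rewrite H subrr mulr0.
have cstp c : (forall e, p e = c) -> E i (fun e => p e * (p' e - m)) e = 0.
  move=> H; rewrite (_ : (fun e => _) = fun e => c * (p' e + - m)); last first.
    by apply/funext => e'; rewrite H.
  rewrite E1Z; last by bmt.
  by rewrite E1D; [rewrite E1_cst mE subrr mulr0|exact: bp'|exact: bm_cst].
have [r0|r0] := ltP r 0.
  rewrite (cstp (-1)) ?normr0// => e'; rewrite /p /sgl.
  rewrite (lt_le_trans r0 (wdist_ge0 _ _ _)) /=; lra.
have [r1|r1] := leP 1 r.
  rewrite (cstp 1) ?normr0// => e'; rewrite /p /sgl ltNge.
  rewrite (le_trans (wdist_le1 q1 _ _) r1) /=; lra.
have mcst c : (forall e, p' e = c) -> m = c.
  by move=> H; rewrite /m -[RHS](E1_cst U c i e); apply: E1_eq => x; rewrite H.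
have [r'0|r'0] := ltP r' 0.
  have H e' : p' e' = -1.
    rewrite /p' /sgl (lt_le_trans r'0 (wdist_ge0 _ _ _)) /=; lra.
  by rewrite zero ?normr0// => e'; rewrite H (mcst _ H).
have [r'1|r'1] := leP 1 r'.
  have H e' : p' e' = 1.
    rewrite /p' /sgl ltNge (le_trans (wdist_le1 q1 _ _) r'1) /=; lra.
  by rewrite zero ?normr0// => e'; rewrite H (mcst _ H).
have triv : `|E i (fun e => p e * (p' e - m)) e| <= 2.
  have m1 : `|m| <= 1.
    apply: le_trans (@Es_norm _ _ _ _ U [:: i] p' e bp') _.
    apply: (@Es_le_cst _ _ _ _ U [:: i]) => [|e']; first by bmt.
    by rewrite sgl_norm.
  apply: le_trans (@Es_norm _ _ _ _ U [:: i] _ e bF) _.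
  apply: (@Es_le_cst _ _ _ _ U [:: i]) => [|e']; first by bmt.
  rewrite normrM sgl_norm mul1r; apply: le_trans (ler_normB _ _) _.
  by rewrite sgl_norm; lra.
rewrite /bd r0 r1 r'0 r'1 /= !mul1r.
set K := (X in 4 * X).
have K0 : 0 <= K by rewrite /K addr_ge0 ?mulr_ge0 ?sqr_ge0.
have [rep|rep] := leP r ep.
  apply: (le_trans triv); rewrite /= mulr1 -addrA addrCA lerDl.
  by rewrite addr_ge0 ?mulr_ge0.
have [r'ep|r'ep] := leP r' ep.
  apply: (le_trans triv); rewrite /= mulr1 mulr0 addr0 lerDr.
  by rewrite mulr_ge0.
rewrite !mulr0 !addr0.
pose th := r `^ q^-1; pose th' := r' `^ q^-1.
have qi0 : 0 <= q^-1 by rewrite invr_ge0 (le_trans _ q1).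
have th01 : 0 <= th <= 1 by rewrite powR_ge0 powR_le1// ltW.
have th'01 : 0 <= th' <= 1 by rewrite powR_ge0 powR_le1// ltW.
have dth : 1 - th <= Dl.
  have : ep `^ q^-1 <= th by rewrite ge0_ler_powR ?nnegrE// ltW.
  by move: epDl; lra.
have dth' : 1 - th' <= Dl.
  have : ep `^ q^-1 <= th' by rewrite ge0_ler_powR ?nnegrE// ltW.
  by move: epDl; lra.
pose A (e : env) : R := ((th < kap a (e i))%R)%:R.
pose B (e : env) : R := ((th' < kap b (e i))%R)%:R.
have bA : bm A by rewrite /A; bmt.
have bB : bm B by rewrite /B; bmt.
have pA e' : p e' = 1 - 2 * A e' by rewrite /p /sgl /A !ltNge wdist_le.
have p'B e' : p' e' = 1 - 2 * B e' by rewrite /p' /sgl /B !ltNge wdist_le.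
have EA : E i A e = 1 - th by exact: E_kap_gt.
have EB : E i B e = 1 - th' by exact: E_kap_gt.
have mB : m = 1 - 2 * (1 - th').
  rewrite /m (_ : p' = fun e => 1 + (-2) * B e); last first.
    by apply/funext => e'; rewrite p'B mulNr.
  rewrite E1D; [|exact: bm_cst|by bmt].
  by rewrite E1_cst E1Z// EB; lra.
have bAB : bm (fun e => A e * B e) by bmt.
have -> : E i (fun e => p e * (p' e - m)) e =
    4 * (E i (fun e => A e * B e) e - (1 - th) * (1 - th')).
  rewrite (_ : (fun e => p e * _) = fun e => 2 * (1 - th') +
     ((-2) * B e + (- (4 * (1 - th')) * A e + 4 * (A e * B e)))); last first.
    by apply/funext => e'; rewrite pA p'B mB; ring.
  rewrite E1D; [|exact: bm_cst|by bmt].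
  rewrite E1D; [|by bmt|by bmt].
  rewrite E1D; [|by bmt|by bmt].
  by rewrite E1_cst !E1Z// EA EB; ring.
rewrite normrM ger0_norm// ler_wpM2l//.
have AB0 : 0 <= E i (fun e => A e * B e) e.
  by apply: (@Es_ge0 _ _ _ _ U [:: i] _ e bAB) => e'; rewrite mulr_ge0.
have th0 : 0 <= 1 - th by rewrite subr_ge0; case/andP: th01.
have th'0 : 0 <= 1 - th' by rewrite subr_ge0; case/andP: th'01.
have ABle : E i (fun e => A e * B e) e <= Dl * ((kap a b <= 2 * Dl)%R)%:R.
  have [kd|kd] := leP (kap a b) (2 * Dl).
    rewrite mulr1; apply: le_trans dth; rewrite -EA; apply: E1_le => // x.
    by rewrite ler_piMr// /B; case: (_ < _).
  rewrite mulr0 -[leRHS](E1_cst U 0 i e); apply: E1_le => //; first exact: bm_cst.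
  move=> x; rewrite /A /B upd_same.
  case: (ltP th (kap a x)) => hA; last by rewrite mul0r.
  case: (ltP th' (kap b x)) => hB; last by rewrite mulr0.
  by exfalso; have := kap_perimeter a b x; lra.
have DD : (1 - th) * (1 - th') <= Dl ^+ 2 by rewrite expr2; apply: ler_pM.
apply: le_trans (ler_normB _ _) _.
by rewrite /K !ger0_norm ?mulr_ge0//; exact: lerD.
Qed.

End SignCovariance.

(** * Variance and covariance of powers of distances *)

Section PowerMoments.
Context {R : realType} (q : R).
Hypothesis q1 : 1 <= q.
Local Notation TR := (measurableTypeR R).
Local Notation U := (@unif02 R).
Context {I : eqType}.
Local Notation env := (I -> TR).
Local Notation E i F := (@E1 R _ TR I U i F).
Local Notation W := (wdist q).

Lemma E1_ge0 (F : env -> R) i e : bm F -> (forall e, 0 <= F e) -> 0 <= E i F e.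
Proof. by move=> bF F0; exact: (@Es_ge0 _ _ _ _ U [:: i] F e bF F0). Qed.

Definition wmean : R := \int[U]_t W 0 t.
(** By rotation invariance [W a] and [W b] both have mean [wmean], so this is their covariance at a
    common uniform point. *)
Definition wcov (a b : R) : R := \int[U]_t (W a t * W b t) - wmean ^+ 2.
Definition wvar : R := wcov 0 0.

(** Since [W] takes values in [[0, 1]], [f] can be clamped there; this admits functions unbounded on
    the line, such as [x] and [x * x]. *)
Lemma E_wdist_law01 (f : R -> R) a b i e : measurable_fun setT f ->
  (exists M, forall x, 0 <= x <= 1 -> `|f x| <= M) ->
  E i (fun e => f (W a (e i))) e = E i (fun e => f (W b (e i))) e.
Proof.
move=> mf [M fM]; pose g x := f (Num.max 0 (Num.min 1 x)).
have fg c t : f (W c t) = g (W c t).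
  by rewrite /g min_r ?wdist_le1// max_r// wdist_ge0.
have mg : measurable_fun setT g.
  by apply: (measurableT_comp mf); apply: measurable_maxr => //; apply: measurable_minr.
have bg : exists M, forall x, `|g x| <= M.
  exists M => x; apply: fM; rewrite le_max lexx ge_max ler01 ge_min lexx.
  by [].
have fgE c : (fun e : env => f (W c (e i))) = (fun e => g (W c (e i))).
  by apply/funext => e'; rewrite fg.
rewrite (fgE a) (fgE b); exact: E_wdist_law.
Qed.

Lemma E_wdist a i e : E i (fun e => W a (e i)) e = wmean.
Proof.
have bd : exists M : R, forall x, 0 <= x <= 1 -> `|x| <= M.
  by exists 1 => x /andP[x0 x1]; rewrite ger0_norm.
have h := @E_wdist_law01 (fun x => x) a 0 i e (@measurable_id _ _ setT) bd.
apply: (etrans h); apply: eq_Rintegral => x _; by rewrite upd_same.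
Qed.

Lemma E_wdist2 a b i e :
  E i (fun e => W a (e i) * W b (e i)) e = wcov a b + wmean ^+ 2.
Proof.
rewrite /wcov subrK; apply: eq_Rintegral => x _.
by rewrite upd_same.
Qed.

Lemma wcov_diag a (i : I) (e : env) : wcov a a = wvar.
Proof.
have bd : exists M : R, forall x, 0 <= x <= 1 -> `|x * x| <= M.
  by exists 1 => x /andP[x0 x1]; rewrite ger0_norm ?mulr_ge0// -[leRHS]mulr1 ler_pM.
have mf : measurable_fun setT (fun x : R => x * x) by exact: measurable_funM.
have h := @E_wdist_law01 (fun x => x * x) a 0 i e mf bd.
apply: (addIr (wmean ^+ 2)).
exact: etrans (esym (E_wdist2 a a i e)) (etrans h (E_wdist2 0 0 i e)).
Qed.

(** Both [W a - W b] and the centered [W a + W b] have nonnegative second moment, namely [2 wvar]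
    minus or plus [2 wcov a b]. *)
Lemma wcov_le a b (i : I) (e : env) : `|wcov a b| <= wvar.
Proof.
have bWW c c' : bm (fun e : env => W c (e i) * W c' (e i)) by bmt.
have bW c : bm (fun e : env => W c (e i)) by bmt.
have H1 : 0 <= E i (fun e => (W a (e i) - W b (e i)) ^+ 2) e.
  by apply: E1_ge0 => [|e']; [bmt|exact: sqr_ge0].
have H2 : 0 <= E i (fun e => (W a (e i) + W b (e i) - 2 * wmean) ^+ 2) e.
  by apply: E1_ge0 => [|e']; [bmt|exact: sqr_ge0].
have E1' : E i (fun e => (W a (e i) - W b (e i)) ^+ 2) e = 2 * wvar - 2 * wcov a b.
  rewrite (_ : (fun e => _) = fun e => W a (e i) * W a (e i) +
     (W b (e i) * W b (e i) + (-2) * (W a (e i) * W b (e i)))); last first.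
    by apply/funext => e'; ring.
  rewrite E1D; [|by bmt|by bmt]; rewrite E1D; [|by bmt|by bmt].
  rewrite E1Z; last exact: bWW.
  rewrite (E_wdist2 a a) (E_wdist2 b b) (E_wdist2 a b).
  by rewrite (wcov_diag a i e) (wcov_diag b i e); ring.
have E2' : E i (fun e => (W a (e i) + W b (e i) - 2 * wmean) ^+ 2) e =
    2 * wvar + 2 * wcov a b.
  rewrite (_ : (fun e => _) = fun e => W a (e i) * W a (e i) +
     (W b (e i) * W b (e i) + (2 * (W a (e i) * W b (e i)) +
      (- (4 * wmean) * W a (e i) + (- (4 * wmean) * W b (e i) + 4 * wmean ^+ 2))))); last first.
    by apply/funext => e'; ring.
  do 5 (rewrite E1D; [|by bmt|by bmt]).
  rewrite [E i (fun _ => 4 * _) e]E1_cst.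
  rewrite E1Z; last exact: bWW.
  rewrite E1Z; last exact: bW.
  rewrite E1Z; last exact: bW.
  rewrite (E_wdist2 a a) (E_wdist2 b b) (E_wdist2 a b) (E_wdist a) (E_wdist b).
  by rewrite (wcov_diag a i e) (wcov_diag b i e); ring.
move: H1 H2; rewrite E1' E2' => H1 H2.
by rewrite ler_norml; apply/andP; split; lra.
Qed.

(** Reading the covariance as an expectation over a spare coordinate [k] yields its measurability in
    the environment and allows Fubini. *)
Lemma wcov_env (i j k : I) (e : env) : k != i -> k != j ->
  wcov (e i) (e j) = E k (fun e => W (e i) (e k) * W (e j) (e k)) e - wmean ^+ 2.
Proof.
move=> ki kj; apply: (congr1 (fun x => x - wmean ^+ 2)).
apply: eq_Rintegral => x _; rewrite upd_same.
rewrite upd_diff; last by rewrite eq_sym.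
by rewrite upd_diff// eq_sym.
Qed.

Lemma bm_wcov (i j k : I) : k != i -> k != j ->
  bm (fun e : env => wcov (e i) (e j)).
Proof.
move=> ki kj; under eq_fun do rewrite (wcov_env _ ki kj).
by bmt.
Qed.

(** After exchanging the integrals, [W (e j) (e k)] averages over [e j] to [wmean] whatever [e k]
    is. *)
Lemma E_wcov (i j k : I) e : k != i -> k != j -> i != j ->
  E j (fun e => wcov (e i) (e j)) e = 0.
Proof.
move=> ki kj ij; under eq_fun do rewrite (wcov_env _ ki kj).
rewrite E1D; [|by bmt|exact: bm_cst].
rewrite E1_cst E1C; last by bmt.
rewrite (_ : E j _ = fun e => wmean * W (e i) (e k)); last first.
  apply/funext => e'; rewrite E1_indepM; last first.
  - by move=> e'' x; rewrite !upd_diff.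
  - by bmt.
  have h : E j (fun e => W (e j) (e k)) e' = wmean.
    apply: etrans (E_wdist (e' k) j e'); apply: E1_eq => x.
    by rewrite upd_same upd_diff// wdistC.
  by rewrite h mulrC.
rewrite E1Z; last by bmt.
have h : E k (fun e => W (e i) (e k)) e = wmean.
  apply: etrans (E_wdist (e i) k e); apply: E1_eq => x.
  by rewrite upd_same upd_diff// eq_sym.
by rewrite h expr2 subrr.
Qed.

(** [W 0] exceeds 3/4 with probability at least [1 / (5 q)] and is at most 1/2 with probability at
    least 1/2. The mean is at distance at least 1/8 from one of these ranges, 5/8 being the
    midpoint, which contributes 1/64 times the probability. The factor [1 / q] reflects that [W] is
    of order 1 only near the antipode. *)
Lemma wvar_ge (i : I) (e : env) : 1 / (320 * q) <= wvar.
Proof.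
have q0 : 0 < q by apply: lt_le_trans q1.
have qi0 : 0 <= q^-1 by rewrite invr_ge0 ltW.
have qi1 : q^-1 <= 1 by rewrite invf_le1.
have vE : wvar = E i (fun e => (W 0 (e i) - wmean) ^+ 2) e.
  rewrite (_ : (fun e => _) = fun e => W 0 (e i) * W 0 (e i) +
     (- (2 * wmean) * W 0 (e i) + wmean ^+ 2)); last by apply/funext => e'; ring.
  do 2 (rewrite E1D; [|by bmt|by bmt]).
  rewrite E1Z; last by bmt.
  by rewrite E1_cst (E_wdist2 0 0) (E_wdist 0) /wvar; ring.
have [w58|w58] := leP wmean (5 / 8).
  pose th : R := (3 / 4) `^ q^-1.
  have th01 : 0 <= th <= 1 by rewrite powR_ge0 powR_le1//; lra.
  apply: (@le_trans _ _ ((1 / 64) * (1 - th))).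
    suff : th <= 1 - 1 / (5 * q).
      have -> : 1 / (320 * q) = (1 / 64) * (1 / (5 * q)) by field; exact: lt0r_neq0.
      by move=> h; rewrite ler_wpM2l//; lra.
    have l34 : ln (3 / 4 : R) <= - (1 / 4).
      have -> : 3 / 4 = 1 + - (1 / 4) :> R by lra.
      by apply: le_ln1Dx; lra.
    have thE : th = expR (q^-1 * ln (3 / 4)).
      rewrite /th /powR ifF//; apply/negbTE; rewrite mulf_neq0// invr_eq0//.
    have h1 : th <= expR (- (q^-1 * (1 / 4))).
      by rewrite thE ler_expR -mulrN ler_wpM2l.
    apply: (le_trans h1); rewrite expRN.
    have h2 : 1 + q^-1 * (1 / 4) <= expR (q^-1 * (1 / 4)) by exact: expR_ge1Dx.
    have h3 : 0 < 1 + q^-1 * (1 / 4) by rewrite ltr_wpDr// mulr_ge0.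
    apply: (@le_trans _ _ ((1 + q^-1 * (1 / 4))^-1)).
      by rewrite lef_pV2 ?posrE ?expR_gt0.
    rewrite -(ler_pM2r h3) mulVf ?lt0r_neq0//.
    have -> : 1 / (5 * q) = q^-1 / 5 by field; exact: lt0r_neq0.
    have : 0 <= q^-1 * (1 - q^-1) by rewrite mulr_ge0// subr_ge0.
    by nra.
  rewrite vE -(E_kap_gt 0 i e th01) -E1Z; last exact: bm_kap_gt.
  apply: E1_le; [by bmt|by bmt|move=> x; rewrite upd_same].
  case: (ltP th (kap 0 x)) => hx; last by rewrite mulr0 sqr_ge0.
  rewrite mulr1; have : 3 / 4 < W 0 x.
    by rewrite ltNge (wdist_le q1)// -?ltNge//; lra.
  by move=> h; nra.
pose th : R := (1 / 2) `^ q^-1.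
have th01 : 0 <= th <= 1 by rewrite powR_ge0 powR_le1//; lra.
have th12 : 1 / 2 <= th.
  by apply: ger1_powR => //; apply/andP; split; lra.
apply: (@le_trans _ _ ((1 / 64) * th)).
  have -> : 1 / (320 * q) = q^-1 / 320 by field; exact: lt0r_neq0.
  by lra.
rewrite vE -{1}(E_kap_le 0 i e th01) -E1Z; last exact: bm_kap_le.
apply: E1_le; [by bmt|by bmt|move=> x; rewrite upd_same].
case: (leP (kap 0 x) th) => hx; last by rewrite mulr0 sqr_ge0.
rewrite mulr1; have : W 0 x <= 1 / 2 by rewrite (wdist_le q1)//; lra.
by move=> h; nra.
Qed.

End PowerMoments.

(** * Elementary bounds for cosines, exponential sums and Gaussian sums *)

Section Trigonometry.
Context {R : realType}.
Implicit Types x y : R.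

Lemma sin_MVT x : 0 <= x -> exists2 c : R, 0 <= c <= x & sin x = cos c * x.
Proof.
move=> x0.
have ds y : y \in `]0, x[%R -> is_derive y 1 (@sin R) (cos y) by move=> _; exact: is_derive_sin.
have cs : {within `[0, x], continuous (@sin R)}.
  by apply: continuous_subspaceT => y; exact: continuous_sin.
have [c cx] := MVT_segment x0 ds cs; rewrite sin0 !subr0 => ->.
by exists c => //; move: cx; rewrite in_itv.
Qed.

Lemma cos_half x : cos x = 1 - 2 * sin (x / 2) ^+ 2.
Proof.
have -> : cos x = cos (x / 2 + x / 2) by congr cos; lra.
by rewrite cosD -!expr2 cos2sin2; ring.
Qed.

Lemma cos_ge_quadratic x : 1 - x ^+ 2 / 2 <= cos x.
Proof.
wlog x0 : x / 0 <= x => [H|].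
  have [/H//|x0] := leP 0 x; have := H (- x); rewrite cosN sqrrN; apply; lra.
have y0 : 0 <= x / 2 by lra.
rewrite cos_half; have [c _ ->] := sin_MVT y0.
have := cos_le1 c; have := cos_geN1 c; set k := cos c => ? ?.
have : (k * (x / 2)) ^+ 2 <= (x / 2) ^+ 2.
  by rewrite exprMn ler_piMl ?sqr_ge0//; nra.
by rewrite !expr2; lra.
Qed.

Lemma cos_le_quadratic x : `|x| <= 1 -> cos x <= 1 - x ^+ 2 / 4.
Proof.
wlog x0 : x / 0 <= x => [H|].
  have [/H//|x0] := leP 0 x; have := H (- x); rewrite cosN sqrrN normrN; apply; lra.
rewrite ger0_norm// => x1; have y0 : 0 <= x / 2 by lra.
rewrite cos_half; have [c /andP[c0 cx] ->] := sin_MVT y0.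
have k78 : 7 / 8 <= cos c by apply: le_trans (cos_ge_quadratic c); nra.
have : (7 / 8 * (x / 2)) ^+ 2 <= (cos c * (x / 2)) ^+ 2.
  by rewrite ler_sqr ?nnegrE ?mulr_ge0 ?ler_wpM2r//; lra.
have : 0 <= x ^+ 2 by exact: sqr_ge0.
by rewrite !exprMn; set z := x ^+ 2; set k := cos c ^+ 2; lra.
Qed.

Lemma trig_combination_le (al c s : R) : (cos al * c + sin al * s) ^+ 2 <= c ^+ 2 + s ^+ 2.
Proof.
have -> : c ^+ 2 + s ^+ 2 = (cos al ^+ 2 + sin al ^+ 2) * (c ^+ 2 + s ^+ 2).
  by rewrite cos2Dsin2 mul1r.
have : 0 <= (cos al * s - sin al * c) ^+ 2 by exact: sqr_ge0.
by nra.
Qed.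

(** The squared modulus of a sum of complex exponentials, in real form. *)
Lemma sum_cos_sin_sqr (J : finType) (f : J -> R) :
  (\sum_j cos (f j)) ^+ 2 + (\sum_j sin (f j)) ^+ 2 =
  \sum_j \sum_k cos (f j - f k).
Proof.
rewrite !expr2 !mulr_suml -big_split /=; apply: eq_bigr => j _.
rewrite !mulr_sumr -big_split /=; apply: eq_bigr => k _.
by rewrite cosB.
Qed.

(** With truncated subtraction, the exponent is the distance between [k] and [j]. Both sides of [k]
    telescope after multiplication by [1 - r]. *)
Lemma geometric_two_sided (r : R) (k M : nat) : 0 <= r -> r <= 1 ->
  (1 - r) * \sum_(j < M) r ^+ ((k - j) + (j - k)) <= 2.
Proof.
move=> r0 r1.
have below m : (m <= k.+1)%N ->
    (1 - r) * \sum_(j < m) r ^+ ((k - j) + (j - k)) <= r ^+ (k.+1 - m).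
  elim: m => [_|m IH mk]; first by rewrite big_ord0 mulr0 exprn_ge0.
  rewrite big_ord_recr /= mulrDr; have := IH (ltnW mk).
  have -> : (k.+1 - m = (k - m).+1)%N by lia.
  have -> : (k.+1 - m.+1 = k - m)%N by lia.
  have -> : (k - m + (m - k) = k - m)%N by lia.
  by rewrite exprS; lra.
have [Mk|kM] := leqP M k.+1.
  have : r ^+ (k.+1 - M) <= 1 by rewrite exprn_ile1.
  by have := below _ Mk; lra.
have above m : (1 - r) * \sum_(j < k.+1 + m) r ^+ ((k - j) + (j - k)) <= 2 - r ^+ m.
  elim: m => [|m IH].
    rewrite addn0 expr0; have := below _ (leqnn _); rewrite subnn expr0; lra.
  rewrite addnS big_ord_recr mulrDr.
  have em : (k - (k.+1 + m) + (k.+1 + m - k))%N = m.+1 by lia.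
  rewrite [X in r ^+ X](em : _ = _) exprS.
  move: IH; set S := \sum_(_ < _) _ => IH.
  have : 0 <= r ^+ m * (1 - r) ^+ 2 by rewrite mulr_ge0 ?exprn_ge0// subr_ge0.
  by rewrite expr2; lra.
have -> : M = (k.+1 + (M - k.+1))%N by lia.
by apply: le_trans (above _) _; rewrite lerBlDr lerDl exprn_ge0.
Qed.

(** Integers satisfy [D <= D^2], which reduces to a two-sided geometric series of ratio at most
    32/33, hence of sum at most [2 * 33]. *)
Lemma gaussian_sum_le (k M : nat) :
  \sum_(j < M) expR (- ((k%:R - j%:R) ^+ 2 / 32)) <= 66 :> R.
Proof.
pose r : R := expR (- (1 / 32)).
have r0 : 0 <= r by exact: expR_ge0.
have r1 : r <= 32 / 33.
  rewrite /r expRN; have h := expR_ge1Dx (1 / 32 : R).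
  have -> : 32 / 33 = (1 + 1 / 32)^-1 :> R by field.
  by rewrite lef_pV2 ?posrE ?expR_gt0//; lra.
have r1' : r <= 1 by lra.
have S0 : 0 <= \sum_(j < M) r ^+ ((k - j) + (j - k)).
  by apply: sumr_ge0 => j _; rewrite exprn_ge0.
apply: (@le_trans _ _ (\sum_(j < M) r ^+ ((k - j) + (j - k)))); last first.
  by have := geometric_two_sided k M r0 r1'; nra.
apply: ler_sum => j _; rewrite /r -expRM_natl ler_expR mulrN lerN2.
set D := ((k - j) + (j - k))%N.
have -> : (k%:R - j%:R) ^+ 2 = D%:R ^+ 2 :> R.
  have [jk|kj] := leqP j k.
    have -> : D = (k - j)%N by rewrite /D; lia.
    by rewrite natrB.
  have -> : D = (j - k)%N by rewrite /D; lia.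
  by rewrite natrB ?(ltnW kj)//; ring.
have : (D%:R : R) <= D%:R ^+ 2 by rewrite -natrX ler_nat; case: D => // n; rewrite -{1}(expn1 n.+1) leq_pexp2l.
lra.
Qed.

Lemma sqrt_nat_approx x : 1 <= x -> exists2 M : nat, (0 < M)%N &
  (M%:R ^+ 2 <= x) /\ x <= 4 * M%:R ^+ 2.
Proof.
move=> x1; have x0 : 0 <= x by lra.
pose s := Num.sqrt x; have s0 : 0 <= s by exact: sqrtr_ge0.
have ss : s ^+ 2 = x by rewrite sqr_sqrtr.
have s1 : 1 <= s by rewrite -(sqrtr1 R) ler_sqrt.
have := truncn_itv s0; set M := Num.truncn s => /andP[Ms sM].
have M0 : (0 < M)%N by rewrite -(ltr_nat R); move: sM; rewrite -natr1; lra.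
have M1 : 1 <= M%:R :> R by rewrite ler1n.
exists M => //; rewrite -ss; split; first by rewrite ler_sqr ?nnegrE.
move: sM; rewrite -natr1 => sM; have : s <= 2 * M%:R by lra.
move=> h; have : s ^+ 2 <= (2 * M%:R) ^+ 2 by rewrite ler_sqr ?nnegrE ?mulr_ge0.
by rewrite exprMn; lra.
Qed.

End Trigonometry.

(** * A local limit bound for two sums, by characteristic functions *)

Section Anticoncentration.
Context {R : realType} {disp : measure_display} {T : measurableType disp}.
Context {I : eqType} (mu : probability T R).
Local Notation env := (I -> T).
Local Notation E1 := (@E1 R disp T I mu).
Local Notation Es := (@Es R disp T I mu).

(** Multiplicativity of the characteristic function of a sum of independent terms, for squared
    moduli. *)
Lemma char_prod s (th : I -> env -> R) e : uniq s -> (forall i, bm (th i)) ->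
  (forall i j, i \in s -> j \in s -> i != j -> indep j (th i)) ->
  Es s (fun e => cos (\sum_(i <- s) th i e)) e ^+ 2 +
  Es s (fun e => sin (\sum_(i <- s) th i e)) e ^+ 2 =
  \prod_(i <- s) (E1 i (fun e => cos (th i e)) e ^+ 2 +
                  E1 i (fun e => sin (th i e)) e ^+ 2).
Proof.
move=> + bth; elim: s => [|i s IH] /=.
  by rewrite !big_nil cos0 sin0 expr1n expr0n addr0.
case/andP=> is_ us ith.
pose S e := \sum_(j <- s) th j e.
have bS : bm S by exact: bm_sum.
have bi := bth i.
have neq j : j \in s -> i != j by move=> js; apply: contraNneq is_ => ->.
have S_indep : indep i S.
  move=> e' x; rewrite /S [LHS]big_seq [RHS]big_seq; apply: eq_bigr => j js.
  by apply: ith; rewrite ?mem_head// ?inE ?js ?orbT// eq_sym neq.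
have th_indep j : j \in s -> indep j (th i).
  by move=> js; apply: ith; rewrite ?mem_head// ?inE ?js ?orbT// neq.
have bc : bm (fun e => cos (S e)) by bmt.
have bs : bm (fun e => sin (S e)) by bmt.
have bci : bm (fun e => cos (th i e)) by bmt.
have bsi : bm (fun e => sin (th i e)) by bmt.
pose C := Es s (fun e => cos (S e)); pose D := Es s (fun e => sin (S e)).
have iC : indep i C by apply: indep_Es => e' x; rewrite S_indep.
have iD : indep i D by apply: indep_Es => e' x; rewrite S_indep.
have bC : bm C by exact: bmEs.
have bD : bm D by exact: bmEs.
have hc : E1 i (Es s (fun e => cos (\sum_(j <- i :: s) th j e))) e =
    C e * E1 i (fun e => cos (th i e)) e - D e * E1 i (fun e => sin (th i e)) e.
  rewrite (_ : Es s _ = fun e => C e * cos (th i e) + - (D e * sin (th i e))).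
    rewrite E1D; [|by bmt|by bmt].
    rewrite E1_indepM//; congr (_ + _).
    rewrite (_ : (fun e => _) = fun e => (-1) * (D e * sin (th i e))); last first.
      by apply/funext => e'; rewrite mulN1r.
    by rewrite E1Z ?E1_indepM ?mulN1r//; bmt.
  apply/funext => e'; rewrite (_ : (fun e => _) = fun e =>
    cos (th i e) * cos (S e) - sin (th i e) * sin (S e)).
    rewrite EsB; [|by bmt|by bmt].
    rewrite !Es_indepM//; first by rewrite mulrC [sin _ * _]mulrC.
    - by move=> j js e'' x; rewrite th_indep.
    - by move=> j js e'' x; rewrite th_indep.
  by apply/funext => e''; rewrite big_cons cosD.
have hs : E1 i (Es s (fun e => sin (\sum_(j <- i :: s) th j e))) e =
    C e * E1 i (fun e => sin (th i e)) e + D e * E1 i (fun e => cos (th i e)) e.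
  rewrite (_ : Es s _ = fun e => C e * sin (th i e) + D e * cos (th i e)).
    by rewrite E1D; [rewrite !E1_indepM|bmt|bmt].
  apply/funext => e'; rewrite (_ : (fun e => _) = fun e =>
    sin (th i e) * cos (S e) + cos (th i e) * sin (S e)).
    rewrite EsD; [|by bmt|by bmt].
    rewrite !Es_indepM//; first by rewrite mulrC [cos _ * _]mulrC.
    - by move=> j js e'' x; rewrite th_indep.
    - by move=> j js e'' x; rewrite th_indep.
  by apply/funext => e''; rewrite big_cons sinD.
rewrite hc hs big_cons -IH//; last first.
  by move=> j k js ks; apply: ith; rewrite inE ?js ?ks orbT.
by rewrite /C /D; ring.
Qed.

(** The squared modulus is the mean of [cos (th - th')] for two independent copies. As they differ
    by at most 1, the cosine is at most [1 - (th - th')^2 / 4], and the mean of [(th - th')^2] is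
    twice the variance. The copies are integrated one after the other. *)
Lemma char_one i (th : env -> R) e : bm th ->
  (forall x y, `|th (upd e i x) - th (upd e i y)| <= 1) ->
  E1 i (fun e => cos (th e)) e ^+ 2 + E1 i (fun e => sin (th e)) e ^+ 2 <=
  1 - (E1 i (fun e => th e ^+ 2) e - E1 i th e ^+ 2) / 2.
Proof.
move=> bth thb.
set c := E1 i (fun e => cos (th e)) e; set s := E1 i (fun e => sin (th e)) e.
set m2 := E1 i (fun e => th e ^+ 2) e; set m := E1 i th e.
have H y : c * cos (th (upd e i y)) + s * sin (th (upd e i y)) <=
    1 - (m2 - 2 * th (upd e i y) * m + th (upd e i y) ^+ 2) / 4.
  set z := th (upd e i y).
  have -> : c * cos z + s * sin z =
      E1 i (fun e => cos z * cos (th e) + sin z * sin (th e)) e.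
    rewrite E1D; [|by bmt|by bmt].
    by rewrite !E1Z; [rewrite mulrC [s * _]mulrC|bmt|bmt].
  have -> : 1 - (m2 - 2 * z * m + z ^+ 2) / 4 =
      E1 i (fun e => (1 - z ^+ 2 / 4) + ((- (1 / 4)) * th e ^+ 2 + (z / 2) * th e)) e.
    rewrite E1D; [|by bmt|by bmt].
    rewrite E1_cst E1D; [|by bmt|by bmt].
    by rewrite !E1Z; [rewrite /m2 /m; lra|bmt|bmt].
  apply: E1_le; [by bmt|by bmt|move=> x].
  rewrite mulrC [sin z * _]mulrC -cosB.
  apply: le_trans (cos_le_quadratic (thb x y)) _.
  by rewrite -/z !expr2; lra.
have : E1 i (fun e => c * cos (th e) + s * sin (th e)) e <=
    E1 i (fun e => (1 - m2 / 4) + ((- (1 / 4)) * th e ^+ 2 + (m / 2) * th e)) e.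
  apply: E1_le; [by bmt|by bmt|move=> x].
  by apply: le_trans (H x) _; rewrite !expr2; lra.
rewrite E1D; [|by bmt|by bmt].
rewrite E1Z; last by bmt.
rewrite E1Z; last by bmt.
rewrite E1D; [|by bmt|by bmt].
rewrite E1_cst E1D; [|by bmt|by bmt].
rewrite E1Z; last by bmt.
rewrite E1Z; last by bmt.
by rewrite -/c -/s -/m -/m2 => h; lra.
Qed.

Section TwoSums.
Variables (s : seq I) (X Y : I -> env -> R) (A B : env -> R) (e : env) (v : R).
Hypothesis us : uniq s.
Hypothesis bX : forall i, bm (X i).
Hypothesis bY : forall i, bm (Y i).
Hypothesis bA : bm A.
Hypothesis bB : bm B.
Hypothesis X01 : forall i e, 0 <= X i e <= 1.
Hypothesis Y01 : forall i e, 0 <= Y i e <= 1.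
Hypothesis iX : forall i j, i \in s -> j \in s -> i != j -> indep j (X i).
Hypothesis iY : forall i j, i \in s -> j \in s -> i != j -> indep j (Y i).
Hypothesis iA : {in s, forall i, indep i A}.
Hypothesis iB : {in s, forall i, indep i B}.
Let N : R := (size s)%:R.
Let cov i := E1 i (fun e => X i e * Y i e) e - E1 i (X i) e * E1 i (Y i) e.
Hypothesis varX : forall i, i \in s ->
  E1 i (fun e => X i e ^+ 2) e - E1 i (X i) e ^+ 2 = v.
Hypothesis varY : forall i, i \in s ->
  E1 i (fun e => Y i e ^+ 2) e - E1 i (Y i) e ^+ 2 = v.
(** Non-collinearity: the correlation of the two sums is at most 1/2, so their covariance matrix is
    at least half of its diagonal. *)
Hypothesis cov_le : `|\sum_(i <- s) cov i| <= N * v / 2.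
Let SX e := A e - \sum_(i <- s) X i e.
Let SY e := B e - \sum_(i <- s) Y i e.

Let bSX : bm SX. Proof. by apply: bmB => //; exact: bm_sum. Qed.
Let bSY : bm SY. Proof. by apply: bmB => //; exact: bm_sum. Qed.

(** The shifts [A] and [B] only add a phase. Each factor of the squared modulus is at most the
    exponential of minus half a variance, these variances add up to at least
    [t^2 (u^2 + w^2) N v / 2], and the square root halves the exponent once more. The condition on
    [t] keeps the oscillation of each term within 1. *)
Lemma char_two_le (t u w : R) : `|t * u| + `|t * w| <= 1 ->
  Es s (fun e => cos (t * (u * SX e + w * SY e))) e <=
  expR (- (t ^+ 2 * (u ^+ 2 + w ^+ 2) * (N * v)) / 8).
Proof.
move=> tuw.
pose th i e := t * u * X i e + t * w * Y i e.
pose al e := t * (u * A e + w * B e).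
have bth i : bm (th i) by have := bX i; have := bY i; rewrite /th => ? ?; bmt.
have bal : bm al by rewrite /al; bmt.
have bS : bm (fun e => \sum_(i <- s) th i e) by exact: bm_sum.
have -> : Es s (fun e => cos (t * (u * SX e + w * SY e))) e =
    cos (al e) * Es s (fun e => cos (\sum_(i <- s) th i e)) e +
    sin (al e) * Es s (fun e => sin (\sum_(i <- s) th i e)) e.
  have ial i : i \in s -> indep i al by move=> is_ e' x; rewrite /al iA// iB.
  rewrite -(@Es_indepM _ _ _ _ mu s (fun e => cos (al e))); first last.
  - by move=> i is_ e' x; rewrite ial.
  - by bmt.
  rewrite -(@Es_indepM _ _ _ _ mu s (fun e => sin (al e))); first last.
  - by move=> i is_ e' x; rewrite ial.
  - by bmt.
  rewrite -EsD; [|by bmt|by bmt]; congr (Es s _ e); apply/funext => e'.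
  rewrite -cosB; congr cos; rewrite /al /SX /SY /th big_split /= -!mulr_sumr.
  by ring.
apply: le_trans (ler_norm _) _.
rewrite -ler_sqr ?nnegrE ?expR_ge0// real_normK ?num_real//.
apply: le_trans (trig_combination_le _ _ _) _.
rewrite char_prod//; last first.
  by move=> i j is_ js ij e' x; rewrite /th iX// iY.
pose var i := t ^+ 2 * (u ^+ 2 * v + w ^+ 2 * v + 2 * u * w * cov i).
apply: (@le_trans _ _ (\prod_(i <- s) expR (- (var i / 2)))).
  rewrite big_seq [leRHS]big_seq; apply: ler_prod => i is_.
  rewrite addr_ge0 ?sqr_ge0//=.
  have bXi := bX i; have bYi := bY i; have bthi := bth i.
  apply: le_trans (char_one bthi _) _.
    move=> x y; rewrite /th.
    have D01 (a b : R) : 0 <= a <= 1 -> 0 <= b <= 1 -> `|a - b| <= 1.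
      by move=> /andP[? ?] /andP[? ?]; rewrite ler_norml; apply/andP; split; lra.
    have dx := D01 _ _ (X01 i (upd e i x)) (X01 i (upd e i y)).
    have dy := D01 _ _ (Y01 i (upd e i x)) (Y01 i (upd e i y)).
    move: dx dy.
    set x1 := X i _; set x2 := X i _; set y1 := Y i _; set y2 := Y i _ => dx dy.
    have -> : t * u * x1 + t * w * y1 - (t * u * x2 + t * w * y2) =
      t * u * (x1 - x2) + t * w * (y1 - y2) by ring.
    apply: le_trans (ler_normD _ _) _; rewrite !normrM.
    apply: le_trans tuw; rewrite !normrM; apply: lerD; by rewrite ler_piMr ?mulr_ge0.
  apply: le_trans (expR_ge1Dx _); rewrite lerD2l lerN2.
  suff -> : var i = E1 i (fun e => th i e ^+ 2) e - E1 i (th i) e ^+ 2 by [].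
  have -> : E1 i (th i) e = t * u * E1 i (X i) e + t * w * E1 i (Y i) e.
    by rewrite /th E1D; [rewrite !E1Z|bmt|bmt].
  have -> : E1 i (fun e => th i e ^+ 2) e = (t * u) ^+ 2 * E1 i (fun e => X i e ^+ 2) e +
     ((t * w) ^+ 2 * E1 i (fun e => Y i e ^+ 2) e +
      2 * t ^+ 2 * u * w * E1 i (fun e => X i e * Y i e) e).
    rewrite (_ : (fun e => th i e ^+ 2) = fun e => (t * u) ^+ 2 * X i e ^+ 2 +
      ((t * w) ^+ 2 * Y i e ^+ 2 + 2 * t ^+ 2 * u * w * (X i e * Y i e))).
      rewrite E1D; [|by bmt|by bmt].
      rewrite E1D; [|by bmt|by bmt].
      by rewrite !E1Z; [|bmt|bmt|bmt].
    by apply/funext => e'; rewrite /th; ring.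
  have := varX is_; have := varY is_; rewrite /var /cov.
  set a1 := E1 i (fun e => X i e ^+ 2) e; set a2 := E1 i (X i) e.
  set b1 := E1 i (fun e => Y i e ^+ 2) e; set b2 := E1 i (Y i) e.
  move=> hb ha; rewrite -{1}ha -hb; ring.
rewrite -expR_sum -expRM_natl ler_expR sumrN -mulr_suml.
have -> : \sum_(i <- s) var i = t ^+ 2 * ((u ^+ 2 + w ^+ 2) * (N * v) +
    2 * u * w * \sum_(i <- s) cov i).
  rewrite /var -mulr_sumr big_split /=; congr (_ * (_ + _)).
    rewrite big_const_seq count_predT iter_addr addr0 /N -mulr_natl; ring.
  by rewrite mulr_sumr.
set c := \sum_(i <- s) cov i.
have h : `|2 * u * w * c| <= (u ^+ 2 + w ^+ 2) * (N * v / 2).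
  rewrite normrM; apply: ler_pM => //.
  have := sqr_ge0 (u + w); have := sqr_ge0 (u - w).
  by rewrite ler_norml => ? ?; apply/andP; split; lra.
have := sqr_ge0 t; set t2 := t ^+ 2 => t20.
move: h; rewrite ler_norml => /andP[h1 _].
have : 0 <= t2 * ((u ^+ 2 + w ^+ 2) * (N * v / 2) + 2 * u * w * c).
  by rewrite mulr_ge0//; lra.
by lra.
Qed.

(** The indicator of the unit square is dominated by a multiple of the squared modulus of an
    exponential sum over an [M] by [M] grid of frequencies, [M] being of the order of [sqrt (N v)].
    Its expectation is a double sum of characteristic functions with Gaussian decay, at most
    [(66 M)^2]. This gives [132^2 / M^2], and [N v <= 4 M^2] turns it into the bound. *)
Lemma anticoncentration : (0 < size s)%N -> 0 < v ->
  Es s (fun e => ((0 <= SX e < 1)%R && (0 <= SY e < 1)%R)%:R) e <= 264 ^+ 2 / (N * v).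
Proof.
move=> s0 v0; have N0 : 0 < N by rewrite ltr0n.
have Nv0 : 0 < N * v by rewrite mulr_gt0.
have bind : bm (fun e => ((0 <= SX e < 1)%R && (0 <= SY e < 1)%R)%:R : R) by bmt.
have [Nv1|Nv1] := leP 1 (N * v); last first.
  apply: (@le_trans _ _ 1); last by rewrite ler_pdivlMr//; lra.
  by apply: Es_le_cst => // e'; case: (_ && _).
have [M M0 [M1 M2]] := sqrt_nat_approx Nv1.
have Mp : 0 < M%:R :> R by rewrite ltr0n.
have Mp1 : 1 <= M%:R :> R by rewrite ler1n.
(* On the unit square every phase [f j] is then in [[0, 1]], where the cosine is at least 1/2. *)
pose t : R := (2 * M%:R)^-1.
have tM : t * M%:R = 1 / 2 by rewrite /t; field; exact: lt0r_neq0.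
have t0 : 0 <= t by rewrite invr_ge0 mulr_ge0.
pose J : finType := ('I_M * 'I_M)%type.
pose f (j : J) e := t * (j.1%:R * SX e + j.2%:R * SY e).
pose g (j k : J) e := cos (t * ((j.1%:R - k.1%:R) * SX e + (j.2%:R - k.2%:R) * SY e)).
have bg j k : bm (g j k) by rewrite /g; bmt.
have gE j k e' : g j k e' = cos (f j e' - f k e') by rewrite /g /f; congr cos; ring.
have kernel e' : ((0 <= SX e' < 1)%R && (0 <= SY e' < 1)%R)%:R <=
    4 / M%:R ^+ 4 * \sum_j \sum_k g j k e'.
  have -> : \sum_j \sum_k g j k e' =
      (\sum_j cos (f j e')) ^+ 2 + (\sum_j sin (f j e')) ^+ 2.
    by rewrite sum_cos_sin_sqr; apply: eq_bigr => j _; apply: eq_bigr => k _; rewrite gE.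
  have K0 : 0 <= (\sum_j cos (f j e')) ^+ 2 + (\sum_j sin (f j e')) ^+ 2.
    by rewrite addr_ge0 ?sqr_ge0.
  have c0 : 0 <= 4 / M%:R ^+ 4 :> R by rewrite divr_ge0 ?exprn_ge0.
  case: andP => [[/andP[x0 x1] /andP[y0 y1]]|_]; last by rewrite mulr_ge0.
  have h : M%:R ^+ 2 / 2 <= \sum_j cos (f j e').
    have -> : M%:R ^+ 2 / 2 = \sum_(j : J) (1 / 2 : R).
      by rewrite sumr_const card_prod card_ord -[RHS]mulr_natl natrM expr2 mul1r.
    apply: ler_sum => j _; apply: le_trans (cos_ge_quadratic _).
    have j1 : (j.1%:R : R) <= M%:R by rewrite ler_nat ltnW.
    have j2 : (j.2%:R : R) <= M%:R by rewrite ler_nat ltnW.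
    have f0 : 0 <= f j e' by rewrite /f !mulr_ge0// addr_ge0// mulr_ge0.
    have f1 : f j e' <= 1.
      have p1 : j.1%:R * SX e' <= M%:R * 1 by apply: ler_pM => //; exact: ltW.
      have p2 : j.2%:R * SY e' <= M%:R * 1 by apply: ler_pM => //; exact: ltW.
      have : t * (j.1%:R * SX e' + j.2%:R * SY e') <= t * (2 * M%:R).
        by rewrite ler_wpM2l//; lra.
      by rewrite /f; lra.
    by nra.
  have hh : M%:R ^+ 4 / 4 <= (\sum_j cos (f j e')) ^+ 2.
    have -> : M%:R ^+ 4 / 4 = (M%:R ^+ 2 / 2) ^+ 2 :> R by field.
    by rewrite ler_sqr ?nnegrE ?divr_ge0 ?sqr_ge0//; apply: le_trans h; rewrite divr_ge0 ?sqr_ge0.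
  have M4 : 0 < M%:R ^+ 4 :> R by rewrite exprn_gt0.
  apply: (@le_trans _ _ (4 / M%:R ^+ 4 * (M%:R ^+ 4 / 4))).
    by rewrite mulrA divfK ?lt0r_neq0// divff.
  by rewrite ler_wpM2l//; have := sqr_ge0 (\sum_j sin (f j e')); lra.
have bK : bm (fun e => \sum_j \sum_k g j k e).
  by apply: bm_sum => j; apply: bm_sum => k; exact: bg.
apply: (@le_trans _ _ (Es s (fun e => 4 / M%:R ^+ 4 * \sum_j \sum_k g j k e) e)).
  by apply: Es_le => //; bmt.
rewrite EsZ// Es_sum; last by move=> j; apply: bm_sum => k; exact: bg.
pose G (a b : nat) : R := expR (- ((a%:R - b%:R) ^+ 2 / 32)).
have gle j k : Es s (g j k) e <= G j.1 k.1 * G j.2 k.2.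
  have b1 (a b : 'I_M) : `|(a%:R : R) - b%:R| <= M%:R.
    have a1 : (a%:R : R) <= M%:R by rewrite ler_nat ltnW.
    have b1 : (b%:R : R) <= M%:R by rewrite ler_nat ltnW.
    have a0 : 0 <= (a%:R : R) by [].
    have b0 : 0 <= (b%:R : R) by [].
    by rewrite ler_norml; apply/andP; split; lra.
  apply: le_trans (char_two_le _) _.
    rewrite !normrM (ger0_norm t0).
    by have := ler_wpM2l t0 (b1 j.1 k.1); have := ler_wpM2l t0 (b1 j.2 k.2); lra.
  rewrite /G -expRD ler_expR.
  set u2 := (j.1%:R - k.1%:R) ^+ 2; set w2 := (j.2%:R - k.2%:R) ^+ 2.
  have u0 : 0 <= u2 by exact: sqr_ge0.
  have w0 : 0 <= w2 by exact: sqr_ge0.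
  (* With [M^2 <= N v], this turns the exponent of [char_two_le] into the 1/32 of
     [gaussian_sum_le]. *)
  have tN : 1 / 4 <= t ^+ 2 * (N * v).
    have -> : 1 / 4 = t ^+ 2 * M%:R ^+ 2 by rewrite -exprMn tM; field.
    by rewrite ler_wpM2l ?sqr_ge0.
  have := ler_wpM2r (addr_ge0 u0 w0) tN.
  have -> : t ^+ 2 * (N * v) * (u2 + w2) = t ^+ 2 * (u2 + w2) * (N * v) by ring.
  by move=> h; lra.
apply: (@le_trans _ _ (4 / M%:R ^+ 4 * (66 * M%:R) ^+ 2)).
  rewrite ler_wpM2l ?divr_ge0 ?exprn_ge0//.
  apply: (@le_trans _ _ (\sum_(j : J) \sum_(k : J) G j.1 k.1 * G j.2 k.2)).
    apply: ler_sum => j _; rewrite Es_sum; last by move=> k; exact: bg.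
    by apply: ler_sum => k _.
  have G0 a b : 0 <= G a b by exact: expR_ge0.
  apply: (@le_trans _ _ (\sum_(j : J) (66 * 66))).
    apply: ler_sum => j _.
    rewrite -(pair_bigA _ (fun k1 k2 : 'I_M => G j.1 k1 * G j.2 k2)) /=.
    under eq_bigr do rewrite -mulr_sumr.
    rewrite -mulr_suml; apply: ler_pM; try by apply: sumr_ge0.
      exact: gaussian_sum_le.
    exact: gaussian_sum_le.
  rewrite sumr_const card_prod card_ord -[leLHS]mulr_natl natrM; lra.
have -> : 4 / M%:R ^+ 4 * (66 * M%:R) ^+ 2 = 132 ^+ 2 / M%:R ^+ 2 :> R.
  by field; exact: lt0r_neq0.
have M20 : 0 < M%:R ^+ 2 :> R by rewrite exprn_gt0.
rewrite ler_pdivrMr// mulrAC ler_pdivlMr//; lra.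
Qed.
End TwoSums.
End Anticoncentration.

Lemma sgl_shift {R : realType} (a b r : R) : sgl (a + b) r = sgl a (r - b).
Proof. by rewrite /sgl ltrBlDr. Qed.

Lemma measurable_sgl {R : realType} (r : R) : measurable_fun setT (fun w => sgl w r).
Proof.
apply: measurable_funB => //; apply: measurable_funM => //.
rewrite (_ : (fun w => _) = fun w => if r < w then 1 else 0); last first.
  by apply/funext => w; case: (r < w).
by apply: measurable_fun_ifT => //; exact: measurable_fun_ltr.
Qed.

Lemma ptE d i : pt d i = [seq (i, j) | j <- iota 0 d].
Proof. by []. Qed.

(* Unfolding these while testing for convertibility is prohibitively slow. *)
Opaque wdist kap sgl Rintegral.

(** * Edge signs on the torus *)

Section Torus.
Context {R : realType} (q : R) (d : nat) (tq : R).
Hypothesis q1 : 1 <= q.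
Local Notation TR := (measurableTypeR R).
Local Notation U := (@unif02 R).
Local Notation env := ((nat * nat)%type -> TR).
Local Notation E i F := (@E1 R _ TR (nat * nat)%type U i F).
Local Notation Es s F := (@Es R _ TR (nat * nat)%type U s F).
Local Notation W := (wdist q).
Local Notation pt := (pt d).
Implicit Types (x y z j l : nat) (e : env).

Definition qsum x z e : R := \sum_(l <- iota 0 d) W (e (x, l)) (e (z, l)).
Definition adj x z e : R := sgl (qsum x z e) tq.
Definition slack j x z e : R :=
  tq - \sum_(l <- iota 0 d | l != j) W (e (x, l)) (e (z, l)).

Lemma bm_qsum x z : bm (qsum x z).
Proof. by apply: bm_sum => l; exact: bm_wdist_var. Qed.

Lemma bm_adj x z : bm (adj x z).
Proof. by apply: bm_sgl; [exact: bm_qsum|exact: bm_cst]. Qed.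

Lemma bm_slack j x z : bm (slack j x z).
Proof. by apply: bmB; [exact: bm_cst|apply: bm_sum => l; exact: bm_wdist_var]. Qed.

Lemma adj_norm x z e : `|adj x z e| = 1.
Proof. exact: sgl_norm. Qed.

Lemma adjC x z : adj x z = adj z x.
Proof.
apply/funext => e; rewrite /adj /qsum.
by under eq_bigr do rewrite wdistC.
Qed.

Lemma adj_rename (sg : nat -> nat) x z e :
  adj x z (fun p => e (sg p.1, p.2)) = adj (sg x) (sg z) e.
Proof. by []. Qed.

Lemma dep_adj x z : depends
  [pred p : nat * nat | ((p.1 == x) || (p.1 == z)) && (p.2 < d)%N] (adj x z).
Proof.
move=> e e' ee'; suff h : qsum x z e = qsum x z e' by rewrite /adj h.
rewrite /qsum [LHS]big_seq [RHS]big_seq; apply: eq_bigr => l; rewrite mem_iota /= add0n => ld.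
by rewrite !ee' //= ?eqxx ?orbT ?ld.
Qed.

Lemma indep_adj x z p : ~~ (((p.1 == x) || (p.1 == z)) && (p.2 < d)%N) ->
  indep p (adj x z).
Proof. by move=> h; apply: depends_indep (@dep_adj x z). Qed.

Lemma adj_slack j x z e : (j < d)%N ->
  adj x z e = sgl (W (e (x, j)) (e (z, j))) (slack j x z e).
Proof.
move=> jd; rewrite /adj /qsum (bigD1_seq j) ?iota_uniq ?mem_iota//=.
exact: sgl_shift.
Qed.

Lemma slack_upd_x j x z e t : x != z -> slack j x z (upd e (x, j) t) = slack j x z e.
Proof.
move=> xz; apply: (congr1 (fun s => tq - s)); apply: eq_bigr => l lj.
by rewrite !upd_diff ?xpair_eqE ?(negbTE lj) ?andbF.
Qed.

Lemma slack_upd_z j x z e t : x != z -> slack j x z (upd e (z, j) t) = slack j x z e.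
Proof.
move=> xz; apply: (congr1 (fun s => tq - s)); apply: eq_bigr => l lj.
by rewrite !upd_diff ?xpair_eqE ?(negbTE lj) ?andbF.
Qed.

Lemma E_sgl_law (a b r : R) i e :
  E i (fun e => sgl (W a (e i)) r) e = E i (fun e => sgl (W b (e i)) r) e.
Proof.
apply: (@E_wdist_law R q _ (fun w => sgl w r) a b i e); first exact: measurable_sgl.
by exists 1 => w; rewrite sgl_norm.
Qed.

(* By symmetry of the circle, averaging over either end point of a pair gives
   the same result. *)
Lemma E_adj_exch j x z e : (j < d)%N -> x != z ->
  E (x, j) (adj x z) e = E (z, j) (adj x z) e.
Proof.
move=> jd xz; pose r := slack j x z e.
have h1 : E (x, j) (adj x z) e = E (x, j) (fun e' => sgl (W (e (z, j)) (e' (x, j))) r) e.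
  apply: E1_eq => t; rewrite (adj_slack _ _ _ jd) (slack_upd_x j e t xz) wdistC upd_same.
  have -> : upd e (x, j) t (z, j) = e (z, j).
    by rewrite upd_diff// xpair_eqE eq_sym (negbTE xz).
  by [].
have h2 : E (z, j) (adj x z) e = E (z, j) (fun e' => sgl (W (e (x, j)) (e' (z, j))) r) e.
  apply: E1_eq => t; rewrite (adj_slack _ _ _ jd) (slack_upd_z j e t xz) upd_same.
  have -> : upd e (z, j) t (x, j) = e (x, j).
    by rewrite upd_diff// xpair_eqE (negbTE xz).
  by [].
have h3 : E (x, j) (fun e' => sgl (W (e (z, j)) (e' (x, j))) r) e =
    E (z, j) (fun e' => sgl (W (e (z, j)) (e' (z, j))) r) e.
  by apply: eq_Rintegral => t _; rewrite !upd_same.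
by rewrite h1 h2 h3; exact: E_sgl_law.
Qed.

(** * The mean of an edge sign given one end point *)

Section MeanZero.

Let base z e : R := sgl (\sum_(l <- iota 0 d) W 0 (e (z, l))) tq.

(** A hybrid between [adj x z] ([r] empty) and [base z] ([r'] empty): the coordinates of [x] in [r]
    have been replaced by 0, one at a time, by rotation invariance in [z]. *)
Let mixed (r r' : seq nat) x z e : R := sgl (\sum_(l <- r) W 0 (e (z, l)) +
  \sum_(l <- r') W (e (x, l)) (e (z, l))) tq.

Let bm_mixed r r' x z : bm (mixed r r' x z).
Proof.
apply: bm_sgl; last exact: bm_cst.
by apply: bmD; apply: bm_sum => l; [exact: bm_wdist_cst|exact: bm_wdist_var].
Qed.

Lemma Es_adj_base x z : x != z ->
  Es (pt z) (adj x z) = Es (pt z) (base z).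
Proof.
move=> xz.
suff H r r' : uniq (r ++ r') -> {subset r' <= iota 0 d} ->
    Es (pt z) (mixed r r' x z) = Es (pt z) (mixed (r ++ r') [::] x z).
  have := H [::] (iota 0 d) (iota_uniq _ _) (fun x h => h).
  rewrite (_ : mixed [::] _ x z = adj x z); last first.
    by apply/funext => e; rewrite /mixed big_nil add0r.
  rewrite (_ : mixed ([::] ++ iota 0 d) [::] x z =
    base z)//.
  by apply/funext => e; rewrite /mixed big_nil addr0.
elim: r' r => [|j r' IH] r ur sr; first by rewrite cats0.
rewrite -cat_rcons -IH; last 2 first.
- by rewrite cat_rcons.
- by move=> l lr; apply: sr; rewrite inE lr orbT.
have jd : (z, j) \in pt z.
  by rewrite mem_pt eqxx /=; have := sr j (mem_head _ _); rewrite mem_iota.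
rewrite -(Es_E1_in U jd (bm_mixed r (j :: r') x z)).
rewrite -(Es_E1_in U jd (bm_mixed (rcons r j) r' x z)).
congr (Es (pt z) _); apply/funext => e.
move: ur; rewrite uniq_catC /= mem_cat negb_or => /andP[/andP[jr' jr] _].
pose a : R := tq - (\sum_(l <- r) W 0 (e (z, l)) +
  \sum_(l <- r') W (e (x, l)) (e (z, l))).
have h l t : l != j -> upd e (z, j) t (z, l) = e (z, l).
  by move=> lj; rewrite upd_diff// xpair_eqE (negbTE lj) andbF.
have hx l t : upd e (z, j) t (x, l) = e (x, l).
  by rewrite upd_diff// xpair_eqE (negbTE xz).
have s1 t : \sum_(l <- r) W 0 (upd e (z, j) t (z, l)) = \sum_(l <- r) W 0 (e (z, l)).
  rewrite [LHS]big_seq [RHS]big_seq; apply: eq_bigr => l lr; rewrite h//.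
  by apply: contraNneq jr => <-.
have s2 t : \sum_(l <- r') W (upd e (z, j) t (x, l)) (upd e (z, j) t (z, l)) =
    \sum_(l <- r') W (e (x, l)) (e (z, l)).
  rewrite [LHS]big_seq [RHS]big_seq; apply: eq_bigr => l lr; rewrite hx h//.
  by apply: contraNneq jr' => <-.
have h1 : E (z, j) (mixed r (j :: r') x z) e =
    E (z, j) (fun e' => sgl (W (e (x, j)) (e' (z, j))) a) e.
  apply: E1_eq => t; rewrite /mixed big_cons s1 s2 hx upd_same /a -sgl_shift.
  by rewrite addrCA.
have h2 : E (z, j) (mixed (rcons r j) r' x z) e =
    E (z, j) (fun e' => sgl (W 0 (e' (z, j))) a) e.
  apply: E1_eq => t; rewrite /mixed -cats1 big_cat big_seq1 /= s1 s2 upd_same /a -sgl_shift.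
  by rewrite [_ + W _ _]addrC -addrA.
by rewrite h1 h2; exact: E_sgl_law.
Qed.

Lemma dep_base z : depends [pred p : nat * nat | (p.1 == z) && (p.2 < d)%N] (base z).
Proof.
move=> e e' ee'; rewrite /base; suff -> : \sum_(l <- iota 0 d) W 0 (e (z, l)) =
  \sum_(l <- iota 0 d) W 0 (e' (z, l)) by [].
rewrite [LHS]big_seq [RHS]big_seq; apply: eq_bigr => l; rewrite mem_iota /= add0n => ld.
by rewrite ee' //= ?eqxx ?ld.
Qed.

Definition swap_names (z z' i : nat) : nat :=
  if i == z then z' else if i == z' then z else i.

Lemma swap_namesK z z' : involutive (swap_names z z').
Proof.
move=> i; rewrite /swap_names; case: (eqVneq i z) => [->|iz].
  by rewrite eqxx; case: eqVneq => // ->.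
case: (eqVneq i z') => [->|iz']; first by rewrite eqxx.
by rewrite (negbTE iz) (negbTE iz').
Qed.

(** The mean over [z] is that of [base z], which involves no other vertex, and the name [z] is
    bound. *)
Lemma Es_adj_cst x z x' z' e e' : x != z -> x' != z' ->
  Es (pt z) (adj x z) e = Es (pt z') (adj x' z') e'.
Proof.
move=> xz xz'; rewrite (Es_adj_base xz) (Es_adj_base xz').
pose sg (p : nat * nat) := (swap_names z z' p.1, p.2).
have sgK : involutive sg by move=> [i j]; rewrite /sg /= swap_namesK.
have -> : pt z' = map sg (pt z).
  by rewrite !ptE -map_comp; apply: eq_map => j; rewrite /sg /swap_names /= eqxx.
rewrite Es_rename//.
have hb : (fun e => base z' (fun p => e (sg p))) = base z.
  apply/funext => e1; rewrite /base.
  have hz l : sg (z', l) = (z, l).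
    by rewrite /sg /swap_names /= eqxx; case: eqVneq => // ->.
  by under eq_bigr do rewrite hz.
rewrite hb.
have dd := @depends_Es _ _ _ _ U _ (pt z) _ (@dep_base z).
by apply: dd => p; rewrite mem_pt /= => /andP[->].
Qed.

End MeanZero.
End Torus.

Opaque wcov wvar wmean.

Lemma slackE {R : realType} (q : R) d tq j x z (e : nat * nat -> measurableTypeR R) :
  slack q d tq j x z e = tq - \sum_(l <- iota 0 d | l != j) wdist q (e (x, l)) (e (z, l)).
Proof. by []. Qed.

Lemma wvar_gt0 {R : realType} (q : R) : 1 <= q -> 0 < wvar q.
Proof.
move=> q1; have q0 : 0 < q by exact: lt_le_trans q1.
have c0 : 0 < 320 * q by apply: mulr_gt0; [rewrite ltr0n|exact: q0].
apply: lt_le_trans (wvar_ge q1 (0%N, 0%N) (fun _ : nat * nat => 0)).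
by rewrite mul1r invr_gt0.
Qed.

(** * Increments of the conditional covariance of two edges *)

Section Increments.
Context {R : realType} (q : R) (d : nat) (tq : R).
Hypothesis q1 : 1 <= q.
Local Notation TR := (measurableTypeR R).
Local Notation U := (@unif02 R).
Local Notation env := ((nat * nat)%type -> TR).
Local Notation E i F := (@E1 R _ TR (nat * nat)%type U i F).
Local Notation Es s F := (@Es R _ TR (nat * nat)%type U s F).
Local Notation W := (wdist q).
Local Notation pt := (pt d).
Local Notation adj := (adj q d tq).
Local Notation slack := (slack q d tq).
Variables x y z : nat.
Hypothesis xy : x != y.
Hypothesis xz : x != z.
Hypothesis yz : y != z.
Implicit Types (j l : nat) (e : env).

Definition corr e : R := Es (pt z) (fun e => adj x z e * adj y z e) e.
(** The [j]-th term of the sum lies in [[0, 1]], so it can decide an edge only if the slack lies in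
    [[0, 1[]. *)
Definition pivot j e : R :=
  ((0 <= slack j x z e < 1)%R && (0 <= slack j y z e < 1)%R)%:R.
(** For such slacks the set where coordinate [j] removes the edge is not confined to a short arc
    around the antipode. *)
Definition tiny ep j x' e : R := ((0 <= slack j x' z e <= ep)%R)%:R.

Lemma bm_corr : bm corr.
Proof. by apply: bmEs; apply: bmM; exact: bm_adj. Qed.

Lemma bm_pivot j : bm (pivot j).
Proof.
have b1 := bm_slack d tq q1 j x z; have b2 := bm_slack d tq q1 j y z.
by rewrite /pivot; bmt.
Qed.

Lemma bm_tiny ep j x' : bm (tiny ep j x').
Proof. by have b1 := bm_slack d tq q1 j x' z; rewrite /tiny; bmt. Qed.

Lemma pivot_le1 j e : pivot j e <= 1.
Proof. by rewrite /pivot; case: (_ && _). Qed.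

(** [adj x z] does not involve [y], and by [E_adj_exch] integrating [(y, j)] out of [adj y z]
    amounts to integrating [(z, j)]. What remains is a covariance in the coordinate [(z, j)]
    alone. *)
Lemma corr_increment j e : (j < d)%N -> corr e - E (y, j) corr e =
  Es (pt z) (E (z, j) (fun e => adj x z e * (adj y z e - E (z, j) (adj y z) e))) e.
Proof.
move=> jd.
have bx := bm_adj d tq q1 x z; have by_ := bm_adj d tq q1 y z.
have bxy : bm (fun e => adj x z e * adj y z e) by exact: bmM.
have bm_ : bm (fun e => adj x z e * E (z, j) (adj y z) e) by bmt.
have ix : indep (y, j) (adj x z).
  by apply: indep_adj; rewrite /= negb_and negb_or eq_sym xy yz.
have h1 : E (y, j) corr = Es (pt z) (fun e => adj x z e * E (z, j) (adj y z) e).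
  rewrite /corr (E1_Es U (y, j) (pt z) bxy); apply: (congr1 (fun F => Es (pt z) F)).
  apply/funext => e'; rewrite (E1_indepM U e' by_ ix).
  by rewrite (E_adj_exch _ _ e' jd yz).
rewrite h1 /corr -(EsB U (pt z) e bxy bm_).
have jz : (z, j) \in pt z by rewrite mem_pt eqxx.
have bd : bm (fun e => adj x z e * (adj y z e - E (z, j) (adj y z) e)) by bmt.
rewrite (Es_E1_in U jz bd); apply: (congr1 (fun F => Es (pt z) F e)).
by apply/funext => e'; exact: esym (mulrBr _ _ _).
Qed.

Lemma adj_slice j x' e t : (j < d)%N -> x' != z ->
  adj x' z (upd e (z, j) t) = sgl (W (e (x', j)) t) (slack j x' z e).
Proof.
move=> jd xz'; rewrite (adj_slack _ _ _ _ _ jd) (slack_upd_z _ _ _ _ e t xz') upd_same.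
have -> : upd e (z, j) t (x', j) = e (x', j).
  by rewrite upd_diff// xpair_eqE (negbTE xz').
by [].
Qed.

Lemma corr_increment_le (Dl ep : R) j e : (j < d)%N ->
  0 <= Dl -> 1 - Dl <= ep `^ q^-1 -> 0 <= ep ->
  `|corr e - E (y, j) corr e| <=
  4 * (Dl * ((kap (e (x, j)) (e (y, j)) <= 2 * Dl)%R)%:R + Dl ^+ 2) *
    Es (pt z) (pivot j) e +
  2 * Es (pt z) (tiny ep j x) e + 2 * Es (pt z) (tiny ep j y) e.
Proof.
move=> jd Dl0 Dlep ep0.
have bx := bm_adj d tq q1 x z; have by_ := bm_adj d tq q1 y z.
have bp := bm_pivot j; have bt1 := bm_tiny ep j x; have bt2 := bm_tiny ep j y.
pose K (e : env) : R :=
  4 * (Dl * ((kap (e (x, j)) (e (y, j)) <= 2 * Dl)%R)%:R + Dl ^+ 2).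
have bK : bm K by rewrite /K; bmt.
have iK : {in pt z, forall p, indep p K}.
  move=> [a l]; rewrite mem_pt /= => /andP[/eqP -> _] e' t; rewrite /K.
  by rewrite !upd_diff ?xpair_eqE ?(negbTE xz) ?(negbTE yz).
have bH : bm (fun e => adj x z e * (adj y z e - E (z, j) (adj y z) e)) by bmt.
rewrite (corr_increment e jd); apply: le_trans (Es_norm U _ _ (bmE1 U _ bH)) _.
rewrite -/(K e) -(Es_indepM U e bp iK) -(EsZ U (pt z) 2 e bt1) -(EsZ U (pt z) 2 e bt2).
have bKp : bm (fun e => K e * pivot j e) by bmt.
have b2t1 : bm (fun e => 2 * tiny ep j x e) by bmt.
have b2t2 : bm (fun e => 2 * tiny ep j y e) by bmt.
rewrite -(EsD U (pt z) e bKp b2t1).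
have bs1 : bm (fun e => K e * pivot j e + 2 * tiny ep j x e) by bmt.
rewrite -(EsD U (pt z) e bs1 b2t2).
apply: Es_le; [by bmt|by bmt|move=> e'].
have := @sign_cov_le R q q1 _ (e' (x, j)) (e' (y, j)) (slack j x z e')
  (slack j y z e') Dl ep (z, j) e' Dl0 Dlep ep0.
have -> : E (z, j) (fun e0 => sgl (W (e' (x, j)) (e0 (z, j))) (slack j x z e') *
     (sgl (W (e' (y, j)) (e0 (z, j))) (slack j y z e') -
      E (z, j) (fun e1 => sgl (W (e' (y, j)) (e1 (z, j))) (slack j y z e')) e0)) e' =
   E (z, j) (fun e => adj x z e * (adj y z e - E (z, j) (adj y z) e)) e'.
  apply: E1_eq => t; rewrite !upd_same.
  rewrite (adj_slice e' t jd xz) (adj_slice e' t jd yz).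
  have -> : E (z, j) (adj y z) (upd e' (z, j) t) =
      E (z, j) (fun e1 => sgl (W (e' (y, j)) (e1 (z, j))) (slack j y z e')) (upd e' (z, j) t).
    apply: E1_eq => u; rewrite upd_id upd_same; exact: adj_slice.
  by [].
have gen (b1 b2 : bool) (c t1 t2 : R) : 4 * (b1%:R * b2%:R * c) + 2 * t1 + 2 * t2 <=
    4 * c * (b1 && b2)%:R + 2 * t1 + 2 * t2.
  by case: b1; case: b2; rewrite /= ?(mul0r, mulr0, mul1r, mulr1).
by move=> h; apply: (le_trans h); exact: gen.
Qed.

Lemma slackD1 j l x' e : (l < d)%N -> l != j ->
  slack j x' z e = tq - \sum_(i <- iota 0 d | (i != j) && (i != l)) W (e (x', i)) (e (z, i))
                   - W (e (x', l)) (e (z, l)).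
Proof.
move=> ld lj; rewrite slackE -big_filter (bigD1_seq l) ?filter_uniq ?iota_uniq//=; last first.
  by rewrite mem_filter lj mem_iota.
by rewrite big_filter_cond opprD addrCA addrC.
Qed.

(* If the slack is tiny, one of the other coordinates is at least of order tq / d
   and lies in a short interval determined by the remaining ones. *)
Lemma Es_tiny_le ep j x' e : x' != z -> (0 < d)%N -> 0 < tq -> 0 <= ep -> ep <= tq / 2 ->
  Es (pt z) (tiny ep j x') e <= 4 * d%:R ^+ 2 * ep / tq.
Proof.
move=> xz' d0 tq0 ep0 eptq.
have dp : 0 < d%:R :> R by rewrite ltr0n.
(* If all the other terms were below [w0], their sum would be at most [tq / 4] and the slack would
   exceed [ep]. *)
pose w0 : R := tq / (4 * d%:R).
have w00 : 0 < w0 by rewrite divr_gt0 ?mulr_gt0.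
pose rest l (e : env) : R :=
  tq - \sum_(i <- iota 0 d | (i != j) && (i != l)) W (e (x', i)) (e (z, i)).
have brest l : bm (rest l).
  by apply: bmB; [exact: bm_cst|apply: bm_sum => i; exact: bm_wdist_var].
pose term l (e : env) : R := ((w0 <= W (e (x', l)) (e (z, l)))%R &&
  (rest l e - ep <= W (e (x', l)) (e (z, l)) <= rest l e)%R)%:R.
have bterm l : bm (term l) by have := brest l => ?; rewrite /term; bmt.
have term0 l e' : 0 <= term l e' by rewrite /term; case: (_ && _).
have bt := bm_tiny ep j x'.
apply: (@le_trans _ _ (Es (pt z) (fun e => \sum_(l <- iota 0 d | l != j) term l e) e)).
  apply: Es_le => // [|e']; first by apply: bm_sum => l; exact: bterm.
  have sum0 : 0 <= \sum_(l <- iota 0 d | l != j) term l e' by apply: sumr_ge0.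
  rewrite /tiny; case: (boolP (0 <= slack j x' z e' <= ep)) => // /andP[s0 s1].
  have [l [ld lj wl]] : exists l, [/\ (l < d)%N, l != j & w0 <= W (e' (x', l)) (e' (z, l))].
    apply/not_existsP => H.
    have : \sum_(l <- iota 0 d | l != j) W (e' (x', l)) (e' (z, l)) <=
        \sum_(l <- iota 0 d) w0.
      rewrite big_mkcond /= big_seq [leRHS]big_seq; apply: ler_sum => l.
      rewrite mem_iota /= add0n => ld; case: ifP => lj; last exact: ltW.
      rewrite leNgt; apply/negP => wl; apply: (H l); split => //; exact: ltW.
    rewrite big_const_seq count_predT size_iota iter_addr addr0 -[leRHS]mulr_natl.
    have -> : d%:R * w0 = tq / 4 by rewrite /w0; field; exact: lt0r_neq0.
    by move: s1; rewrite slackE; lra.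
  have tl : term l e' = 1.
    move: s0 s1; rewrite (slackD1 x' e' ld lj) -/(rest l e') => s0 s1.
    by rewrite /term wl; case: andP => // -[]; split; lra.
  rewrite -big_filter (bigD1_seq l) ?filter_uniq ?iota_uniq//=; last first.
    by rewrite mem_filter lj mem_iota.
  by rewrite tl lerDl; apply: sumr_ge0.
rewrite Es_sum//.
apply: (@le_trans _ _ (\sum_(l <- iota 0 d) (ep / w0))); last first.
  rewrite big_const_seq count_predT size_iota iter_addr addr0 -[leLHS]mulr_natl.
  have -> : d%:R * (ep / w0) = 4 * d%:R ^+ 2 * ep / tq.
    by rewrite /w0; field; rewrite !lt0r_neq0.
  by [].
rewrite big_mkcond /= big_seq [leRHS]big_seq; apply: ler_sum => l.
rewrite mem_iota /= add0n => ld; case: ifP => lj; last by rewrite divr_ge0// ltW.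
have lz : (z, l) \in pt z by rewrite mem_pt eqxx.
rewrite -(Es_E1_in U lz (bterm l)); apply: Es_le_cst => [|e'].
  by apply: bmE1; exact: bterm.
have := @E_wdist_itv R q q1 _ (e' (x', l)) w0 ep (rest l e') (z, l) e' w00 ep0.
have -> : E (z, l) (fun e0 => ((w0 <= W (e' (x', l)) (e0 (z, l)))%R &&
     (rest l e' - ep <= W (e' (x', l)) (e0 (z, l)) <= rest l e')%R)%:R) e' =
   E (z, l) (term l) e'; last by [].
apply: E1_eq => t; rewrite /term upd_same.
have -> : upd e' (z, l) t (x', l) = e' (x', l).
  by rewrite upd_diff// xpair_eqE (negbTE xz').
have -> : rest l (upd e' (z, l) t) = rest l e'.
  apply: (congr1 (fun s => tq - s)); apply: eq_bigr => i /andP[_ il].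
  by rewrite !upd_diff// xpair_eqE ?(negbTE xz') ?(negbTE il) ?andbF.
by [].
Qed.

Definition coords (P : pred nat) : seq nat := [seq l <- iota 0 d | P l].
(** Genericity of the pair of points: the non-collinearity needed by [anticoncentration] on the
    coordinates [P]. Only the coordinates in [P] of [x] and [y] are involved. *)
Definition good (P : pred nat) e : bool :=
  (`|\sum_(l <- coords P) wcov q (e (x, l)) (e (y, l))| <=
    (size (coords P))%:R * wvar q / 2)%R.

(** The local limit bound is applied to the terms with coordinates in [P]; the others are fixed and
    go into the shifts [A]. The condition [~~ P j] ensures that the omitted coordinate is not among
    the terms. *)
Lemma Es_pivot_le (P : pred nat) j e : ~~ P j -> (0 < size (coords P))%N ->
  good P e -> Es (pt z) (pivot j) e <= 264 ^+ 2 / ((size (coords P))%:R * wvar q).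
Proof.
move=> Pj sP gP.
have v0 := wvar_gt0 q1.
set c := _ / _.
have c264 : 0 <= 264 ^+ 2 :> R by rewrite exprn_ge0// ler0n.
have c0 : 0 <= c by apply: (divr_ge0 c264); rewrite mulr_ge0 ?ler0n// ltW.
pose s := [seq (z, l) | l <- coords P].
have ss : size s = size (coords P) by rewrite size_map.
have us : uniq s.
  by rewrite map_inj_uniq => [|a b []//]; rewrite filter_uniq// iota_uniq.
have sz : {subset s <= pt z}.
  move=> p /mapP[l]; rewrite mem_filter mem_iota => /andP[_ ld] ->.
  by rewrite mem_pt eqxx.
have memP p : p \in s -> p = (z, p.2) /\ P p.2.
  by move=> /mapP[l]; rewrite mem_filter => /andP[Pl _] ->.
pose X x' (p : nat * nat) (e : env) : R := W (e (x', p.2)) (e (z, p.2)).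
pose A x' (e : env) : R :=
  tq - \sum_(l <- iota 0 d | (l != j) && ~~ P l) W (e (x', l)) (e (z, l)).
have slackE x' e' : slack j x' z e' = A x' e' - \sum_(p <- s) X x' p e'.
  have hs : \sum_(l <- iota 0 d | l != j) W (e' (x', l)) (e' (z, l)) =
      \sum_(p <- s) X x' p e' +
      \sum_(l <- iota 0 d | (l != j) && ~~ P l) W (e' (x', l)) (e' (z, l)).
    rewrite (bigID P) /=; apply: (congr1 (fun u => u + _)).
    rewrite big_map big_filter; apply: eq_bigl => l.
    by case: (boolP (P l)) => Pl; rewrite ?andbT ?andbF//; apply: contraNneq Pj => <-.
  by rewrite slackE hs /A; ring.
have bX x' p : bm (X x' p) by exact: bm_wdist_var.
have bA x' : bm (A x').
  by apply: bmB; [exact: bm_cst|apply: bm_sum => l; exact: bm_wdist_var].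
have X01 x' p e' : 0 <= X x' p e' <= 1 by rewrite wdist_ge0 wdist_le1.
have iX x' : x' != z -> forall p p', p \in s -> p' \in s -> p != p' -> indep p' (X x' p).
  move=> xz' p p' /memP[pz _] /memP[pz' _] pp' e' t; rewrite /X.
  rewrite pz pz' xpair_eqE eqxx /= in pp'.
  by rewrite pz' !upd_diff// xpair_eqE ?(negbTE xz') ?(negbTE pp') ?andbF.
have iA x' : x' != z -> {in s, forall p, indep p (A x')}.
  move=> xz' p /memP[-> Pp] e' t; apply: (congr1 (fun s => tq - s)).
  apply: eq_bigr => l /andP[_ nPl].
  have lp : l != p.2 by apply: contraNneq nPl => ->.
  by rewrite !upd_diff// xpair_eqE ?(negbTE xz') ?(negbTE lp) ?andbF.
have EX x1 x2 p e' : p \in s -> x1 != z -> x2 != z ->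
    E p (fun e => X x1 p e * X x2 p e) e' =
    wcov q (e' (x1, p.2)) (e' (x2, p.2)) + wmean q ^+ 2.
  move=> ps xz1 xz2; have [pz _] := memP _ ps; case: p pz {ps} => a l /= [->].
  apply: etrans (E_wdist2 q (e' (x1, l)) (e' (x2, l)) (z, l) e').
  apply: E1_eq => t; rewrite /X /= upd_same.
  have -> : upd e' (z, l) t (x1, l) = e' (x1, l).
    by rewrite upd_diff// xpair_eqE (negbTE xz1).
  have -> : upd e' (z, l) t (x2, l) = e' (x2, l).
    by rewrite upd_diff// xpair_eqE (negbTE xz2).
  by [].
have EX1 x1 p e' : p \in s -> x1 != z -> E p (X x1 p) e' = wmean q.
  move=> ps xz1; have [pz _] := memP _ ps; case: p pz {ps} => a l /= [->].
  apply: etrans (E_wdist q1 (e' (x1, l)) (z, l) e').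
  apply: E1_eq => t; rewrite /X /= upd_same.
  have -> : upd e' (z, l) t (x1, l) = e' (x1, l).
    by rewrite upd_diff// xpair_eqE (negbTE xz1).
  by [].
have bp := bm_pivot j.
(* Inside the integral over the remaining coordinates of [z] the environment is no longer [e].
   Genericity is carried there as a factor, which does not depend on [z]. *)
pose gi (e : env) : R := (good P e)%:R.
have bgi : bm gi.
  apply/bm_bool/mbool_le; last exact: bm_cst.
  apply/bm_norm/bm_sum => l; apply: (@bm_wcov R q q1 _ (x, l) (y, l) (z, l)).
    by rewrite xpair_eqE eq_sym (negbTE xz).
  by rewrite xpair_eqE eq_sym (negbTE yz).
have igi : {in pt z, forall p, indep p gi}.
  move=> [a l]; rewrite mem_pt /= => /andP[/eqP -> _] e' t.
  have hs : \sum_(i <- coords P) wcov q (upd e' (z, l) t (x, i)) (upd e' (z, l) t (y, i)) =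
      \sum_(i <- coords P) wcov q (e' (x, i)) (e' (y, i)).
    by apply: eq_bigr => i _; rewrite !upd_diff// xpair_eqE ?(negbTE xz) ?(negbTE yz).
  exact: (congr1 (fun u : R =>
    ((`|u| <= (size (coords P))%:R * wvar q / 2)%R)%:R) hs).
have -> : Es (pt z) (pivot j) e = gi e * Es (pt z) (pivot j) e.
  by rewrite /gi gP mul1r.
rewrite -(Es_Es_sub U sz bp) -(Es_indepM U e (bmEs U s bp) igi).
apply: Es_le_cst => [|e']; first by bmt.
rewrite /gi; case: (boolP (good P e')) => [ge'|_]; last by rewrite mul0r.
rewrite mul1r.
have hcov : `|\sum_(p <- s) (E p (fun e => X x p e * X y p e) e' -
    E p (X x p) e' * E p (X y p) e')| <= (size s)%:R * wvar q / 2.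
  have -> : \sum_(p <- s) (E p (fun e => X x p e * X y p e) e' -
      E p (X x p) e' * E p (X y p) e') =
      \sum_(l <- coords P) wcov q (e' (x, l)) (e' (y, l)).
    transitivity (\sum_(p <- s) wcov q (e' (x, p.2)) (e' (y, p.2))).
      rewrite [LHS]big_seq [RHS]big_seq; apply: eq_bigr => p ps.
      by rewrite (EX x y p e' ps xz yz) (EX1 x p e' ps xz) (EX1 y p e' ps yz); ring.
    by rewrite big_map.
  by rewrite ss; exact: ge'.
have hvar x' p : x' != z -> p \in s ->
    E p (fun e => X x' p e ^+ 2) e' - E p (X x' p) e' ^+ 2 = wvar q.
  move=> xz' ps; rewrite (EX1 x' p e' ps xz').
  have -> : E p (fun e => X x' p e ^+ 2) e' = wcov q (e' (x', p.2)) (e' (x', p.2)) + wmean q ^+ 2.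
    rewrite -(EX x' x' p e' ps xz' xz'); apply: E1_eq => t; exact: expr2.
  by rewrite (wcov_diag q1 _ p e'); ring.
have := @anticoncentration R _ TR _ U s (X x) (X y) (A x) (A y) e' (wvar q) us
  (bX x) (bX y) (bA x) (bA y) (X01 x) (X01 y) (iX x xz) (iX y yz) (iA x xz) (iA y yz)
  (fun p => hvar x p xz) (fun p => hvar y p yz) hcov.
rewrite ss => /(_ sP v0); apply: le_trans.
suff -> : pivot j = fun e => ((0 <= A x e - \sum_(p <- s) X x p e < 1)%R &&
   (0 <= A y e - \sum_(p <- s) X y p e < 1)%R)%:R by [].
by apply/funext => e1; rewrite /pivot (slackE x e1) (slackE y e1).
Qed.

End Increments.

Lemma goodE {R : realType} (q : R) d x y P (e : nat * nat -> measurableTypeR R) :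
  good q d x y P e = (`|\sum_(l <- coords d P) wcov q (e (x, l)) (e (y, l))| <=
    (size (coords d P))%:R * wvar q / 2)%R.
Proof. by []. Qed.

Opaque adj slack pivot tiny.

(** * Integrating the coordinates of one point in two halves *)

Section TwoStage.
Context {R : realType} (q : R) (d : nat) (tq : R).
Hypothesis q1 : 1 <= q.
Local Notation TR := (measurableTypeR R).
Local Notation U := (@unif02 R).
Local Notation env := ((nat * nat)%type -> TR).
Local Notation E i F := (@E1 R _ TR (nat * nat)%type U i F).
Local Notation Es s F := (@Es R _ TR (nat * nat)%type U s F).
Local Notation pt := (pt d).
Local Notation coords := (coords d).
Variables x y : nat.
Hypothesis xy : x != y.
Local Notation good := (good q d x y).
Local Notation wc e l := (wcov q (e (x, l)) (e (y, l))).
Implicit Types (j l : nat) (e : env) (P : pred nat).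

Definition ylist P : seq (nat * nat) := [seq (y, l) | l <- coords P].

Lemma uniq_ylist P : uniq (ylist P).
Proof. by rewrite map_inj_uniq => [|a b []//]; rewrite filter_uniq// iota_uniq. Qed.

Lemma mem_ylist P p : (p \in ylist P) = [&& p.1 == y, P p.2 & (p.2 < d)%N].
Proof.
case: p => a l /=; apply/mapP/and3P => [[i + [-> ->]]|[/eqP -> Pl ld]].
  by rewrite mem_filter mem_iota /= add0n => /andP[-> ->].
by exists l; rewrite // mem_filter Pl mem_iota.
Qed.

Lemma size_ylist P : size (ylist P) = size (coords P).
Proof. by rewrite size_map. Qed.

Lemma bm_wc l : bm (fun e => wc e l).
Proof.
apply: (@bm_wcov R q q1 _ (x, l) (y, l) ((x + y).+1, l)); rewrite xpair_eqE negb_and.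
  by apply/orP; left; lia.
by apply/orP; left; lia.
Qed.

Lemma E_wc e l : E (y, l) (fun e => wc e l) e = 0.
Proof.
apply: (@E_wcov R q q1 _ (x, l) (y, l) ((x + y).+1, l)); rewrite xpair_eqE negb_and.
- by apply/orP; left; lia.
- by apply/orP; left; lia.
- by rewrite xy.
Qed.

Lemma wc_indep l j : l != j -> indep (y, j) (fun e => wc e l).
Proof.
by move=> lj e t; rewrite !upd_diff// xpair_eqE ?(negbTE xy) ?(negbTE lj) ?andbF.
Qed.

Lemma bm_sum_wc P : bm (fun e => \sum_(l <- coords P) wc e l).
Proof. by apply: bm_sum => l; exact: bm_wc. Qed.

Lemma mbool_good P : mbool (good P).
Proof.
have b := bm_sum_wc P; apply: mbool_le; last exact: bm_cst.
exact: bm_norm.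
Qed.

Lemma good_indep P j : ~~ P j -> indep (y, j) (good P).
Proof.
move=> Pj e t.
have hs : \sum_(l <- coords P) wc (upd e (y, j) t) l = \sum_(l <- coords P) wc e l.
  rewrite [LHS]big_seq [RHS]big_seq; apply: eq_bigr => l.
  rewrite mem_filter => /andP[Pl _]; apply: wc_indep.
  by apply: contraNneq Pj => <-.
exact: (congr1 (fun u : R => (`|u| <= (size (coords P))%:R * wvar q / 2)%R) hs).
Qed.

(** A sum of independent centered terms bounded by [wvar q], scaled so that each increment is at
    most 1/8: the martingale bound costs [2 / 64] per coordinate. *)
Lemma Es_expR_wc P (sg : R) e : `|sg| = 1 ->
  Es (ylist P) (fun e => expR (sg / (8 * wvar q) * \sum_(l <- coords P) wc e l)) e <=
  expR ((size (coords P))%:R / 32).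
Proof.
move=> sg1; have v0 := wvar_gt0 q1.
set c := sg / _.
have cv : `|c| * wvar q = 1 / 8.
  have c8 : 0 < (8 * wvar q)^-1 by rewrite invr_gt0 mulr_gt0.
  by rewrite /c normrM sg1 mul1r (gtr0_norm c8); field; exact: lt0r_neq0.
pose F (e : env) : R := c * \sum_(l <- coords P) wc e l.
have bS := bm_sum_wc P.
have bF : bm F by rewrite /F; bmt.
have EF p e' : p \in ylist P -> F e' - E p F e' = c * wc e' p.2.
  case: p => a j; rewrite mem_ylist /= => /and3P[/eqP -> Pj jd].
  have jP : j \in coords P by rewrite mem_filter Pj mem_iota.
  have uP : uniq (coords P) by rewrite filter_uniq// iota_uniq.
  pose rest (e : env) : R := \sum_(l <- coords P | l != j) wc e l.
  have brest : bm rest by apply: bm_sum => l; exact: bm_wc.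
  have irest : indep (y, j) rest.
    by move=> e1 t; apply: eq_bigr => l lj; apply: wc_indep.
  have FE : F = fun e => c * (wc e j + rest e).
    by apply/funext => e1; rewrite /F (bigD1_seq j).
  have bj := bm_wc j.
  have bs : bm (fun e => wc e j + rest e) by bmt.
  have -> : E (y, j) F e' = c * rest e'.
    rewrite FE (E1Z U c (y, j) e' bs) (E1D U (y, j) e' bj brest) E_wc add0r.
    by rewrite (E1_indep U irest).
  by rewrite FE; ring.
have EsF : Es (ylist P) F e = 0.
  rewrite (EsZ U (ylist P) c e bS) Es_sum; last by move=> l; exact: bm_wc.
  rewrite big_seq big1 ?mulr0// => l lP.
  have yl : (y, l) \in ylist P.
    by apply/mapP; exists l.
  rewrite -(Es_E1_in U yl (bm_wc l)) -(Es_cst U (ylist P) 0 e).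
  by apply: (congr1 (fun G => Es (ylist P) G e)); apply/funext => e'; exact: E_wc.
have := @Es_expR_le R _ TR _ U (ylist P) F (fun _ _ => 1 / 8) (fun _ => 1 / 64) e
  (uniq_ylist P) bF (fun _ => bm_cst (1 / 8)).
move=> /(_ (fun _ _ _ _ _ _ _ => erefl)) H.
apply: le_trans (H _ _ _) _.
- move=> p e' pP; rewrite (EF p e' pP) normrM.
  apply: (@le_trans _ _ (`|c| * wvar q)); last by rewrite cv.
  by rewrite ler_wpM2l//; exact: (wcov_le q1 _ _ (0%N, 0%N) e').
- by move=> *; lra.
- by move=> p e' _; rewrite E1_cst; lra.
rewrite EsF add0r ler_expR big_const_seq count_predT size_ylist iter_addr addr0.
by rewrite -[_ *+ size _]mulr_natl; lra.
Qed.

(** Chernoff's bound for both signs: the threshold gives the exponent [n / 16], of which the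
    exponential moment takes back [n / 32]. *)
Lemma Es_bad_le P e :
  Es (ylist P) (fun e => (~~ good P e)%:R) e <= 2 * expR (- ((size (coords P))%:R / 32)).
Proof.
have v0 := wvar_gt0 q1; set n : R := (size (coords P))%:R.
pose G (sg : R) (e : env) := expR (sg / (8 * wvar q) * \sum_(l <- coords P) wc e l).
have bS := bm_sum_wc P.
have bG sg : bm (G sg) by rewrite /G; bmt.
have bb : bm (fun e => (~~ good P e)%:R : R).
  by apply/bm_bool/mbool_neg; exact: mbool_good.
have bR : bm (fun e => expR (- (n / 16)) * (G 1 e + G (-1) e)).
  by have := bG 1; have := bG (-1) => ? ?; bmt.
apply: (@le_trans _ _ (Es (ylist P) (fun e => expR (- (n / 16)) * (G 1 e + G (-1) e)) e)).
  apply: Es_le => // e'.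
  have Gp sg e1 : 0 <= G sg e1 by exact: expR_ge0.
  have r0 : 0 <= expR (- (n / 16)) * (G 1 e' + G (-1) e').
    by rewrite mulr_ge0 ?expR_ge0 ?addr_ge0.
  case: (boolP (good P e')) => //=; rewrite goodE -ltNge => h.
  rewrite mulrDr /G -!expRD.
  set S := \sum_(l <- coords P) _ in h *.
  have hE (sg : R) : sg / (8 * wvar q) * S - n / 16 = (sg * S - n * wvar q / 2) / (8 * wvar q).
    by field; exact: lt0r_neq0.
  have [S0|S0] := leP 0 S.
    apply: (@le_trans _ _ (expR (- (n / 16) + 1 / (8 * wvar q) * S))); last first.
      by rewrite lerDl expR_ge0.
    rewrite -[leLHS]expR0 ler_expR addrC hE mul1r divr_ge0 ?mulr_ge0 ?(ltW v0)//.
    by move: h; rewrite ger0_norm// -/n; lra.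
  apply: (@le_trans _ _ (expR (- (n / 16) + -1 / (8 * wvar q) * S))); last first.
    by rewrite lerDr expR_ge0.
  rewrite -[leLHS]expR0 ler_expR addrC hE mulN1r divr_ge0 ?mulr_ge0 ?(ltW v0)//.
  by move: h; rewrite ltr0_norm// -/n; lra.
rewrite (EsZ U (ylist P) _ e (bmD (bG 1) (bG (-1)))) (EsD U (ylist P) e (bG 1) (bG (-1))).
have h1 : Es (ylist P) (G 1) e <= expR (n / 32) by apply: Es_expR_wc; rewrite normr1.
have h2 : Es (ylist P) (G (-1)) e <= expR (n / 32).
  by apply: Es_expR_wc; rewrite normrN normr1.
have -> : expR (- (n / 32)) = expR (- (n / 16)) * expR (n / 32).
  by rewrite -expRD; congr expR; lra.
rewrite mulrCA ler_wpM2l ?expR_ge0//; lra.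
Qed.

Variable k : nat.
Hypothesis kx : (k <= x)%N.
Hypothesis ky : (k <= y)%N.
Hypothesis adj_mean : forall x z e, x != z -> Es (pt z) (adj q d tq x z) e = 0.
Variables (Dl ep : R).
Hypothesis d2 : (1 < d)%N.
Hypothesis tq0 : 0 < tq.
Hypothesis Dl0 : 0 <= Dl.
Hypothesis Dlep : 1 - Dl <= ep `^ q^-1.
Hypothesis ep0 : 0 <= ep.
Hypothesis eptq : ep <= tq / 2.

Definition half : nat := d./2.
Definition beta : R := 4 * d%:R ^+ 2 * ep / tq.
Definition pbound : R := Num.min 1 (264 ^+ 2 / (half%:R * wvar q)).
(** The exponential is the probability that a half is not generic, needed when that half is averaged
    instead of frozen. *)
Definition pbound' : R := pbound + 2 * expR (- (half%:R / 32)).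
Definition prox j e : R := Dl * ((kap (e (x, j)) (e (y, j)) <= 2 * Dl)%R)%:R + Dl ^+ 2.
Definition incb j e : R := k%:R * (4 * prox j e * pbound' + 4 * beta).
(** Bounds the second moment of [incb]. The indicator in [prox] has weight [Dl] and probability at
    most [2 Dl], whence the leading [2 Dl ^ 3]. *)
Definition incv : R :=
  k%:R ^+ 2 * (32 * (2 * (2 * Dl ^+ 3 + Dl ^+ 4) * pbound' ^+ 2 + beta ^+ 2)).
Definition total e : R := \sum_(i < k) corr q d tq x y i e.
Hypothesis inc_small : k%:R * (4 * (Dl + Dl ^+ 2) * pbound' + 4 * beta) <= 1 / 2.

Let PA l : bool := (l < half)%N.
Let PB l : bool := ~~ PA l.

Lemma half_gt0 : (0 < half)%N.
Proof. by rewrite /half half_gt0. Qed.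

Lemma size_coordsA : size (coords PA) = half.
Proof.
rewrite size_filter /PA; have hd : (half <= d)%N by rewrite /half; lia.
rewrite -(subnKC hd) iotaD count_cat add0n.
rewrite (eq_in_count (a2 := predT)) ?count_predT ?size_iota; last first.
  by move=> l; rewrite mem_iota /= add0n => ->.
rewrite (eq_in_count (a2 := pred0)) ?count_pred0 ?addn0// => l.
by rewrite mem_iota /= => /andP[hl _]; rewrite ltnNge hl.
Qed.

Lemma size_coordsB : (half <= size (coords PB))%N.
Proof.
have := size_coordsA; rewrite !size_filter => hA.
have := count_predC PA (iota 0 d); rewrite hA size_iota => h.
rewrite (_ : count PB (iota 0 d) = count (predC PA) (iota 0 d)); last exact: eq_count.
by move: h; rewrite /half; lia.
Qed.

Let Pb_ge0 : 0 <= pbound.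
Proof.
have c264 : 0 <= 264 ^+ 2 :> R by rewrite exprn_ge0// ler0n.
by rewrite le_min ler01; apply: (divr_ge0 c264); rewrite mulr_ge0 ?ler0n// ltW// (wvar_gt0 q1).
Qed.

Let Pb'_ge0 : 0 <= pbound'.
Proof. by rewrite addr_ge0 ?mulr_ge0 ?expR_ge0. Qed.

Let beta_ge0 : 0 <= beta.
Proof. by rewrite /beta divr_ge0 ?mulr_ge0 ?sqr_ge0// ltW. Qed.

Lemma prox_ge0 j e : 0 <= prox j e.
Proof. by rewrite /prox addr_ge0 ?mulr_ge0 ?sqr_ge0. Qed.

Lemma bm_prox j : bm (prox j).
Proof. by rewrite /prox; bmt. Qed.

Lemma bm_incb j : bm (incb j).
Proof. by have := bm_prox j => ?; rewrite /incb; bmt. Qed.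

Lemma incb_le j e : incb j e <= 1 / 2.
Proof.
apply: le_trans inc_small; rewrite ler_wpM2l// lerD2r ler_wpM2r// ler_wpM2l//.
by rewrite /prox lerD2r; case: (kap _ _ <= _); rewrite ?mulr1 ?mulr0.
Qed.

Lemma E_incb_sqr j e : E (y, j) (fun e => incb j e ^+ 2) e <= incv.
Proof.
pose near e : R := ((kap (e (x, j)) (e (y, j)) <= 2 * Dl)%R)%:R.
have bn : bm near by rewrite /near; bmt.
have bi := bm_incb j.
apply: (@le_trans _ _ (E (y, j) (fun e => k%:R ^+ 2 * (32 * (2 * Dl ^+ 4 * pbound' ^+ 2 + beta ^+ 2)) +
    k%:R ^+ 2 * (32 * (2 * Dl ^+ 2 * pbound' ^+ 2)) * near e) e)).
  apply: E1_le; [by bmt|by bmt|move=> t; set e' := upd _ _ _].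
  have nn : near e' ^+ 2 = near e' by rewrite /near; case: (_ <= _); rewrite /= ?expr1n ?expr0n.
  have sq (a b : R) : (a + b) ^+ 2 <= 2 * (a ^+ 2 + b ^+ 2).
    by have := sqr_ge0 (a - b); rewrite !expr2; lra.
  have pE : prox j e' = Dl * near e' + Dl ^+ 2 by [].
  have hK : prox j e' ^+ 2 <= 2 * (Dl ^+ 2 * near e' + Dl ^+ 4).
    by rewrite pE; apply: le_trans (sq _ _) _; rewrite exprMn nn -exprM.
  have hp := ler_wpM2r (sqr_ge0 pbound') hK.
  have h : (4 * prox j e' * pbound' + 4 * beta) ^+ 2 <=
      32 * (2 * Dl ^+ 4 * pbound' ^+ 2 + beta ^+ 2) +
      32 * (2 * Dl ^+ 2 * pbound' ^+ 2) * near e'.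
    apply: le_trans (sq _ _) _; rewrite !exprMn.
    by move: hp; set p2 := pbound' ^+ 2; set pr := prox j e' ^+ 2; lra.
  have := ler_wpM2l (sqr_ge0 k%:R) h; rewrite -exprMn -/(incb j e').
  by move=> h'; apply: (le_trans h'); rewrite mulrDr !mulrA.
rewrite (E1D U (y, j) e (bm_cst _) (bmM (bm_cst _) bn)) E1_cst (E1Z U _ (y, j) e bn).
have : E (y, j) near e <= 2 * Dl.
  have := @E_kap_le_max R _ (e (x, j)) (2 * Dl) (y, j) e (mulr_ge0 (ler0n _ 2) Dl0).
  apply: le_trans; apply: E1_le; [by bmt|exact: bm_kap_le|move=> t].
  rewrite /near upd_same.
  have -> : upd e (y, j) t (x, j) = e (x, j) by rewrite upd_diff// xpair_eqE (negbTE xy).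
  by [].
set c := k%:R ^+ 2 * (32 * (2 * Dl ^+ 2 * pbound' ^+ 2)).
have c0 : 0 <= c by rewrite /c !mulr_ge0 ?sqr_ge0.
move=> /(ler_wpM2l c0); rewrite /incv /c.
by rewrite ![Dl ^+ 3]exprS; lra.
Qed.

Let zneq (i : 'I_k) : (x != i) * (y != i).
Proof. by split; apply: contraTneq (ltn_ord i) => <-; rewrite -leqNgt. Qed.

Lemma corr_norm i e : `|corr q d tq x y i e| <= 1.
Proof.
have b1 := bm_adj d tq q1 x i; have b2 := bm_adj d tq q1 y i.
have b12 : bm (fun e => adj q d tq x i e * adj q d tq y i e) by bmt.
apply: le_trans (Es_norm U _ _ b12) _; apply: Es_le_cst => [|e']; first by bmt.
by rewrite normrM !adj_norm mulr1.
Qed.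

Lemma bm_total : bm total.
Proof. by apply: bm_sum => i; exact: bm_corr. Qed.

Lemma total_le e : total e <= k%:R.
Proof.
apply: (@le_trans _ _ (\sum_(i < k) (1 : R))); last by rewrite sumr_const card_ord.
by apply: ler_sum => i _; apply: le_trans (ler_norm _) (corr_norm _ _).
Qed.

(** In each covariance [y] occurs in a single edge sign, centered given the other end point. *)
Lemma Es_total e : Es (pt y) total e = 0.
Proof.
rewrite Es_sum; last by move=> i; exact: bm_corr.
rewrite big1// => i _; have [xi yi] := zneq i.
have b1 := bm_adj d tq q1 x i; have b2 := bm_adj d tq q1 y i.
have b12 : bm (fun e => adj q d tq x i e * adj q d tq y i e) by bmt.
rewrite /corr (EsC U (pt y) (pt i) b12) -(Es_cst U (pt i) 0 e).
apply: (congr1 (fun F => Es (pt i) F e)); apply/funext => e'.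
rewrite (Es_indepM U e' b2); last first.
  move=> [a l]; rewrite mem_pt /= => /andP[/eqP -> _]; apply: indep_adj.
  by rewrite /= negb_and negb_or eq_sym xy yi.
have ha : Es (pt y) (adj q d tq y i) e' = 0.
  by rewrite adjC; apply: adj_mean; rewrite eq_sym.
by rewrite ha mulr0.
Qed.

Lemma total_increment j e : (j < d)%N ->
  `|total e - E (y, j) total e| <=
  k%:R * 4 * beta + 4 * prox j e * \sum_(i < k) Es (pt i) (pivot q d tq x y i j) e.
Proof.
move=> jd; have dp : (0 < d)%N by lia.
have -> : total e - E (y, j) total e =
    \sum_(i < k) (corr q d tq x y i e - E (y, j) (corr q d tq x y i) e).
  have bc (i : 'I_k) : bm (corr q d tq x y i) by exact: bm_corr.
  have hs := @Es_sum R _ TR _ U _ (index_enum 'I_k) xpredT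
    (fun i : 'I_k => corr q d tq x y i) [:: (y, j)] e bc.
  by rewrite sumrB; apply: (congr1 (fun u => total e - u)); exact: hs.
apply: le_trans (ler_norm_sum _ _ _) _.
apply: (@le_trans _ _ (\sum_(i < k) (4 * beta +
    4 * prox j e * Es (pt i) (pivot q d tq x y i j) e))); last first.
  by rewrite big_split /= sumr_const card_ord -[_ *+ k]mulr_natl mulrA -mulr_sumr.
apply: ler_sum => i _; have [xi yi] := zneq i.
have hc : `|corr q d tq x y i e - E (y, j) (corr q d tq x y i) e| <=
    4 * prox j e * Es (pt i) (pivot q d tq x y i j) e +
    2 * Es (pt i) (tiny q d tq i ep j x) e + 2 * Es (pt i) (tiny q d tq i ep j y) e.
  by apply: corr_increment_le.
have t1 : Es (pt i) (tiny q d tq i ep j x) e <= beta by apply: Es_tiny_le.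
have t2 : Es (pt i) (tiny q d tq i ep j y) e <= beta by apply: Es_tiny_le.
by apply: (le_trans hc); lra.
Qed.

Lemma Es_pivot_good P j (i : 'I_k) e : ~~ P j -> (half <= size (coords P))%N ->
  Es (pt i) (pivot q d tq x y i j) e <= pbound + (~~ good P e)%:R.
Proof.
move=> Pj sP; have v0 := wvar_gt0 q1; have [xi yi] := zneq i.
have p1 : Es (pt i) (pivot q d tq x y i j) e <= 1.
  by apply: Es_le_cst => [|e']; [exact: bm_pivot|exact: pivot_le1].
case: (boolP (good P e)) => g; last by rewrite /= (le_trans p1)// lerDr Pb_ge0.
rewrite addr0 le_min p1 /=.
have hp : 0 < half%:R :> R by rewrite ltr0n half_gt0.
apply: le_trans (Es_pivot_le tq q1 xi yi Pj (leq_trans half_gt0 sP) g) _.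
have c264 : 0 <= 264 ^+ 2 :> R by rewrite exprn_ge0// ler0n.
rewrite (ler_wpM2l c264)// lef_pV2 ?posrE ?mulr_gt0//; last first.
  by rewrite ltr0n (leq_trans half_gt0 sP).
by rewrite ler_wpM2r ?ler_nat// ltW.
Qed.

Lemma incb_indep P j : ~~ P j -> {in ylist P, forall p, indep p (prox j)}.
Proof.
move=> Pj [a l]; rewrite mem_ylist /= => /and3P[/eqP -> Pl _] e t.
have jl : j != l by apply: contraNneq Pj => ->.
by rewrite /prox !upd_diff// xpair_eqE ?(negbTE xy) ?(negbTE jl) ?andbF.
Qed.

Lemma incb_indep2 j l : j != l -> indep (y, l) (incb j).
Proof.
move=> jl e t; rewrite /incb.
have -> : prox j (upd e (y, l) t) = prox j e.
  by rewrite /prox !upd_diff// xpair_eqE ?(negbTE xy) ?(negbTE jl) ?andbF.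
by [].
Qed.

(* Stage 2: with the coordinates of the first half frozen at a good
   configuration, the total concentrates in the second half. *)
Lemma stage2 e : Es (ylist PB) (fun e => expR (total e)) e <=
  expR (2 * ((size (coords PB))%:R * incv)) * expR (Es (ylist PB) total e) +
  expR k%:R * (~~ good PA e)%:R.
Proof.
have bt := bm_total.
pose g e : R := (good PA e)%:R.
have bg : bm g by apply: bm_bool; exact: mbool_good.
have ig : {in ylist PB, forall p, indep p g}.
  move=> [a l]; rewrite mem_ylist /= => /and3P[/eqP -> Pl _] e' t.
  have nP : ~~ PA l := Pl.
  exact: (congr1 (fun b : bool => (b : nat)%:R) (good_indep nP e' t)).
(* The martingale bound asks for increment bounds at every environment; the factor [g], constant
   along the second half, makes [F] vanish where they could fail. *)
pose F e := g e * total e.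
have bF : bm F by rewrite /F; bmt.
case: (boolP (good PA e)) => ge; last first.
  rewrite mulr1; apply: (@le_trans _ _ (expR k%:R)).
    by apply: Es_le_cst => [|e']; [bmt|rewrite ler_expR total_le].
  by rewrite lerDr mulr_ge0 ?expR_ge0.
rewrite /= mulr0 addr0.
have g1 : g e = 1 by rewrite /g ge.
apply: (@le_trans _ _ (Es (ylist PB) (fun e => expR (F e)) e)).
  have bex : bm (fun e => expR (total e)) by bmt.
  rewrite -[leLHS]mul1r -g1 -(Es_indepM U e bex ig); apply: Es_le; [by bmt|by bmt|move=> e'].
  by rewrite /F /g; case: (good PA e'); rewrite /= ?mul1r// !mul0r expR_ge0.
have := @Es_expR_le R _ TR _ U (ylist PB) F (fun p => incb p.2) (fun=> incv) e
  (uniq_ylist PB) bF (fun p => bm_incb p.2) => H.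
apply: le_trans (H _ _ _ _) _.
- move=> [a j] [b l]; rewrite !mem_ylist /= => /and3P[/eqP -> _ _] /and3P[/eqP -> _ _].
  by rewrite xpair_eqE eqxx /=; exact: incb_indep2.
- move=> [a j] e'; rewrite mem_ylist /= => /and3P[/eqP -> Pj jd].
  have yj : (y, j) \in ylist PB by rewrite mem_ylist eqxx Pj jd.
  have -> : E (y, j) F e' = g e' * E (y, j) total e' := E1_indepM U e' bt (ig _ yj).
  rewrite /F -mulrBr normrM ger0_norm ?ler0n//.
  have Pj' : ~~ PA j by exact: Pj.
  have sA : (half <= size (coords PA))%N by rewrite size_coordsA.
  have i0 : 0 <= incb j e'.
    have p0 := Pb'_ge0; have b0 := beta_ge0; have r0 := prox_ge0 j e'.
    by rewrite /incb; apply: mulr_ge0 => //; apply: addr_ge0; apply: mulr_ge0 => //; apply: mulr_ge0.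
  rewrite /g; case: (boolP (good PA e')) => ge'; last by rewrite mul0r.
  rewrite mul1r; apply: le_trans (total_increment e' jd) _.
  have : \sum_(i < k) Es (pt i) (pivot q d tq x y i j) e' <= k%:R * pbound'.
     apply: (@le_trans _ _ (\sum_(i < k) pbound')).
      apply: ler_sum => i _; apply: le_trans (Es_pivot_good i e' Pj' sA) _.
      by rewrite ge' addr0 lerDl mulr_ge0 ?expR_ge0.
    by rewrite sumr_const card_ord mulr_natl.
  move=> /(ler_wpM2l (mulr_ge0 (ler0n R 4) (prox_ge0 j e'))).
  by rewrite /incb; lra.
- by move=> p e' _; exact: incb_le.
- by move=> [a j] e'; rewrite mem_ylist /= => /and3P[/eqP -> _ _]; exact: E_incb_sqr.
rewrite (Es_indepM U e bt ig) g1 mul1r addrC expRD.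
by rewrite big_const_seq count_predT size_ylist iter_addr addr0 -[incv *+ _]mulr_natl.
Qed.

(** With the second half averaged, an increment along the first is bounded by the pivot probability
    on [good PB] plus the probability that this event fails. [prox j] involves no coordinate of the
    second half and factors out. *)
Lemma stage1 e : Es (ylist PA) (fun e => expR (Es (ylist PB) total e)) e <=
  expR (Es (ylist PA) (Es (ylist PB) total) e + 2 * (half%:R * incv)).
Proof.
have bt := bm_total; have bM : bm (Es (ylist PB) total) by exact: bmEs.
have := @Es_expR_le R _ TR _ U (ylist PA) (Es (ylist PB) total) (fun p => incb p.2)
  (fun=> incv) e (uniq_ylist PA) bM (fun p => bm_incb p.2) => H.
apply: le_trans (H _ _ _ _) _.
- move=> [a j] [b l]; rewrite !mem_ylist /= => /and3P[/eqP -> _ _] /and3P[/eqP -> _ _].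
  by rewrite xpair_eqE eqxx /=; exact: incb_indep2.
- move=> [a j] e'; rewrite mem_ylist /= => /and3P[/eqP -> Pj jd].
  have Pj' : ~~ PB j by rewrite negbK.
  have bD : bm (fun e => total e - E (y, j) total e) by bmt.
  have bEt : bm (E (y, j) total) by bmt.
  rewrite (E1_Es U (y, j) (ylist PB) bt) -(EsB U (ylist PB) e' bt bEt).
  apply: le_trans (Es_norm U _ _ bD) _.
  have bpr := bm_prox j.
  have bbad : bm (fun e => (~~ good PB e)%:R : R).
    by apply/bm_bool/mbool_neg; exact: mbool_good.
  pose H1 e : R := k%:R * 4 * beta + prox j e * (4 * (k%:R * pbound) +
      4 * k%:R * (~~ good PB e)%:R).
  have bH1 : bm H1 by rewrite /H1; bmt.
  apply: (@le_trans _ _ (Es (ylist PB) H1 e')).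
    apply: Es_le; [by bmt|by []|move=> e1].
    apply: le_trans (total_increment e1 jd) _; rewrite /H1 lerD2l.
    have : \sum_(i < k) Es (pt i) (pivot q d tq x y i j) e1 <=
        k%:R * (pbound + (~~ good PB e1)%:R).
      apply: (@le_trans _ _ (\sum_(i < k) (pbound + (~~ good PB e1)%:R))).
        by apply: ler_sum => i _; apply: Es_pivot_good => //; exact: size_coordsB.
      by rewrite sumr_const card_ord mulr_natl.
    by move=> /(ler_wpM2l (mulr_ge0 (ler0n R 4) (prox_ge0 j e1))); lra.
  have bH2 : bm (fun e => 4 * (k%:R * pbound) + 4 * k%:R * (~~ good PB e)%:R : R) by bmt.
  have bH3 : bm (fun e => prox j e * (4 * (k%:R * pbound) + 4 * k%:R * (~~ good PB e)%:R)) by bmt.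
  have bH4 : bm (fun e => 4 * k%:R * (~~ good PB e)%:R : R) by bmt.
  rewrite /H1 (EsD U (ylist PB) e' (bm_cst _) bH3) Es_cst.
  rewrite (Es_indepM U e' bH2 (incb_indep Pj')).
  rewrite (EsD U (ylist PB) e' (bm_cst _) bH4) Es_cst (EsZ U (ylist PB) _ e' bbad).
  have hb := Es_bad_le PB e'.
  have hs : expR (- ((size (coords PB))%:R / 32)) <= expR (- (half%:R / 32)) :> R.
    by rewrite ler_expR lerN2 ler_wpM2r// ler_nat size_coordsB.
  have : Es (ylist PB) (fun e => (~~ good PB e)%:R) e' <= 2 * expR (- (half%:R / 32)).
    by apply: (le_trans hb); rewrite ler_wpM2l.
  have c0 : 0 <= prox j e' * (4 * k%:R) by rewrite !mulr_ge0// prox_ge0.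
  by move=> /(ler_wpM2l c0); rewrite /incb /pbound'; lra.
- by move=> p e' _; exact: incb_le.
- by move=> [a j] e'; rewrite mem_ylist /= => /and3P[/eqP -> _ _]; exact: E_incb_sqr.
rewrite big_const_seq count_predT size_ylist iter_addr addr0 -[incv *+ _]mulr_natl.
by rewrite size_coordsA.
Qed.

Lemma Es_pt_split F : bm F -> Es (pt y) F = Es (ylist PA) (Es (ylist PB) F).
Proof.
move=> bF; rewrite -Es_cat; apply: Es_perm => //.
by rewrite -map_cat perm_map// perm_sym; exact: (permEl (perm_filterC PA _)).
Qed.

(** After [1 + c <= expR c], the two stages are composed and the mean of [total] is zero. The second
    term is the failure of [good PA], on which only [total <= k] is available. *)
Lemma Es_prod_corr_le e :
  Es (pt y) (fun e => \prod_(i < k) (1 + corr q d tq x y i e)) e <=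
  expR (2 * (d%:R * incv)) + 2 * expR (k%:R - half%:R / 32).
Proof.
have bt := bm_total; have bex : bm (fun e => expR (total e)) by bmt.
have bpr : bm (fun e => \prod_(i < k) (1 + corr q d tq x y i e)).
  by apply: bm_prod => i; apply: bmD; [exact: bm_cst|exact: bm_corr].
apply: (@le_trans _ _ (Es (pt y) (fun e => expR (total e)) e)).
  apply: Es_le => // e'; rewrite /total expR_sum; apply: ler_prod => i _.
  have := corr_norm i e'; rewrite ler_norml => /andP[h _].
  by rewrite expR_ge1Dx andbT; lra.
rewrite (Es_pt_split bex).
have bM : bm (Es (ylist PB) total) by exact: bmEs.
have beM : bm (fun e => expR (Es (ylist PB) total e)) by bmt.
have bbad : bm (fun e => (~~ good PA e)%:R : R).
  by apply/bm_bool/mbool_neg; exact: mbool_good.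
pose c1 := expR (2 * ((size (coords PB))%:R * incv)).
have bA : bm (fun e => c1 * expR (Es (ylist PB) total e)) by bmt.
have bB := bmM (bm_cst (expR k%:R)) bbad.
apply: (@le_trans _ _ (Es (ylist PA) (fun e => c1 * expR (Es (ylist PB) total e) +
    expR k%:R * (~~ good PA e)%:R) e)).
  by apply: Es_le; [bmt|bmt|exact: stage2].
rewrite (EsD U (ylist PA) e bA bB) (EsZ U (ylist PA) c1 e beM) (EsZ U (ylist PA) _ e bbad).
apply: lerD.
  have h := stage1 e; rewrite -(Es_pt_split bt) Es_total add0r in h.
  apply: (@le_trans _ _ (c1 * expR (2 * (half%:R * incv)))).
    by rewrite ler_wpM2l ?expR_ge0.
  have incv0 : 0 <= incv.
    apply: mulr_ge0; first exact: sqr_ge0.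
    apply: mulr_ge0 => //; apply: addr_ge0; last exact: sqr_ge0.
    apply: mulr_ge0; last exact: sqr_ge0.
    by apply: mulr_ge0 => //; apply: addr_ge0; [apply: mulr_ge0 => //|]; exact: exprn_ge0.
  have hn : (size (coords PB))%:R + half%:R <= d%:R :> R.
    have hA : half = count PA (iota 0 d) by have := size_coordsA; rewrite size_filter => ->.
    have hB : size (coords PB) = count (predC PA) (iota 0 d).
      by rewrite size_filter; exact: eq_count.
    have hh : (count PA (iota 0 d) + count (predC PA) (iota 0 d) = d)%N.
      by rewrite count_predC size_iota.
    rewrite -natrD ler_nat hB [X in (_ + X)%N]hA addnC [X in (X <= _)%N]hh.
    exact: leqnn.
  have := ler_wpM2r incv0 hn; rewrite /c1 -expRD ler_expR; lra.
have h := Es_bad_le PA e; rewrite size_coordsA in h.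
have -> : 2 * expR (k%:R - half%:R / 32) = expR k%:R * (2 * expR (- (half%:R / 32))) :> R.
  by rewrite expRD; ring.
by rewrite ler_wpM2l ?expR_ge0.
Qed.

End TwoStage.

Transparent wdist sgl adj.

Lemma wdistE {R : realType} (q a b : R) : wdist q a b = kap a b `^ q.
Proof. by []. Qed.

Lemma adjE {R : realType} (q : R) d tq x z (e : nat * nat -> measurableTypeR R) :
  adj q d tq x z e = 1 - 2 * ((tq < qsum q d x z e)%R)%:R.
Proof. by []. Qed.

Opaque wdist sgl adj corr.

(** * From flat coordinate lists to environments *)

(** Each normalized integral over [[0, 2]] is an expectation under [unif02]. Agreement of [f] and
    [H] is asked only for integrated coordinates in [[0, 2]], where clamping changes nothing. *)
Lemma unif_iint_Es {R : realType} {I : eqType} (s : seq I) (f : seq R -> \bar R)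
    (H : (I -> measurableTypeR R) -> R) (e : I -> measurableTypeR R) :
  uniq s -> bm H -> (forall e, 0 <= H e) ->
  (forall e' : I -> measurableTypeR R, (forall p, p \notin s -> e' p = e p) ->
     (forall p, p \in s -> 0 <= e' p <= 2) -> f (map (e' : I -> R) s) = (H e')%:E) ->
  unif_iint (size s) f = (Es unif02 s H e)%:E.
Proof.
move=> + bH H0; elim: s f e => [|i s IH] f e.
  by move=> _ fH; rewrite /= -(fH e).
rewrite cons_uniq => /andP[is_ us] fH.
have bE : bm (Es unif02 s H) by exact: bmEs.
have EG : (E1 unif02 i (Es unif02 s H) e)%:E = ((((2 : R) - 0)^-1)%:E *
    \int[lebesgue_measure]_(x in `[(0%R : R), (2%R : R)]) (Es unif02 s H (upd e i x))%:E)%E.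
  rewrite (E1_EFin unif02 i e bE) /unif02 integral_uniform//.
    by apply/measurable_EFinP; exact: (bm_slice i e bE).
  by move=> x; rewrite lee_fin; exact: Es_ge0.
rewrite [RHS]EG subr0 [LHS]/=.
apply: (congr1 (fun z => ((2 : R)^-1)%:E * z)%E).
apply: eq_integral => x; rewrite inE /= in_itv /= => xI.
apply: IH => // e' out inn.
have ei : e' i = x by rewrite out// upd_same.
rewrite -(fH e').
- by rewrite /= ei.
- by move=> p; rewrite inE negb_or => /andP[pi ps]; rewrite out// upd_diff.
- by move=> p; rewrite inE => /orP[/eqP ->|]; [rewrite ei|exact: inn].
Qed.

Lemma size_pts d k : size (pts d k) = (k * d)%N.
Proof. by elim: k => [//|k IH]; rewrite ptsS size_cat IH size_map size_iota mulSn addnC. Qed.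

Lemma uniq_pts d k : uniq (pts d k).
Proof.
elim: k => [//|k IH]; rewrite ptsS cat_uniq IH uniq_pt andbT /=.
by apply/hasPn => p; rewrite mem_pt mem_pts => /andP[/eqP -> _]; rewrite ltnn.
Qed.

Lemma nth_pts {T : Type} (x0 : T) d k (e : nat * nat -> T) i j : (i < k)%N -> (j < d)%N ->
  nth x0 (map e (pts d k)) (i * d + j) = e (i, j).
Proof.
move=> + jd; elim: k => [//|k IH]; rewrite ltnS => ik.
rewrite ptsS map_cat nth_cat size_map size_pts.
have [ik'|ki] := ltnP i k.
  have -> : (i * d + j < k * d)%N.
    apply: (@leq_trans (i.+1 * d)); first by rewrite mulSn addnC ltn_add2r.
    by rewrite leq_mul2r ik' orbT.
  exact: IH.
have -> : i = k by apply/eqP; rewrite eqn_leq ik ki.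
rewrite ltnNge leq_addr /= addKn /pt -map_comp (nth_map 0%N) ?size_iota//.
by rewrite nth_iota.
Qed.

Lemma qdist_le {R : realType} (q : R) d tau (a b : nat -> R) : 1 <= q -> 0 <= tau ->
  (forall j, (j < d)%N -> 0 <= a j <= 2) -> (forall j, (j < d)%N -> 0 <= b j <= 2) ->
  (qdist d q a b <= tau) = (\sum_(l <- iota 0 d) wdist q (a l) (b l) <= tau `^ q).
Proof.
move=> q1 t0 ha hb.
have q0 : 0 < q by exact: lt_le_trans ltr01 q1.
have qi0 : 0 <= q^-1 by rewrite invr_ge0 ltW.
have -> : \sum_(l <- iota 0 d) wdist q (a l) (b l) = \sum_(j < d) circ (a j) (b j) `^ q.
  rewrite -(big_mkord xpredT (fun l => circ (a l) (b l) `^ q)) /index_iota subn0.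
  rewrite big_seq [RHS]big_seq; apply: eq_bigr => l; rewrite mem_iota add0n => /andP[_ ld].
  by rewrite wdistE kap_id ?ha ?hb.
rewrite /qdist; set S := \sum_(j < d) _.
have S0 : 0 <= S by apply: sumr_ge0 => j _; exact: powR_ge0.
have SE : S = (S `^ q^-1) `^ q by rewrite -powRrM mulVf ?lt0r_neq0// powRr1.
have tE : tau = (tau `^ q) `^ q^-1 by rewrite -powRrM mulfV ?lt0r_neq0// powRr1.
apply/idP/idP => h.
  by rewrite SE; apply: ge0_ler_powR; rewrite ?nnegrE ?powR_ge0// ltW.
by rewrite tE; apply: ge0_ler_powR; rewrite ?nnegrE ?powR_ge0.
Qed.

Lemma card_upper_pairs n : #|upper_pairs n| = 'C(n, 2).
Proof.
rewrite -sum1_card (eq_bigl (fun p : 'I_n * 'I_n => true && (p.1 < p.2)%N)); last first.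
  by move=> p; rewrite in_upper_pairs.
rewrite -(pair_big_dep xpredT (fun i j : 'I_n => (i < j)%N) (fun _ _ => 1%N)) /=.
rewrite (exchange_big_dep xpredT)//= -bin2_sum big_mkord; apply: eq_bigr => j _.
by rewrite -(big_ord_widen n (fun=> 1%N) (ltnW (ltn_ord j))) sum_nat_const card_ord muln1.
Qed.

Lemma er_probE {R : realType} n : er_prob R n = (#|simple_graphs n|%:R)^-1.
Proof.
have -> : #|simple_graphs n| = (2 ^ 'C(n, 2))%N.
  rewrite -card_upper_pairs -card_powerset; apply: eq_card => G.
  by rewrite simple_graphsE powersetE.
by rewrite /er_prob natrX exprVn.
Qed.

(** * Consequences of the median threshold, and the bound on the total variation distance *)

Section Median.
Context {R : realType} (q : R) (d : nat) (tau : R).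
Hypothesis q1 : 1 <= q.
Hypothesis med : is_median_thr d q tau.
Local Notation TR := (measurableTypeR R).
Local Notation U := (@unif02 R).
Local Notation env := ((nat * nat)%type -> TR).
Local Notation E i F := (@E1 R _ TR (nat * nat)%type U i F).
Local Notation Es s F := (@Es R _ TR (nat * nat)%type U s F).
Local Notation tq := (tau `^ q).
Implicit Types (x y z j l : nat) (e : env).

Let q0 : 0 < q. Proof. exact: lt_le_trans ltr01 q1. Qed.

Lemma median_Es (H : env -> R) e0 : bm H -> (forall e, 0 <= H e) ->
  (forall e, (forall p, p \in pts d 2 -> 0 <= e p <= 2) ->
     ind R (qdist d q (fun j => e (0%N, j)) (fun j => e (1%N, j)) <= tau) = (H e)%:E) ->
  Es (pts d 2) H e0 = 2^-1.
Proof.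
move=> bH H0 HE.
suff h : ((2 : R)^-1)%:E = (Es (pts d 2) H e0)%:E by case: h.
move: med; rewrite /is_median_thr => <-.
have -> : (d + d)%N = size (pts d 2) by rewrite size_pts mul2n addnn.
apply: unif_iint_Es => //; first exact: uniq_pts.
move=> e' _ inn.
have qE : qdist d q (fun j => nth 0 (map (e' : nat * nat -> R) (pts d 2)) j)
    (fun j => nth 0 (map (e' : nat * nat -> R) (pts d 2)) (d + j)) =
    qdist d q (fun j => e' (0%N, j)) (fun j => e' (1%N, j)); last first.
  by rewrite qE; exact: HE e' inn.
rewrite /qdist; apply: (congr1 (fun r => r `^ q^-1)); apply: eq_bigr => j _.
have h0 := nth_pts 0 (e' : nat * nat -> R) (isT : 0 < 2)%N (ltn_ord j).
have h1 := nth_pts 0 (e' : nat * nat -> R) (isT : 1 < 2)%N (ltn_ord j).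
by rewrite mul0n add0n in h0; rewrite mul1n in h1; rewrite h0 h1.
Qed.

Lemma tau_ge0 : 0 <= tau.
Proof.
rewrite leNgt; apply/negP => t0.
have h : Es (pts d 2) (fun _ => 0) (fun=> 0) = 2^-1.
  apply: median_Es => //; first exact: bm_cst.
  move=> e _; suff -> : (qdist d q (fun j => e (0%N, j)) (fun j => e (1%N, j)) <= tau) = false by [].
  by apply/negbTE; rewrite -ltNge; apply: lt_le_trans t0 (powR_ge0 _ _).
by have h' := Es_cst U (pts d 2) 0 (fun=> 0); rewrite h in h'; lra.
Qed.

Lemma bm_qsum_le : bm (fun e => ((qsum q d 0 1 e <= tq)%R)%:R : R).
Proof. by apply/bm_bool/mbool_le; [exact: bm_qsum|exact: bm_cst]. Qed.

Lemma median_qsum e0 : Es (pts d 2) (fun e => ((qsum q d 0 1 e <= tq)%R)%:R) e0 = 2^-1.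
Proof.
apply: median_Es; first exact: bm_qsum_le.
  by move=> e; rewrite ler0n.
move=> e inn; rewrite (qdist_le q1 tau_ge0).
- by rewrite /qsum; case: (_ <= _).
- by move=> j jd; apply: inn; rewrite mem_pts.
- by move=> j jd; apply: inn; rewrite mem_pts.
Qed.

Let pts2 : pts d 2 = pt d 0 ++ pt d 1.
Proof. by rewrite !ptsS. Qed.

(** The mean given one end point is a constant, hence equal to the overall mean, which the median
    makes zero. *)
Lemma Es_adj0 x z e : x != z -> Es (pt d z) (adj q d tq x z) e = 0.
Proof.
move=> xz; rewrite (Es_adj_cst d tq q1 e e xz (isT : 0%N != 1%N)).
have cE : Es (pt d 1) (adj q d tq 0 1) = fun _ => Es (pt d 1) (adj q d tq 0 1) e.
  by apply/funext => e'; exact: Es_adj_cst.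
have bH := bm_qsum_le.
have h : Es (pts d 2) (adj q d tq 0 1) e = 0.
  have -> : adj q d tq 0 1 = fun e => 2 * ((qsum q d 0 1 e <= tq)%R)%:R - 1.
    by apply/funext => e'; rewrite adjE ltNge; case: (_ <= _); rewrite /=; ring.
  rewrite (EsB U _ e (bmM (bm_cst 2) bH) (bm_cst 1)) (EsZ U _ 2 e bH) Es_cst median_qsum.
  by rewrite mulfV ?subrr// pnatr_eq0.
by rewrite pts2 Es_cat cE Es_cst in h.
Qed.

(* If the q-norm is below the threshold, so is every coordinate distance. *)
Lemma median_pow_ge : 2^-1 <= (Num.min 1 tau) ^+ d.
Proof.
have t0 := tau_ge0; set th := Num.min 1 tau.
have th01 : 0 <= th <= 1 by rewrite le_min ler01 t0 /= ge_min lexx.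
have tE : tau = tq `^ q^-1 by rewrite -powRrM mulfV ?lt0r_neq0// powRr1.
pose A (p : nat * nat) e : R := ((kap (e (0%N, p.2)) (e p) <= th)%R)%:R.
have bA p : bm (A p).
  by apply/bm_bool/mbool_le; [exact: bm_kap_var|exact: bm_cst].
have bP : bm (fun e => \prod_(p <- pt d 1) A p e) by apply: bm_prod => p; exact: bA.
rewrite -(median_qsum (fun=> 0)) pts2 Es_cat.
apply: Es_le_cst; first by apply: bmEs; exact: bm_qsum_le.
move=> e; apply: (@le_trans _ _ (Es (pt d 1) (fun e => \prod_(p <- pt d 1) A p e) e)).
  apply: Es_le; [exact: bm_qsum_le|exact: bP|].
  move=> e'; case: (boolP (qsum q d 0 1 e' <= tq)) => h; last first.
    by apply: prodr_ge0 => p _; rewrite ler0n.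
  rewrite big_seq big1// => -[a j]; rewrite mem_pt /= => /andP[/eqP -> jd].
  rewrite /A /= le_min kap_le1 /= tE -(wdist_le q1)// ?powR_ge0//.
  have -> : (wdist q (e' (0%N, j)) (e' (1%N, j)) <= tq) = true; last by [].
  apply: le_trans h; rewrite /qsum (bigD1_seq j) ?iota_uniq ?mem_iota//=.
  by rewrite lerDl; apply: sumr_ge0 => l _; exact: wdist_ge0.
rewrite (Es_prod U e (uniq_pt d 1) bA); last first.
  move=> [a j] [b l]; rewrite !mem_pt /= => /andP[/eqP -> _] /andP[/eqP -> _] jl e' t.
  by rewrite /A /= !upd_diff.
have -> : \prod_(p <- pt d 1) E p (A p) e = \prod_(p <- pt d 1) th.
  rewrite big_seq [RHS]big_seq; apply: eq_bigr => -[a j].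
  rewrite mem_pt /= => /andP[/eqP -> _].
  rewrite -[RHS](E_kap_le (e (0%N, j)) ((1, j)%N : nat * nat) e th01); apply: E1_eq => t.
  by rewrite /A /= upd_diff//; apply/eqP => -[].
by rewrite big_const_seq count_predT size_map size_iota iter_mulr mulr1.
Qed.

(** Otherwise [(min 1 tau)^d] would be at most [expR (- d^-1) ^ d = expR (-1)], which is below
    1/2. *)
Lemma tau_ge : (1 < d)%N -> 1 - d%:R^-1 <= tau.
Proof.
move=> d2; rewrite leNgt; apply/negP => tl.
have D0 : 0 < d%:R :> R by rewrite ltr0n; lia.
have Di0 : 0 < d%:R^-1 :> R by rewrite invr_gt0.
have Di1 : d%:R^-1 <= 1 :> R by rewrite invf_le1// ler1n; lia.
have h := median_pow_ge.
have t0 := tau_ge0.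
have h1 : (Num.min 1 tau) ^+ d <= expR (- d%:R^-1) ^+ d.
  apply: lerXn2r; rewrite ?nnegrE ?expR_ge0//; first by rewrite le_min ler01.
  apply: (@le_trans _ _ tau); first by rewrite ge_min lexx orbT.
  by apply: le_trans (ltW tl) _; have := expR_ge1Dx (- d%:R^-1 : R); lra.
have h2 : expR (- d%:R^-1) ^+ d = expR (-1) :> R.
  by rewrite -expRM_natl mulrN mulfV// lt0r_neq0.
have h3 : expR (-1) * expR 1 = 1 :> R by rewrite -expRD addNr expR0.
have h4 := @expR_gt1Dx R 1 (oner_neq0 _).
have h5 := expR_gt0 (-1 : R).
rewrite h2 in h1; have h6 : 2^-1 <= expR (-1) :> R by exact: le_trans h h1.
have h7 := ler_wpM2r (expR_ge0 (1 : R)) h6; rewrite h3 in h7.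
by lra.
Qed.

Let adj_norm1 i j e : `|adj q d tq i j e| <= 1.
Proof. by rewrite adj_norm. Qed.

(** At a latent configuration each factor [1 + s h] is 2 or 0, according as the pair has the status
    prescribed by [G]; [er_prob] normalizes the product into an indicator. *)
Lemma rgg_probE n (G : {set 'I_n * 'I_n}) e0 : G \in simple_graphs n ->
  rgg_prob d q tau G = er_prob R n * dens U d (adj q d tq) e0 n G.
Proof.
move=> GS; rewrite /rgg_prob -(size_pts d n).
have bW : bm (wgt (adj q d tq) n G) by apply: bm_wgt => i j; exact: bm_adj.
have er0 : 0 <= er_prob R n by rewrite exprn_ge0// invr_ge0.
rewrite (unif_iint_Es (H := fun e => er_prob R n * wgt (adj q d tq) n G e) (e := e0)).
- by rewrite /= (EsZ U _ _ e0 bW).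
- exact: uniq_pts.
- exact: bmM (bm_cst _) bW.
- by move=> e; rewrite mulr_ge0// wgt_ge0.
move=> e _ inn; set Ed := rgg_edges _ _ _ _.
have EdE (p : 'I_n * 'I_n) : (p \in Ed) = (p.1 < p.2)%N && (qsum q d p.1 p.2 e <= tq).
  rewrite /Ed finset.in_set; congr (_ && _).
  have cE (i : 'I_n) j : (j < d)%N -> config d (map (e : _ -> R) (pts d n)) i j = e (val i, j).
    by move=> jd; rewrite /config nth_pts.
  have iI (i : 'I_n) j : (j < d)%N -> 0 <= e (val i, j) <= 2.
    by move=> jd; apply: inn; rewrite mem_pts /= ltn_ord.
  rewrite (qdist_le q1 tau_ge0).
  - rewrite /qsum; apply: (congr1 (fun r => r <= tq)).
    rewrite big_seq [RHS]big_seq; apply: eq_bigr => j; rewrite mem_iota add0n => /andP[_ jd].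
    by rewrite !cE.
  - by move=> j jd; rewrite cE// iI.
  - by move=> j jd; rewrite cE// iI.
have fE (p : 'I_n * 'I_n) : (p.1 < p.2)%N ->
    1 + esign G p * adj q d tq p.1 p.2 e = if (p \in Ed) == (p \in G) then 2 else 0 :> R.
  move=> pl; rewrite EdE pl /= /esign adjE ltNge.
  by case: (p \in G); case: (_ <= _); rewrite /=; ring.
have [EG|EG] := eqVneq Ed G.
  rewrite /ind /wgt (eq_bigr (fun=> 2)); last first.
    by move=> p /andP[pl _]; rewrite fE// EG eqxx.
  rewrite (eq_bigl (fun p => p \in upper_pairs n)); last first.
    by move=> p; rewrite in_upper_pairs ltn_ord andbT.
  have -> : er_prob R n * \prod_(p in upper_pairs n) 2 = 1; last by [].
  by rewrite prodr_const card_upper_pairs /er_prob exprVn mulVf// expf_neq0// pnatr_eq0.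
have [p pl pd] : exists2 p : 'I_n * 'I_n, (p.1 < p.2)%N & (p \in Ed) != (p \in G).
  apply: contrapT => nex; move/eqP: EG; apply; apply/setP => p.
  have [pl|pl] := boolP (p.1 < p.2)%N.
    by apply/eqP; apply: contrapT => /negP pd; apply: nex; exists p.
  rewrite EdE (negbTE pl) /=; apply/esym/negbTE; apply: contra pl => pG.
  by move: GS; rewrite simple_graphsE => /fintype.subsetP/(_ p pG); rewrite in_upper_pairs.
rewrite /ind /wgt (bigD1 p) /=; last by rewrite pl ltn_ord.
by rewrite fE// (negbTE pd) mul0r mulr0.
Qed.

Lemma tv_sqr_le_overlap n e0 : tv_rgg_er n d q tau ^+ 2 <=
  \sum_(k < n) (overlap U d (adj q d tq) e0 k - 1).
Proof.
have h := avg_dens_dist1 U n (bm_adj d tq q1) adj_norm1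
  (fun i j => @dep_adj R q d tq i j) (adj_rename q d tq) e0.
have er0 : 0 <= er_prob R n by rewrite exprn_ge0// invr_ge0.
have -> : tv_rgg_er n d q tau = 2^-1 * (er_prob R n *
    \sum_(G in simple_graphs n) `|dens U d (adj q d tq) e0 n G - 1|).
  rewrite /tv_rgg_er; apply: (congr1 (fun r => 2^-1 * r)).
  rewrite mulr_sumr; apply: eq_bigr => G GS; rewrite (rgg_probE e0 GS).
  by rewrite -[X in _ - X]mulr1 -mulrBr normrM ger0_norm.
by rewrite er_probE exprMn; move: h => /=; lra.
Qed.

Lemma overlap_le k e0 (Dl ep : R) : (1 < d)%N -> 0 < tq -> 0 <= Dl ->
  1 - Dl <= ep `^ q^-1 -> 0 <= ep -> ep <= tq / 2 ->
  k%:R * (4 * (Dl + Dl ^+ 2) * pbound' q d + 4 * beta d tq ep) <= 1 / 2 ->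
  overlap U d (adj q d tq) e0 k <=
  expR (2 * (d%:R * incv q d tq k Dl ep)) + 2 * expR (k%:R - (half d)%:R / 32).
Proof.
move=> d2 tq0 Dl0 Dlep ep0 eptq small; rewrite /overlap.
have -> : (fun e => \prod_(i < k) (1 + codeg U d (adj q d tq) k i e)) =
    (fun e => \prod_(i < k) (1 + corr q d tq k k.+1 i e)).
  apply/funext => e; apply: eq_bigr => i _; apply: (congr1 (fun r => 1 + r)).
  by rewrite /codeg (adjC q d tq i k) (adjC q d tq i k.+1).
apply: Es_le_cst.
  by apply: bmEs; apply: bm_prod => i; apply: bmD; [exact: bm_cst|exact: bm_corr].
move=> e; apply: (Es_prod_corr_le q1 _ (leqnn k) (leqnSn k) Es_adj0 d2 tq0 Dl0 Dlep ep0 eptq small).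
by rewrite neq_ltn ltnSn.
Qed.

(** The value given to [Dl]. For [ep = tq / d ^ 6] the root [ep ^ (1 / q)] is
    [tau * expR (- 6 ln d / q)], at least [(1 - 1 / d) (1 - 6 ln d / q)], hence at least
    [1 - shift]. *)
Definition shift : R := d%:R^-1 + 6 * (ln d%:R / q).

Lemma pbound'_ge0 : 0 <= pbound' q d.
Proof.
apply: addr_ge0; last by rewrite mulr_ge0 ?expR_ge0.
rewrite /pbound le_min ler01 /=; apply: divr_ge0; first by rewrite exprn_ge0// ler0n.
by rewrite mulr_ge0 ?ler0n// ltW// wvar_gt0.
Qed.

Lemma shift_ge0 : (1 < d)%N -> 0 <= shift.
Proof.
move=> d2; apply: addr_ge0; first by rewrite invr_ge0 ler0n.
by rewrite mulr_ge0// divr_ge0 ?(ltW q0)// ln_ge0// ler1n; lia.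
Qed.

(* The tiny-distance cutoff [ep = tq / d ^ 6] makes [beta] equal to [4 / d ^ 4]. *)
Lemma tv_sqr_le n : (1 < d)%N ->
  n%:R * (4 * (shift + shift ^+ 2) * pbound' q d + 4 * (4 / d%:R ^+ 4)) <= 1 / 2 ->
  tv_rgg_er n d q tau ^+ 2 <= n%:R * (expR (2 * (d%:R * (n%:R ^+ 2 *
    (32 * (2 * (2 * shift ^+ 3 + shift ^+ 4) * pbound' q d ^+ 2 + (4 / d%:R ^+ 4) ^+ 2))))) - 1 +
    2 * expR (n%:R - (half d)%:R / 32)).
Proof.
move=> d2 small.
have D2 : 2 <= d%:R :> R by rewrite ler_nat.
have D0 : 0 < d%:R :> R by lra.
have Di : d%:R^-1 <= 2^-1 :> R by rewrite lef_pV2 ?posrE.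
have tl := tau_ge d2.
have t0 : 0 < tau by lra.
have tq0 : 0 < tq by exact: powR_gt0.
have Dl0 := shift_ge0 d2; have pb0 := pbound'_ge0.
pose ep := tq / d%:R ^+ 6.
have D6 : 0 < d%:R ^+ 6 :> R by exact: exprn_gt0.
have ep0 : 0 < ep by exact: divr_gt0.
have bE : beta d tq ep = 4 / d%:R ^+ 4.
  by rewrite /beta /ep; field; rewrite !lt0r_neq0.
have eptq : ep <= tq / 2.
  rewrite /ep ler_pM2l// lef_pV2 ?posrE//.
  apply: (le_trans D2); rewrite -[leLHS]expr1; apply: ler_weXn2l => //; lra.
have Dlep : 1 - shift <= ep `^ q^-1.
  have lnE : ln ep = ln tq - 6 * ln d%:R.
    by rewrite /ep ln_div ?posrE// lnXn// -[ln _ *+ 6]mulr_natl.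
  have -> : ep `^ q^-1 = tau * expR (- (6 * (ln d%:R / q))).
    rewrite {1}/powR gt_eqF// lnE.
    have -> : q^-1 * (ln tq - 6 * ln d%:R) = ln tau - 6 * (ln d%:R / q).
      by rewrite ln_powR; field; rewrite lt0r_neq0.
    by rewrite expRD lnK ?posrE.
  have l0 : 0 <= ln d%:R / q by rewrite divr_ge0 ?(ltW q0)// ln_ge0//; lra.
  have h1 := expR_ge1Dx (- (6 * (ln d%:R / q)) : R).
  have h2 : (1 - d%:R^-1) * (1 - 6 * (ln d%:R / q)) <= (1 - d%:R^-1) * expR (- (6 * (ln d%:R / q))).
    by rewrite ler_wpM2l//; lra.
  have h3 : (1 - d%:R^-1) * expR (- (6 * (ln d%:R / q))) <= tau * expR (- (6 * (ln d%:R / q))).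
    by rewrite ler_wpM2r// expR_ge0.
  have h4 : 0 <= d%:R^-1 * (ln d%:R / q) by rewrite mulr_ge0// invr_ge0 ltW.
  by apply: le_trans h3; apply: le_trans h2; rewrite /shift; lra.
pose c : R := 4 * (shift + shift ^+ 2) * pbound' q d + 4 * (4 / d%:R ^+ 4).
have be0 : 0 <= 4 / d%:R ^+ 4 :> R by rewrite divr_ge0// exprn_ge0// ltW.
have c0 : 0 <= c.
  apply: addr_ge0; last by rewrite mulr_ge0.
  by apply: mulr_ge0 => //; apply: mulr_ge0 => //; apply: addr_ge0 => //; exact: exprn_ge0.
pose V : R := 32 * (2 * (2 * shift ^+ 3 + shift ^+ 4) * pbound' q d ^+ 2 + (4 / d%:R ^+ 4) ^+ 2).
have V0 : 0 <= V.
  apply: mulr_ge0 => //; apply: addr_ge0; last exact: sqr_ge0.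
  apply: mulr_ge0; last exact: sqr_ge0.
  apply: mulr_ge0 => //; apply: addr_ge0; last exact: exprn_ge0.
  by apply: mulr_ge0 => //; exact: exprn_ge0.
apply: le_trans (tv_sqr_le_overlap n (fun=> 0)) _.
apply: (@le_trans _ _ (\sum_(k < n) (expR (2 * (d%:R * (n%:R ^+ 2 * V))) - 1 +
    2 * expR (n%:R - (half d)%:R / 32)))); last first.
  by rewrite sumr_const card_ord -[X in X <= _]mulr_natl.
apply: ler_sum => k _.
have kn : k%:R <= n%:R :> R by rewrite ler_nat ltnW.
have k0 : 0 <= k%:R :> R by rewrite ler0n.
have small' : k%:R * (4 * (shift + shift ^+ 2) * pbound' q d + 4 * beta d tq ep) <= 1 / 2.
  by rewrite bE; apply: le_trans small; exact: ler_wpM2r.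
have h := overlap_le (fun=> 0) d2 tq0 Dl0 Dlep (ltW ep0) eptq small'.
have h1 : expR (2 * (d%:R * incv q d tq k shift ep)) <= expR (2 * (d%:R * (n%:R ^+ 2 * V))).
  rewrite ler_expR ler_wpM2l// ler_wpM2l ?(ltW D0)// /incv bE -/V ler_wpM2r//.
  by apply: lerXn2r; rewrite ?nnegrE// ler0n.
have h2 : expR (k%:R - (half d)%:R / 32) <= expR (n%:R - (half d)%:R / 32) :> R.
  by rewrite ler_expR lerD2r.
by lra.
Qed.

End Median.

(** * Rates in the two regimes *)

Section Rates.
Context {R : realType}.
Implicit Types (n d : nat) (q tau A Y : R).

Lemma half_ge d : (1 < d)%N -> d%:R <= 3 * (half d)%:R :> R.
Proof. by move=> d2; rewrite -natrM ler_nat /half; lia. Qed.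

Lemma expRN_le (x : R) : 0 < x -> expR (- x) <= x^-1.
Proof.
move=> x0; rewrite expRN lef_pV2 ?posrE ?expR_gt0//.
by have := expR_ge1Dx x; lra.
Qed.

Lemma pbound'_le3 q d : pbound' q d <= 3.
Proof.
have h1 : pbound q d <= 1 by rewrite /pbound ge_min lexx.
have h2 : expR (- ((half d)%:R / 32)) <= 1 :> R.
  by rewrite -expR0 ler_expR oppr_le0 divr_ge0 ?ler0n.
by rewrite /pbound'; lra.
Qed.

(** [960 = 3 * 320] comes from [d <= 3 * half d] and [wvar_ge], and [192 = 2 * 3 * 32] from the
    exponential term of [pbound']. *)
Definition pconst : R := 264 ^+ 2 * 960 + 192.

Lemma pconst_ge1 : 1 <= pconst.
Proof.
rewrite /pconst; have : 0 <= 264 ^+ 2 :> R by exact: sqr_ge0.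
by move: (264 ^+ 2) => c; lra.
Qed.

Lemma pbound'_le q d : 1 <= q -> (1 < d)%N -> pbound' q d <= pconst * (q / d%:R).
Proof.
move=> q1 d2; have hd := half_ge d2.
have D0 : 0 < d%:R :> R by rewrite ltr0n; lia.
rewrite /pbound' /pbound /pconst.
move: hd; move: (half d)%:R => h hd; move: D0 hd; move: d%:R => D D0 hd.
have h0 : 0 < h by lra.
have w0 := wvar_gt0 q1.
have w1 : 1 <= 320 * q * wvar q.
  have q320 : 0 < 320 * q by apply: mulr_gt0; [rewrite ltr0n|lra].
  have := wvar_ge q1 0%N (fun _ : nat => (0 : R)); rewrite ler_pdivrMr; last exact: q320.
  by rewrite mulrC.
move: w0 w1; move: (wvar q) => w w0 w1.
have c0 : 0 <= 264 ^+ 2 :> R by exact: sqr_ge0.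
move: c0; move: (264 ^+ 2) => c c0.
have r1 : 1 <= 3 * h / D by rewrite ler_pdivlMr// mul1r.
have s1 : Num.min 1 (c / (h * w)) <= c * 960 * (q / D).
  rewrite ge_min; apply/orP; right; rewrite ler_pdivrMr ?mulr_gt0//.
  have -> : c * 960 * (q / D) * (h * w) = c * ((3 * h / D) * (320 * q * w)).
    by field; rewrite lt0r_neq0.
  by rewrite -[leLHS]mulr1 ler_wpM2l// mulr_ege1.
have s2 : 2 * expR (- (h / 32)) <= 192 * (q / D).
  have x0 : 0 < h / 32 by rewrite divr_gt0.
  have e1 := expRN_le x0.
  have e2 : (h / 32)^-1 <= 96 / D.
    rewrite invf_div ler_pdivrMr//.
    have -> : 96 / D * h = 32 * (3 * h / D) by field; rewrite lt0r_neq0.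
    by lra.
  have e3 : 1 / D <= q / D by rewrite ler_wpM2r// invr_ge0 ltW.
  by rewrite !mul1r in e3; lra.
by lra.
Qed.

(** Common to both regimes, [Y] standing for [d q] or [d ^ 2]. The variance is governed by
    [z = N^3 L^8 / Y], and the bound on single increments by [t = N L^4 / D]; since [Y <= A D^2],
    [t^2 <= A z], so that smallness of [z] suffices for both. *)
Lemma rate_bounds A (de N D L Y h s pb : R) :
  1 <= A -> 0 < de -> de <= 1 / 48 / 48 -> (8 * A + 32) * de <= 1 ->
  1 <= N -> 2 <= D -> 1 <= L -> 0 < Y -> Y <= A * D ^+ 2 -> D <= 3 * h -> 0 <= s -> 0 <= pb ->
  (s + s ^+ 2) * pb <= A * (L ^+ 4 / D) ->
  D * ((2 * s ^+ 3 + s ^+ 4) * pb ^+ 2) <= A * (L ^+ 8 / Y) ->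
  N ^+ 3 * L ^+ 8 <= de ^+ 2 / A * Y ->
  N * (4 * (s + s ^+ 2) * pb + 4 * (4 / D ^+ 4)) <= 1 / 2 /\
  N * (expR (2 * (D * (N ^+ 2 * (32 * (2 * (2 * s ^+ 3 + s ^+ 4) * pb ^+ 2 +
    (4 / D ^+ 4) ^+ 2))))) - 1 + 2 * expR (N - h / 32)) <= 400 * de.
Proof.
move=> A1 de0 de1 deA N1 D2 L1 Y0 YD hd s0 pb0.
have L4_1 : 1 <= L ^+ 4 by exact: exprn_ege1.
have L8_1 : 1 <= L ^+ 8 by exact: exprn_ege1.
have L48 : L ^+ 8 = (L ^+ 4) ^+ 2 by rewrite -exprM.
move: (L ^+ 8) (L ^+ 4) L48 L8_1 L4_1 => L8 L4 L48 L8_1 L4_1 h1 h2 h3.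
have A0 : 0 < A by lra.
have D0 : 0 < D by lra.
have N0 : 0 < N by lra.
have Di0 : 0 < D^-1 by rewrite invr_gt0.
have Di1 : D^-1 <= 1 by rewrite invf_le1//; lra.
have [z zE] : exists z, z = N ^+ 3 * (L8 / Y) by eexists.
have [t tE] : exists t, t = N * (L4 / D) by eexists.
have z1 : A * z <= de ^+ 2.
  have -> : A * z = A * (N ^+ 3 * L8) / Y by rewrite zE; ring.
  rewrite ler_pdivrMr//; have -> : de ^+ 2 * Y = A * (de ^+ 2 / A * Y).
    by field; rewrite lt0r_neq0.
  by rewrite ler_wpM2l// ltW.
have YDi : (D ^+ 2)^-1 <= A / Y.
  by rewrite ler_pdivlMr// mulrC ler_pdivrMr// exprn_gt0.
have L80 : 0 <= L8 by lra.
have L8D : L8 / D ^+ 2 <= A * (L8 / Y).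
  have -> : A * (L8 / Y) = L8 * (A / Y) by ring.
  exact: ler_wpM2l.
have N23 : N ^+ 2 <= N ^+ 3 by exact: ler_weXn2l.
have D20 : 0 <= (D ^+ 2)^-1 by rewrite invr_ge0 sqr_ge0.
have t0 : 0 <= t.
  by rewrite tE; apply: mulr_ge0; [lra|apply: divr_ge0; lra].
have t1 : t <= de.
  rewrite -(@ler_pXn2r _ 2) ?nnegrE ?(ltW de0)//; apply: le_trans z1.
  have -> : t ^+ 2 = N ^+ 2 * (L8 / D ^+ 2) by rewrite tE L48; field; rewrite lt0r_neq0.
  have -> : A * z = N ^+ 3 * (A * (L8 / Y)) by rewrite zE; ring.
  by apply: ler_pM => //; [exact: sqr_ge0|exact: mulr_ge0].
have LD : D^-1 <= L4 / D by rewrite -[leLHS]mul1r ler_wpM2r// ltW.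
have D41 : (D ^+ 4)^-1 <= L4 / D.
  rewrite -exprVn; apply: le_trans LD.
  by rewrite -[leRHS]expr1; apply: (@ler_wiXn2l _ (D^-1)) => //; exact: ltW.
split.
  apply: (@le_trans _ _ ((4 * A + 16) * t)).
    have -> : (4 * A + 16) * t = N * (4 * (A * (L4 / D)) + 16 * (L4 / D)) by rewrite tE; ring.
    rewrite ler_wpM2l ?(ltW N0)//; move: h1 D41; clear; move: (L4 / D) => u h1 D41; lra.
  apply: (@le_trans _ _ ((4 * A + 16) * de)); last by move: deA; clear; lra.
  by apply: ler_wpM2l => //; move: A0; clear; lra.
set X := 2 * (D * _).
have X0 : 0 <= X.
  apply: mulr_ge0 => //; apply: mulr_ge0; first exact: ltW.
  apply: mulr_ge0; first exact: sqr_ge0.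
  apply: mulr_ge0; first by rewrite ler0n.
  apply: addr_ge0; last exact: sqr_ge0.
  apply: mulr_ge0; last exact: sqr_ge0.
  by apply: mulr_ge0 => //; apply: addr_ge0; [apply: mulr_ge0 => //|]; exact: exprn_ge0.
have D7 : (D ^+ 7)^-1 <= L8 / D ^+ 2.
  rewrite -!exprVn; apply: (@le_trans _ _ (D^-1 ^+ 2)).
    by apply: (@ler_wiXn2l _ (D^-1)) => //; exact: ltW.
  by rewrite -[leLHS]mul1r ler_wpM2r// sqr_ge0.
have X1 : N * X <= 24 * (48 * (A * z)).
  have -> : N * X = 64 * (N ^+ 3 * (2 * (D * ((2 * s ^+ 3 + s ^+ 4) * pb ^+ 2)) + 16 * (D ^+ 7)^-1)).
    by rewrite /X; field; rewrite lt0r_neq0.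
  have -> : 24 * (48 * (A * z)) = 64 * (N ^+ 3 * (18 * (A * (L8 / Y)))) by rewrite zE; ring.
  apply: ler_wpM2l; first by rewrite ler0n.
  apply: ler_wpM2l; first by rewrite exprn_ge0// ltW.
  have D7' := le_trans D7 L8D; move: h2 D7'; clear.
  by move: (A * (L8 / Y)) ((D ^+ 7)^-1) (D * ((2 * s ^+ 3 + s ^+ 4) * pb ^+ 2)) => *; lra.
have de2 : de ^+ 2 <= de * (1 / 48 / 48).
  by rewrite expr2; apply: ler_wpM2l => //; exact: ltW.
have X2 : X <= N * X by rewrite ler_peMl.
(* [24 * 48 * de ^+ 2] is at most [de / 2] exactly because [de <= 1 / 48 / 48]. *)
have NX : N * X <= de / 2 by move: X1 z1 de2; clear; move: (N * X) (A * z) (de ^+ 2) => *; lra.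
have X3 : X <= 1 / 2 by move: X2 NX de1; clear; move: (N * X) => *; lra.
have X4 : expR X - 1 <= 2 * X.
  have hx : `|X| <= 1 / 2 by rewrite ger0_norm.
  have hX2 : X ^+ 2 <= X * (1 / 2) by rewrite expr2; exact: ler_wpM2l.
  have := expR_le_quadratic hx; move: hX2; clear.
  by move: (expR X) (X ^+ 2) => *; lra.
have T1 : N * (expR X - 1) <= de.
  have := ler_wpM2l (ltW N0) X4; have -> : N * (2 * X) = 2 * (N * X) by ring.
  by move: NX; clear; move: (N * X) (N * _) => *; lra.
(* Thus [N] uses up at most half of the decay [h / 32], which is at least [D / 96]. *)
have nD : N <= D / 192.
  have nt : N / D <= t.
    have -> : t = N / D * L4 by rewrite tE; ring.
    by rewrite ler_peMr// divr_ge0// ltW.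
  have : N / D <= 1 / 192 by move: nt t1 de1; clear; move: (N / D) => *; lra.
  by rewrite ler_pdivrMr// mulrC mul1r.
have T2 : N * (2 * expR (N - h / 32)) <= 384 * t.
  have e1 : expR (N - h / 32) <= expR (- (D / 192)).
    by rewrite ler_expR; move: nD hd; clear; lra.
  have x0 : 0 < D / 192 by apply: divr_gt0 => //; rewrite ltr0n.
  have e2 : expR (- (D / 192)) <= 192 * D^-1 by have := expRN_le x0; rewrite invf_div.
  have -> : 384 * t = N * (384 * (L4 / D)) by rewrite tE; ring.
  apply: ler_wpM2l; first exact: ltW.
  by move: e1 e2 LD; clear; move: (expR _) (expR _) (D^-1) (L4 / D) => *; lra.
rewrite mulrDr; move: T1 T2 t1 de0; clear; move: (N * _) (N * _) => *; lra.
Qed.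

Lemma tv_small A eps : 1 <= A -> 0 < eps -> exists2 eta : R, 0 < eta &
  forall n d q tau Y, 1 <= q -> is_median_thr d q tau -> (0 < n)%N -> (1 < d)%N ->
    1 <= ln (d%:R : R) -> 0 < Y -> Y <= A * d%:R ^+ 2 ->
    (shift q d + shift q d ^+ 2) * pbound' q d <= A * (ln d%:R ^+ 4 / d%:R) ->
    d%:R * ((2 * shift q d ^+ 3 + shift q d ^+ 4) * pbound' q d ^+ 2) <= A * (ln d%:R ^+ 8 / Y) ->
    n%:R ^+ 3 * ln d%:R ^+ 8 <= eta * Y ->
    tv_rgg_er n d q tau <= eps.
Proof.
move=> A1 eps0.
have [de [de0 de1 deA dee]] : exists de : R,
    [/\ 0 < de, de <= 1 / 48 / 48, (8 * A + 32) * de <= 1 & 400 * de <= eps ^+ 2].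
  have a0 : 0 < 8 * A + 32 by lra.
  have a1 : 0 < 1 / 48 / 48 :> R by lra.
  have a2 : 0 < 400 :> R by rewrite ltr0n.
  exists (Num.min (1 / 48 / 48) (Num.min (1 / (8 * A + 32)) (eps ^+ 2 / 400))); split.
  - rewrite !lt_min; apply/and3P; split; [exact: a1|exact: divr_gt0|].
    exact: divr_gt0 (exprn_gt0 _ eps0) a2.
  - by rewrite ge_min lexx.
  - by rewrite mulrC -(ler_pdivlMr _ _ a0) ge_min; apply/orP; right; rewrite ge_min lexx.
  - by rewrite mulrC -(ler_pdivlMr _ _ a2) ge_min; apply/orP; right; rewrite ge_min lexx orbT.
exists (de ^+ 2 / A); first by apply: divr_gt0; [exact: exprn_gt0|lra].
move=> n d q tau Y q1 med n1 d2 L1 Y0 YD h1 h2 h3.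
have D2 : 2 <= d%:R :> R by rewrite ler_nat.
have N1 : 1 <= n%:R :> R by rewrite ler1n.
have tv0 : 0 <= tv_rgg_er n d q tau.
  apply: mulr_ge0; first by rewrite invr_ge0.
  by apply: sumr_ge0 => G _; exact: normr_ge0.
have [inc bnd] := rate_bounds A1 de0 de1 deA N1 D2 L1 Y0 YD (half_ge d2)
  (shift_ge0 q1 d2) (pbound'_ge0 d q1) h1 h2 h3.
rewrite -(@ler_pXn2r _ 2) ?nnegrE ?(ltW eps0)//.
exact: le_trans (tv_sqr_le q1 med d2 inc) (le_trans bnd dee).
Qed.

Lemma expR1_le4 : expR 1 <= 4 :> R.
Proof.
have h : `|1 / 2 : R| <= 1 / 2 by rewrite ger0_norm//; lra.
have := expR_le_quadratic h.
have -> : expR 1 = expR (1 / 2) * expR (1 / 2) :> R by rewrite -expRD; congr expR; lra.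
have e0 := expR_ge0 (1 / 2 : R); move=> h'.
have h2 : expR (1 / 2) <= 2 :> R by lra.
by have := ler_pM e0 e0 h2 h2; lra.
Qed.

Lemma ln_ge1 n : (4 <= n)%N -> 1 <= ln (n%:R : R).
Proof.
move=> n4; have n0 : 0 < n%:R :> R by rewrite ltr0n; lia.
rewrite -ler_expR lnK ?posrE//; apply: le_trans expR1_le4 _.
by rewrite ler_nat.
Qed.

(* Either [Y <= n ^ 7], so that [ln d] and [ln n] are comparable, or [n ^ 3] is at most
   [Y ^ (3 / 7)] and the power of [Y] left over absorbs the logarithm. *)
Lemma polylog_absorb (eta : R) : 0 < eta -> exists2 M : R, 0 < M &
  forall n d Y, (4 <= n)%N -> (4 <= d)%N -> d%:R <= Y ->
    M * (n%:R ^+ 3 * ln (n%:R : R) ^+ 8) <= Y ->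
    n%:R ^+ 3 * ln (d%:R : R) ^+ 8 <= eta * Y.
Proof.
(* [expR (4 l / 7)] is the ninth power of [expR (4 l / 63)], hence at least [c * l ^+ 9]. A ninth
   power leaves one factor [l] beyond [l ^+ 8], and [l >= l0] makes it absorb [eta]. *)
move=> eta0; pose c : R := (4 / 63) ^+ 9; pose l0 : R := (eta * c)^-1.
have c0 : 0 < c by apply: exprn_gt0; lra.
have K0 : 0 < 7 ^+ 8 / eta :> R by rewrite divr_gt0// exprn_gt0.
exists (Num.max (7 ^+ 8 / eta) (expR l0)); first by rewrite lt_max K0.
move=> n d Y n4 d4 dY MY.
have n1 : 1 <= n%:R :> R by rewrite ler1n; lia.
have n0 : 0 < n%:R :> R by lra.
have d0 : 0 < d%:R :> R by rewrite ltr0n; lia.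
have Y0 : 0 < Y by exact: lt_le_trans dY.
have ln1' := ln_ge1 n4; have ld1 := ln_ge1 d4.
have P1 : 1 <= n%:R ^+ 3 * ln n%:R ^+ 8 :> R by rewrite mulr_ege1// exprn_ege1.
have M1 : 7 ^+ 8 / eta * (n%:R ^+ 3 * ln n%:R ^+ 8) <= Y.
  by apply: le_trans MY; rewrite ler_wpM2r ?le_max ?lexx//; lra.
have M2 : expR l0 <= Y.
  apply: le_trans MY; apply: (@le_trans _ _ (expR l0 * (n%:R ^+ 3 * ln n%:R ^+ 8))).
    by rewrite ler_peMr// expR_ge0.
  by rewrite ler_wpM2r ?le_max ?lexx ?orbT//; lra.
have dl : ln d%:R <= ln Y by rewrite ler_ln ?posrE.
have ll : l0 <= ln Y by rewrite -ler_expR lnK ?posrE.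
have N30 : 0 <= n%:R ^+ 3 :> R by rewrite exprn_ge0// ltW.
have [Yn|Yn] := leP Y (n%:R ^+ 7).
  have l7 : ln d%:R <= 7 * ln n%:R :> R.
    apply: (le_trans dl); rewrite mulr_natl -lnXn// ler_ln ?posrE// exprn_gt0//.
  have l8 : ln d%:R ^+ 8 <= 7 ^+ 8 * ln n%:R ^+ 8 :> R.
    rewrite -exprMn; apply: lerXn2r; rewrite ?nnegrE//; lra.
  apply: (@le_trans _ _ (n%:R ^+ 3 * (7 ^+ 8 * ln n%:R ^+ 8))); first exact: ler_wpM2l.
  have -> : n%:R ^+ 3 * (7 ^+ 8 * ln n%:R ^+ 8) =
      eta * (7 ^+ 8 / eta * (n%:R ^+ 3 * ln n%:R ^+ 8)) :> R.
    by field; rewrite lt0r_neq0.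
  by rewrite ler_wpM2l// ltW.
set l := ln Y in dl ll *.
have YE : Y = expR l by rewrite /l lnK ?posrE.
have l1 : 1 <= l by lra.
have nl : n%:R <= expR (l / 7) :> R.
  rewrite -(@ler_pXn2r _ 7) ?nnegrE ?expR_ge0 ?(ltW n0)// -expRM_natl.
  have -> : 7 * (l / 7) = l by lra.
  by rewrite -YE ltW.
have n3 : n%:R ^+ 3 <= expR (3 * l / 7) :> R.
  have -> : 3 * l / 7 = 3%:R * (l / 7) by lra.
  by rewrite expRM_natl; apply: lerXn2r; rewrite ?nnegrE ?expR_ge0// ltW.
have e9 : c * l ^+ 9 <= expR (4 * l / 7).
  have -> : 4 * l / 7 = 9%:R * (4 / 63 * l) by lra.
  rewrite expRM_natl /c -exprMn; apply: lerXn2r; rewrite ?nnegrE ?expR_ge0//; first by lra.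
  by have := expR_ge1Dx (4 / 63 * l); lra.
have l8 : ln d%:R ^+ 8 <= l ^+ 8 by apply: lerXn2r; rewrite ?nnegrE//; lra.
have l8e : l ^+ 8 <= eta * expR (4 * l / 7).
  apply: (@le_trans _ _ (eta * (c * l ^+ 9))); last by rewrite ler_wpM2l// ltW.
  have -> : eta * (c * l ^+ 9) = (eta * c * l) * l ^+ 8 by ring.
  rewrite ler_peMl ?exprn_ge0//; first by lra.
  have ec : 0 < eta * c by exact: mulr_gt0.
  by have := ler_wpM2l (ltW ec) ll; rewrite /l0 mulfV// lt0r_neq0.
apply: (@le_trans _ _ (expR (3 * l / 7) * (eta * expR (4 * l / 7)))).
  apply: ler_pM => //; first by rewrite exprn_ge0//; lra.
  exact: le_trans l8 l8e.
have -> : expR (3 * l / 7) * (eta * expR (4 * l / 7)) = eta * (expR (3 * l / 7) * expR (4 * l / 7)).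
  by ring.
by rewrite -expRD YE; have -> : 3 * l / 7 + 4 * l / 7 = l by lra.
Qed.

(** In this regime [1 / d <= ln d / q], so [shift <= 7 ln d / q], while [pbound'] is of order
    [q / d]: the leading term [d * shift^3 * pbound'^2] is of order [ln^3 d / (d q)]. The constants
    are [7 + 49 = 56] and [2 * 343 + 2401 <= 56 * 56]. *)
Lemma small_q_rates q d : 1 <= q -> (4 <= d)%N -> q * ln d%:R <= d%:R ->
  (shift q d + shift q d ^+ 2) * pbound' q d <=
    ((56 * 56) * pconst ^+ 2) * (ln d%:R ^+ 4 / d%:R) /\
  d%:R * ((2 * shift q d ^+ 3 + shift q d ^+ 4) * pbound' q d ^+ 2) <=
    ((56 * 56) * pconst ^+ 2) * (ln d%:R ^+ 8 / (d%:R * q)).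
Proof.
move=> q1 d4 qd; have d2 : (1 < d)%N by lia.
have L1 := ln_ge1 d4; have sh0 := shift_ge0 q1 d2; have pb0 := pbound'_ge0 d q1.
have pbl := pbound'_le q1 d2; have K1 := pconst_ge1.
have D0 : 0 < d%:R :> R by rewrite ltr0n; lia.
have shE : shift q d = d%:R^-1 + 6 * (ln d%:R / q) by [].
move: sh0 pb0 pbl shE; move: (shift q d) (pbound' q d) => s pb s0 pb0 pbl shE.
move: pconst K1 pbl => K K1 pbl.
move: (d%:R) (ln d%:R) L1 qd D0 shE pbl => D L L1 qd D0 shE pbl.
have q0 : 0 < q by lra.
pose i := q^-1; have i0 : 0 < i by rewrite invr_gt0.
have i1 : i <= 1 by rewrite invf_le1.
have qi : q * i = 1 by rewrite mulfV// lt0r_neq0.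
pose j := D^-1; have j0 : 0 < j by rewrite invr_gt0.
have Dj : D * j = 1 by rewrite mulfV// lt0r_neq0.
have ji : j <= L * i.
  rewrite /j /i -[leLHS]mul1r ler_pdivrMr// mulrAC ler_pdivlMr// mul1r.
  apply: (@le_trans _ _ (q * L)); first by rewrite ler_peMr// ltW.
  by apply: (le_trans qd); rewrite ler_peMl// ltW.
have sl : s <= 7 * (L * i) by rewrite shE -/i -/j; lra.
have Li0 : 0 <= L * i by rewrite mulr_ge0//; lra.
have s7 m : s ^+ m <= (7 * (L * i)) ^+ m by apply: lerXn2r; rewrite ?nnegrE//; lra.
have Lp m k : (m <= k)%N -> L ^+ m <= L ^+ k by move=> mk; exact: ler_weXn2l.
have Lg m : 0 <= L ^+ m by rewrite exprn_ge0//; lra.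
have ip m k : (m <= k)%N -> i ^+ k <= i ^+ m.
  by move=> mk; apply: (@ler_wiXn2l _ i) => //; exact: ltW.
have ig m : 0 <= i ^+ m by rewrite exprn_ge0// ltW.
have K2 : K <= K ^+ 2 by rewrite expr2 ler_peMl//; lra.
have A1 : s + s ^+ 2 <= 56 * (L ^+ 4 * i).
  have a := ler_pM (Lg 1) (ig 1) (Lp 1 4 isT) (lexx _).
  have b := ler_pM (Lg 2) (ig 2) (Lp 2 4 isT) (ip 1 2 isT).
  by have := s7 2; rewrite !exprMn !expr1 in a b *; lra.
have A2 : 2 * s ^+ 3 + s ^+ 4 <= (56 * 56) * (L ^+ 8 * i ^+ 3).
  have a := ler_pM (Lg 3) (ig 3) (Lp 3 8 isT) (lexx _).
  have b := ler_pM (Lg 4) (ig 4) (Lp 4 8 isT) (ip 3 4 isT).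
  have e3 : (7 * (L * i)) ^+ 3 = 343 * (L ^+ 3 * i ^+ 3) by ring.
  have e4 : (7 * (L * i)) ^+ 4 = (49 * 49) * (L ^+ 4 * i ^+ 4) by ring.
  have g := mulr_ge0 (Lg 8%N) (ig 3%N).
  by have := s7 3; have := s7 4; rewrite e3 e4; lra.
split.
  apply: (@le_trans _ _ (56 * (L ^+ 4 * i) * (K * (q * j)))).
    by apply: ler_pM => //; rewrite addr_ge0// exprn_ge0.
  have -> : 56 * (L ^+ 4 * i) * (K * (q * j)) = (q * i) * (56 * K * (L ^+ 4 * j)) by ring.
  rewrite qi mul1r ler_wpM2r//; last by lra.
  by rewrite mulr_ge0// ltW.
apply: (@le_trans _ _ (D * (((56 * 56) * (L ^+ 8 * i ^+ 3)) * (K * (q * j)) ^+ 2))).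
  rewrite ler_wpM2l ?(ltW D0)//; apply: ler_pM => //.
  - by rewrite addr_ge0 ?mulr_ge0 ?exprn_ge0.
  - exact: sqr_ge0.
  - by apply: lerXn2r; rewrite ?nnegrE// (le_trans pb0).
rewrite invfM -/i -/j.
have -> : D * (((56 * 56) * (L ^+ 8 * i ^+ 3)) * (K * (q * j)) ^+ 2) =
   (D * j) * (q * i) ^+ 2 * ((56 * 56) * K ^+ 2 * (L ^+ 8 * (j * i))) by ring.
by rewrite Dj qi expr1n !mul1r.
Qed.

(** [B] is the constant in [shift <= B ln^2 d / d]; the factors 3 and 9 come from [pbound' <= 3],
    and the final 1 keeps the constant at least 1. *)
Definition large_q_const (c : R) : R :=
  let B := 1 + 6 / c in 9 * (2 * B ^+ 3 + B ^+ 4) + 3 * (B + B ^+ 2) + 1.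

(** Here the trivial bound on [pbound'] is enough, because [c d / ln d <= q] makes [shift] itself of
    order [ln^2 d / d]. *)
Lemma large_q_rates c q d : 0 < c -> 1 <= q -> (4 <= d)%N -> c * d%:R / ln d%:R <= q ->
  (shift q d + shift q d ^+ 2) * pbound' q d <=
    large_q_const c * (ln d%:R ^+ 4 / d%:R) /\
  d%:R * ((2 * shift q d ^+ 3 + shift q d ^+ 4) * pbound' q d ^+ 2) <=
    large_q_const c * (ln d%:R ^+ 8 / d%:R ^+ 2).
Proof.
move=> c0 q1 d4 qd; have d2 : (1 < d)%N by lia.
have L1 := ln_ge1 d4; have sh0 := shift_ge0 q1 d2; have pb0 := pbound'_ge0 d q1.
have pbl := pbound'_le3 q d.
have D1 : 1 <= d%:R :> R by rewrite ler1n; lia.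
have shE : shift q d = d%:R^-1 + 6 * (ln d%:R / q) by [].
move: sh0 pb0 pbl shE; move: (shift q d) (pbound' q d) => s pb s0 pb0 pbl shE.
move: (d%:R) (ln d%:R) L1 qd D1 shE => D L L1 qd D1 shE.
have q0 : 0 < q by lra.
have D0 : 0 < D by lra.
have L0 : 0 < L by lra.
pose j := D^-1; have j0 : 0 < j by rewrite invr_gt0.
have j1 : j <= 1 by rewrite invf_le1.
have Dj : D * j = 1 by rewrite mulfV// lt0r_neq0.
have Lq : L / q <= c^-1 * (L ^+ 2 * j).
  rewrite ler_pdivrMr//; move: qd; rewrite ler_pdivrMr// => qd.
  have -> : L = c^-1 * (L * j) * (c * D) by rewrite /j; field; rewrite !lt0r_neq0.
  have -> : c^-1 * ((c^-1 * (L * j) * (c * D)) ^+ 2 * j) * q = c^-1 * (L * j) * (q * L).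
    by rewrite /j; field; rewrite !lt0r_neq0.
  by rewrite ler_wpM2l// !mulr_ge0 ?invr_ge0// ltW.
rewrite /large_q_const; set B := 1 + 6 / c.
have B1 : 1 <= B by rewrite lerDl divr_ge0// ltW.
have L21 : 1 <= L ^+ 2 by exact: exprn_ege1.
have jL : j <= L ^+ 2 * j by rewrite -[leLHS]mul1r ler_wpM2r// ltW.
have sl : s <= B * (L ^+ 2 * j).
  have -> : B * (L ^+ 2 * j) = L ^+ 2 * j + 6 * (c^-1 * (L ^+ 2 * j)) by rewrite /B; ring.
  by rewrite shE -/j; lra.
have Lg m : 0 <= L ^+ m by rewrite exprn_ge0// ltW.
have Bg m : 0 <= B ^+ m by rewrite exprn_ge0//; lra.
have s7 m : s ^+ m <= (B * (L ^+ 2 * j)) ^+ m.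
  by apply: lerXn2r; rewrite ?nnegrE// !mulr_ge0 ?(ltW j0)//; lra.
have Lp m k : (m <= k)%N -> L ^+ m <= L ^+ k by move=> mk; exact: ler_weXn2l.
have jp m k : (m <= k)%N -> j ^+ k <= j ^+ m.
  by move=> mk; apply: (@ler_wiXn2l _ j) => //; exact: ltW.
have jg m : 0 <= j ^+ m by rewrite exprn_ge0// ltW.
have A1 : s + s ^+ 2 <= (B + B ^+ 2) * (L ^+ 4 * j).
  have a := ler_pM (Lg 2) (jg 1) (Lp 2 4 isT) (lexx _).
  have b := ler_pM (Lg 4) (jg 2) (lexx _) (jp 1 2 isT).
  have a' := ler_wpM2l (Bg 1) a; have b' := ler_wpM2l (Bg 2) b.
  have := s7 2; have -> : (B * (L ^+ 2 * j)) ^+ 2 = B ^+ 2 * (L ^+ 4 * j ^+ 2) by ring.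
  by rewrite !expr1 in a' b' *; lra.
have A2 : 2 * s ^+ 3 + s ^+ 4 <= (2 * B ^+ 3 + B ^+ 4) * (L ^+ 8 * j ^+ 3).
  have a := ler_pM (Lg 6) (jg 3) (Lp 6 8 isT) (lexx _).
  have b := ler_pM (Lg 8) (jg 4) (lexx _) (jp 3 4 isT).
  have a' := ler_wpM2l (Bg 3) a; have b' := ler_wpM2l (Bg 4) b.
  have e3 : (B * (L ^+ 2 * j)) ^+ 3 = B ^+ 3 * (L ^+ 6 * j ^+ 3) by ring.
  have e4 : (B * (L ^+ 2 * j)) ^+ 4 = B ^+ 4 * (L ^+ 8 * j ^+ 4) by ring.
  by have := s7 3; have := s7 4; rewrite e3 e4; lra.
have B2g := Bg 2; have B3g := Bg 3; have B4g := Bg 4.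
split.
  apply: (@le_trans _ _ ((B + B ^+ 2) * (L ^+ 4 * j) * 3)).
    by apply: ler_pM => //; rewrite addr_ge0// exprn_ge0.
  have -> : (B + B ^+ 2) * (L ^+ 4 * j) * 3 = 3 * (B + B ^+ 2) * (L ^+ 4 * j) by ring.
  by rewrite ler_wpM2r ?mulr_ge0 ?(ltW j0)//; lra.
apply: (@le_trans _ _ (D * (((2 * B ^+ 3 + B ^+ 4) * (L ^+ 8 * j ^+ 3)) * 3 ^+ 2))).
  rewrite ler_wpM2l ?(ltW D0)//; apply: ler_pM => //.
  - by rewrite addr_ge0 ?mulr_ge0 ?exprn_ge0.
  - exact: sqr_ge0.
  - by apply: lerXn2r; rewrite ?nnegrE.
rewrite -exprVn -/j.
have -> : D * (((2 * B ^+ 3 + B ^+ 4) * (L ^+ 8 * j ^+ 3)) * 3 ^+ 2) =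
   (D * j) * (9 * (2 * B ^+ 3 + B ^+ 4) * (L ^+ 8 * j ^+ 2)) by ring.
by rewrite Dj mul1r ler_wpM2r ?mulr_ge0//; lra.
Qed.

Lemma small_q_tv eps : 0 < eps -> exists2 M : R, 0 < M &
  forall n d q tau, 1 <= q -> is_median_thr d q tau -> (4 <= n)%N -> (4 <= d)%N ->
    q * ln d%:R <= d%:R -> M <= d%:R * q / (n%:R ^+ 3 * ln (n%:R : R) ^+ 8) ->
    tv_rgg_er n d q tau <= eps.
Proof.
move=> eps0.
have A1 : 1 <= (56 * 56) * pconst ^+ 2.
  have := exprn_ege1 2 pconst_ge1; clear; move: (pconst ^+ 2) => c c1; lra.
have [eta eta0 H] := tv_small A1 eps0.
have [M M0 HM] := polylog_absorb eta0; exists M => //.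
move=> n d q tau q1 med n4 d4 qd.
have n1 : (0 < n)%N by lia.
have d2 : (1 < d)%N by lia.
have L1 := ln_ge1 d4; have ln1' := ln_ge1 n4.
have D1 : 1 <= d%:R :> R by rewrite ler1n; lia.
have P0 : 0 < n%:R ^+ 3 * ln (n%:R : R) ^+ 8.
  by apply: mulr_gt0; apply: exprn_gt0; [rewrite ltr0n|exact: lt_le_trans ln1'].
rewrite ler_pdivlMr// => MY.
have [r1 r2] := small_q_rates q1 d4 qd.
have D0 : 0 <= d%:R :> R by rewrite ler0n.
have dq : d%:R <= d%:R * q by rewrite ler_peMr.
have qD : q <= d%:R.
  by apply: le_trans qd; rewrite ler_peMr//; exact: le_trans q1.
apply: (H n d q tau (d%:R * q)) => //.
- by apply: lt_le_trans dq; exact: lt_le_trans D1.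
- apply: (@le_trans _ _ (d%:R ^+ 2)); first by rewrite expr2 ler_wpM2l.
  by rewrite ler_peMl// exprn_ge0.
- exact: HM.
Qed.

Lemma large_q_tv c eps : 0 < c -> 0 < eps -> exists2 M : R, 0 < M &
  forall n d q tau, 1 <= q -> is_median_thr d q tau -> (4 <= n)%N ->
    c * d%:R / ln d%:R <= q -> M <= d%:R ^+ 2 / (n%:R ^+ 3 * ln (n%:R : R) ^+ 8) ->
    tv_rgg_er n d q tau <= eps.
Proof.
move=> c0 eps0.
have A1 : 1 <= large_q_const c.
  rewrite /large_q_const; have B0 : 0 <= 1 + 6 / c by rewrite addr_ge0// divr_ge0// ltW.
  have := (exprn_ge0 2 B0, exprn_ge0 3 B0, exprn_ge0 4 B0); move: B0; clear.
  by move: (1 + 6 / c) => B B0 [[]]; move: (B ^+ 2) (B ^+ 3) (B ^+ 4) => *; lra.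
have [eta eta0 H] := tv_small A1 eps0.
have [M M0 HM] := polylog_absorb eta0.
(* The value [4 ^+ 2] forces [4 <= d]: in this regime the growth of [d] is extracted from that of
   [d ^+ 2]. *)
exists (Num.max M (4 ^+ 2)); first by rewrite lt_max M0.
move=> n d q tau q1 med n4 qd MY.
have ln1' := ln_ge1 n4.
have P1 : 1 <= n%:R ^+ 3 * ln (n%:R : R) ^+ 8.
  by apply: mulr_ege1; apply: exprn_ege1 => //; rewrite ler1n; exact: leq_trans n4.
have P0 : 0 < n%:R ^+ 3 * ln (n%:R : R) ^+ 8 by exact: lt_le_trans P1.
move: MY; rewrite ler_pdivlMr// => MY.
have d4 : (4 <= d)%N.
  rewrite -(ler_nat R) -(@ler_pXn2r _ 2) ?nnegrE ?ler0n//; apply: le_trans MY.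
  apply: (@le_trans _ _ (4 ^+ 2 * (n%:R ^+ 3 * ln (n%:R : R) ^+ 8))).
    by rewrite ler_peMr// exprn_ge0.
  by rewrite ler_wpM2r ?(ltW P0)// le_max lexx orbT.
have n1 : (0 < n)%N by exact: leq_trans n4.
have d2 : (1 < d)%N by exact: leq_trans d4.
have L1 := ln_ge1 d4.
have D1 : 1 <= d%:R :> R by rewrite ler1n; exact: ltnW.
have [r1 r2] := large_q_rates c0 q1 d4 qd.
apply: (H n d q tau (d%:R ^+ 2)) => //.
- by apply: exprn_gt0; exact: lt_le_trans D1.
- by rewrite ler_peMl// exprn_ge0.
- apply: HM => //; first by rewrite expr2 ler_peMr.
  by apply: le_trans MY; rewrite ler_wpM2r ?(ltW P0)// le_max lexx.
Qed.

End Rates.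

Theorem theorem1p8 (R : realType) :
  exists C : nat,
  (forall (d : nat -> nat) (q tau : nat -> R),
     (forall n, 1 <= q n) ->
     (forall n, is_median_thr (d n) (q n) (tau n)) ->
     ((fun n => (d n)%:R : R) @ \oo --> +oo) ->
     ((fun n => q n * ln ((d n)%:R : R) / (d n)%:R) @ \oo --> 0) ->
     ((fun n => (d n)%:R * q n / ((n%:R : R) ^+ 3 * (ln (n%:R : R)) ^+ C)) @ \oo --> +oo) ->
     ((fun n => tv_rgg_er n (d n) (q n) (tau n)) @ \oo --> 0))
  /\
  (forall (d : nat -> nat) (q tau : nat -> R),
     (forall n, 1 <= q n) ->
     (forall n, is_median_thr (d n) (q n) (tau n)) ->
     (exists c : R, 0 < c /\
        \forall n \near \oo, c * (d n)%:R / ln ((d n)%:R : R) <= q n) ->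
     ((fun n => ((d n)%:R : R) ^+ 2 / ((n%:R : R) ^+ 3 * (ln (n%:R : R)) ^+ C)) @ \oo --> +oo) ->
     ((fun n => tv_rgg_er n (d n) (q n) (tau n)) @ \oo --> 0)).
Proof.
(* The exponent is that of the logarithm in [shift ^+ 4], with [shift] of order [ln^2 d / d] in the
   second regime; [polylog_absorb] trades [ln d] for [ln n] at the same power. *)
exists 8%N; split=> d q tau q1 med.
  move=> dinf qd0 dq; apply/cvgr0Pnorm_le => eps eps0.
  have [M M0 H] := small_q_tv eps0.
  near=> n; rewrite ger0_norm; last first.
    by apply: mulr_ge0; [rewrite invr_ge0|apply: sumr_ge0 => G _; exact: normr_ge0].
  have D4 : 4 <= (d n)%:R :> R by near: n; move/cvgryPge : dinf; exact.
  have D0 : 0 < (d n)%:R :> R by exact: lt_le_trans D4.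
  apply: H => //.
  - by near: n; exact: nbhs_infty_ge.
  - by rewrite -(ler_nat R).
  - have h : `|q n * ln (d n)%:R / (d n)%:R| <= 1.
      by near: n; move/cvgr0Pnorm_le : qd0; exact.
    by have := le_trans (ler_norm _) h; rewrite ler_pdivrMr// mul1r.
  - by near: n; move/cvgryPge : dq; exact.
move=> [c [c0 qc]] dd; apply/cvgr0Pnorm_le => eps eps0.
have [M M0 H] := large_q_tv c0 eps0.
near=> n; rewrite ger0_norm; last first.
  by apply: mulr_ge0; [rewrite invr_ge0|apply: sumr_ge0 => G _; exact: normr_ge0].
apply: H => //.
- by near: n; exact: nbhs_infty_ge.
- by near: n.
- by near: n; move/cvgryPge : dd; exact.
Unshelve. all: by end_near.
Qed.
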